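(* Let $\phi\in\mathcal{S}(\mathbb{R}^{n})$ be such that $\int_{\mathbb{R}^n}\phi(t)\,dt=1$ and let $L$ be slowly varying at the origin (resp. at infinity). Let $\mathbf{f}\in\mathcal{S}'(\mathbb{R}^{n},E)$, $\alpha\in\mathbb{R}$ and $x_0\in\mathbb{R}^n$. The following two conditions together, namely: (a) for each $(x,y)\in\mathbb{H}^{n+1}\cap\mathbb{S}^{n}$ the limit $$\lim_{\varepsilon\to0^{+}}\frac{1}{\varepsilon^{\alpha}L(\varepsilon)}F_{\phi}\mathbf{f}(x_{0}+\varepsilon x,\varepsilon y)=F_{x,y}\qquad\left(\text{resp. } \lim_{\lambda\to\infty}\frac{1}{\lambda^{\alpha}L(\lambda)}F_{\phi}\mathbf{f}(\lambda x,\lambda y)=F_{x,y}\right)$$ exists in $E$; and (b) for some $k\in\mathbb{N}$, $$\limsup_{\varepsilon\rightarrow0^+}\ \sup_{|x|^2+y^2=1,\,y>0}\frac{y^k}{\varepsilon^{\alpha}L(\varepsilon)}\left\|F_{\phi}\mathbf{f}\left(x_0+\varepsilon x,\varepsilon y\right)\right\|<\infty$$ $$\left(\text{resp. } \limsup_{\lambda\rightarrow\infty}\ \sup_{|x|^2+y^2=1,\,y>0}\frac{y^k}{\lambda^{\alpha}L(\lambda)}\left\|F_{\phi}\mathbf{f}\left(\lambda x,\lambda y\right)\right\|<\infty\right),$$ are necessary and sufficient for the existence of a homogeneous distribution $\mathbf{g}\in\mathcal{S}'(\mathbb{R}^{n},E)$ (of degree $\alpha$) such that $$\mathbf{f}(x_{0}+\varepsilon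 t)\sim \varepsilon^{\alpha}L(\varepsilon)\mathbf{g}(t)\ \text{ as } \varepsilon\to0^{+}\ \text{ in } \mathcal{S}'(\mathbb{R}^{n},E)$$ $$\left(\text{resp. }\mathbf{f}\left(\lambda t\right)\sim\lambda^{\alpha}L(\lambda)\mathbf{g}(t) \ \text{ as } \lambda\to\infty \ \text{ in } \mathcal{S}'(\mathbb{R}^{n},E)\right).$$ In such a case, $\mathbf{g}$ is completely determined by $F_{\phi}\mathbf{g}(x,y)=F_{x,y}$.
   Context: $E$ is a Banach space with norm $\|\cdot\|$; $\mathbb{N}$ includes $0$; $\mathbb{H}^{n+1}=\mathbb{R}^n\times(0,\infty)$; $\mathbb{S}^{n}$ is the unit sphere of $\mathbb{R}^{n+1}$. $\mathcal{S}'(\mathbb{R}^n,E)$ is the space of continuous linear maps $\mathcal{S}(\mathbb{R}^n)\to E$. For $\phi\in\mathcal{S}(\mathbb{R}^n)$ with $\int\phi=1$, the $\phi$-transform of $\mathbf{f}\in\mathcal{S}'(\mathbb{R}^n,E)$ is $F_\phi\mathbf{f}(x,y)=\langle\mathbf{f}(x+yt),\phi(t)\rangle=\langle\mathbf{f}(t),y^{-n}\phi((t-x)/y)\rangle\in E$, $(x,y)\in\mathbb{H}^{n+1}$. A measurable positive function $L$ on $(0,A]$ (resp. $[A,\infty)$), $A>0$, is slowly varying at the origin (resp. at infinity) if $L(a\varepsilon)/L(\varepsilon)\to1$ as $\varepsilon\to0^+$ (resp. $L(a\lambda)/L(\lambda)\to1$ as $\lambda\to\infty$) for each $a>0$. $\mathbf{f}(x_0+\varepsilon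 t)\sim\varepsilon^\alpha L(\varepsilon)\mathbf{g}(t)$ as $\varepsilon\to0^+$ in $\mathcal{S}'(\mathbb{R}^n,E)$ means that for each $\varphi\in\mathcal{S}(\mathbb{R}^n)$, $\langle\mathbf{f}(x_0+\varepsilon t),\varphi(t)\rangle/(\varepsilon^\alpha L(\varepsilon))\to\langle\mathbf{g},\varphi\rangle$ in the norm of $E$; similarly $\mathbf{f}(\lambda t)\sim\lambda^\alpha L(\lambda)\mathbf{g}(t)$ as $\lambda\to\infty$. A distribution $\mathbf{g}$ is homogeneous of degree $\alpha$ if $\mathbf{g}(at)=a^\alpha\mathbf{g}(t)$ for all $a>0$. *)

(* Defs.v *)
From HB Require Import structures.
From mathcomp Require Import all_boot all_order all_algebra.
From mathcomp Require Import all_classical all_reals all_analysis.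
From mathcomp Require Import measurable_realfun complex ring.

Set Implicit Arguments.
Unset Strict Implicit.
Unset Printing Implicit Defensive.

Import Order.TTheory GRing.Theory Num.Theory.
Import numFieldNormedType.Exports.

Local Open Scope classical_set_scope.
Local Open Scope ring_scope.
Local Open Scope complex_scope.

(* The norm of a normed module over R[i] takes its values in R[i]; it is
   always of the form r%:C, and rnorm is that r. *)
Definition rnorm (R : realType) (V : normedZmodType R[i]) (v : V) : R :=
  complex.Re `|v|.

Section RnormTheory.
Variables (R : realType) (V : normedZmodType R[i]).
Implicit Types u v : V.

Lemma rnormE v : `|v| = (rnorm v)%:C.
Proof.
rewrite /rnorm; have := normr_ge0 v.
by case: `|v| => a b; rewrite lecE /= => /andP[/eqP -> _].
Qed.

Lemma rnorm_ge0 v : 0 <= rnorm v.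
Proof. by have := normr_ge0 v; rewrite rnormE lecR. Qed.

Lemma rnorm0 : rnorm (0 : V) = 0.
Proof. by rewrite /rnorm normr0. Qed.

Lemma ler_rnormD u v : rnorm (u + v) <= rnorm u + rnorm v.
Proof. by rewrite -lecR -rnormE rmorphD /= -!rnormE ler_normD. Qed.
End RnormTheory.

Lemma rnormM (R : realType) (a b : R[i]) : rnorm (a * b) = rnorm a * rnorm b.
Proof. by rewrite {1}/rnorm normrM !rnormE -rmorphM. Qed.

Section Schwartz.
Variables (R : realType) (n : nat).
Implicit Types (u v : 'rV[R]_n -> R[i]^o) (s : seq 'I_n) (i : 'I_n).

Definition pderiv i u : 'rV[R]_n -> R[i]^o := fun x =>
  'D_(delta_mx ord0 i) (fun t => complex.Re (u t)) x +i*
  'D_(delta_mx ord0 i) (fun t => complex.Im (u t)) x.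

(* Multi-indices are words of coordinate indices. *)
Definition pderivs s u : 'rV[R]_n -> R[i]^o := foldr pderiv u s.

Definition cdifferentiable u := forall x,
  differentiable (fun t => complex.Re (u t)) x /\
  differentiable (fun t => complex.Im (u t)) x.

Definition smooth u := forall s, cdifferentiable (pderivs s u).

(* `|x| is the sup norm on 'rV[R]_n. *)
Definition is_schwartz u := smooth u /\
  forall (k : nat) s, exists M : R, forall x,
    (1 + `|x|) ^+ k * rnorm (pderivs s u x) <= M.

Definition schwartz_pred : {pred 'rV[R]_n -> R[i]^o} :=
  fun u => `[< is_schwartz u >].

Record schwartz := Schwartz {
  schwartz_fun :> 'rV[R]_n -> R[i]^o;
  schwartz_funP : schwartz_fun \in schwartz_pred }.

HB.instance Definition _ := [isSub for schwartz_fun].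
HB.instance Definition _ := [Choice of schwartz by <:].

Lemma schwartzP (phi : schwartz) : is_schwartz phi.
Proof. exact/asboolP/schwartz_funP. Qed.

Lemma Re_lin (a : R[i]) u v : (fun t => complex.Re ((a *: u + v) t)) =
  complex.Re a *: (fun t => complex.Re (u t)) +
  (- complex.Im a) *: (fun t => complex.Im (u t)) + (fun t => complex.Re (v t)).
Proof.
apply/funext => t.
have -> : (a *: u + v) t = a * u t + v t by [].
rewrite !fctE /=; move: a (u t) (v t) => [a1 a2] [u1 u2] [v1 v2] /=.
by rewrite scaleNr.
Qed.

Lemma Im_lin (a : R[i]) u v : (fun t => complex.Im ((a *: u + v) t)) =
  complex.Re a *: (fun t => complex.Im (u t)) +
  complex.Im a *: (fun t => complex.Re (u t)) + (fun t => complex.Im (v t)).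
Proof.
apply/funext => t.
have -> : (a *: u + v) t = a * u t + v t by [].
by rewrite !fctE /=; move: a (u t) (v t) => [a1 a2] [u1 u2] [v1 v2].
Qed.

Lemma differentiable_lin (p q : R) (f g h : 'rV[R]_n -> R) (x : 'rV[R]_n) :
  differentiable f x -> differentiable g x -> differentiable h x ->
  differentiable (p *: f + q *: g + h) x.
Proof.
move=> df dg dh.
have dpf : differentiable (p *: f) x by exact: differentiableZ.
have dqg : differentiable (q *: g) x by exact: differentiableZ.
exact: (differentiableD (differentiableD dpf dqg) dh).
Qed.

Lemma derive_lin (p q : R) (f g h : 'rV[R]_n -> R) (x v : 'rV[R]_n) :
  differentiable f x -> differentiable g x -> differentiable h x ->
  'D_v (p *: f + q *: g + h) x = p * 'D_v f x + q * 'D_v g x + 'D_v h x.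
Proof.
move=> df dg dh.
have df' : derivable f x v by exact: diff_derivable.
have dg' : derivable g x v by exact: diff_derivable.
have dh' : derivable h x v by exact: diff_derivable.
have dpf : derivable (p *: f) x v by exact: derivableZ.
have dqg : derivable (q *: g) x v by exact: derivableZ.
by rewrite (deriveD (derivableD dpf dqg) dh') (deriveD dpf dqg) !deriveZ.
Qed.

Lemma pderiv_lin i (a : R[i]) u v : cdifferentiable u -> cdifferentiable v ->
  pderiv i (a *: u + v) = a *: pderiv i u + pderiv i v.
Proof.
move=> du dv; apply/funext => x; rewrite /pderiv !Re_lin !Im_lin.
have [ur ui] := du x; have [vr vi] := dv x.
rewrite !derive_lin //.
have -> : (a *: pderiv i u + pderiv i v) x = a * pderiv i u x + pderiv i v x by [].
rewrite /pderiv; case: a => p q /=; simpc.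
by [].
Qed.

Lemma cdiff_lin (a : R[i]) u v : cdifferentiable u -> cdifferentiable v ->
  cdifferentiable (a *: u + v).
Proof.
move=> du dv x; rewrite Re_lin Im_lin.
have [ur ui] := du x; have [vr vi] := dv x.
by split; apply: differentiable_lin.
Qed.

Lemma pderivs_lin s (a : R[i]) u v : smooth u -> smooth v ->
  pderivs s (a *: u + v) = a *: pderivs s u + pderivs s v.
Proof.
move=> su sv; elim: s => [//|i s IH] /=.
by rewrite IH pderiv_lin.
Qed.

Lemma smooth_lin (a : R[i]) u v : smooth u -> smooth v -> smooth (a *: u + v).
Proof.
move=> su sv s; rewrite pderivs_lin //.
exact: cdiff_lin.
Qed.

Lemma pderiv0 i : pderiv i 0 = 0.
Proof.
apply/funext => x; rewrite /pderiv /=.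
by rewrite !derive_cst.
Qed.

Lemma pderivs0 s : pderivs s 0 = 0.
Proof. by elim: s => [//|i s IH] /=; rewrite IH pderiv0. Qed.

Lemma schwartz_submod_closed : submod_closed schwartz_pred.
Proof.
split=> [|a u v /asboolP[su bu] /asboolP[sv bv]]; apply/asboolP.
- split=> [s x|k s]; rewrite pderivs0.
    by split; exact: differentiable_cst.
  by exists 0 => x; rewrite rnorm0 mulr0.
- split=> [|k s]; first exact: smooth_lin.
  have [M hM] := bu k s; have [N hN] := bv k s.
  exists (rnorm a * M + N) => x; rewrite pderivs_lin //.
  have w0 : 0 <= (1 + `|x|) ^+ k by rewrite exprn_ge0 // addr_ge0.
  apply: (le_trans (ler_wpM2l w0 (ler_rnormD _ _))).
  rewrite mulrDr lerD // rnormM mulrCA ler_wpM2l // rnorm_ge0 //.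
Qed.

HB.instance Definition _ :=
  GRing.isSubmodClosed.Build _ _ schwartz_pred schwartz_submod_closed.
HB.instance Definition _ := [SubChoice_isSubLmodule of schwartz by <:].

Definition seminorm (k : nat) s (phi : schwartz) : R :=
  sup [set (1 + `|x|) ^+ k * rnorm (pderivs s phi x) | x in [set: 'rV[R]_n]].

Lemma seminorm_ub k s (phi : schwartz) x :
  (1 + `|x|) ^+ k * rnorm (pderivs s phi x) <= seminorm k s phi.
Proof.
have [_ /(_ k s)[M hM]] := schwartzP phi.
apply: ub_le_sup; last by exists x.
by exists M => _ [t _ <-].
Qed.

Lemma seminorm_leP k s (phi : schwartz) M :
  (forall x, (1 + `|x|) ^+ k * rnorm (pderivs s phi x) <= M) ->
  seminorm k s phi <= M.
Proof.
move=> hM; apply: ge_sup; last by move=> _ [x _ <-].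
by eexists; exists 0.
Qed.

Lemma seminorm0 k s : seminorm k s 0 <= 0.
Proof.
apply: seminorm_leP => x.
by rewrite [schwartz_fun _]/(0 : _ -> _) pderivs0 rnorm0 mulr0.
Qed.

Lemma ler_seminormD k s (phi psi : schwartz) :
  seminorm k s (phi + psi) <= seminorm k s phi + seminorm k s psi.
Proof.
apply: seminorm_leP => x.
have [sp _] := schwartzP phi; have [sq _] := schwartzP psi.
have -> : pderivs s (phi + psi) x = pderivs s phi x + pderivs s psi x.
  have -> : schwartz_fun (phi + psi) = 1 *: (phi : _ -> R[i]^o) + psi.
    by rewrite scale1r.
  by rewrite pderivs_lin // scale1r.
have w0 : 0 <= (1 + `|x|) ^+ k by rewrite exprn_ge0 // addr_ge0.
apply: (le_trans (ler_wpM2l w0 (ler_rnormD _ _))).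
by rewrite mulrDr lerD // seminorm_ub.
Qed.

(* Basic neighbourhoods for the locally convex topology defined by the
   family of all seminorms. *)
Definition sball (N : nat) (e : R) (phi : schwartz) : set schwartz :=
  [set psi | forall (k : nat) s, (k <= N)%N -> (size s <= N)%N ->
    seminorm k s (psi - phi) < e].

Definition snbhs (phi : schwartz) : set_system schwartz :=
  [set A | exists N (e : R), 0 < e /\ sball N e phi `<=` A].

HB.instance Definition _ := hasNbhs.Build schwartz snbhs.

Lemma sball_center N e phi : 0 < e -> sball N e phi phi.
Proof.
by move=> e0 k s _ _; rewrite subrr; exact: le_lt_trans (seminorm0 k s) e0.
Qed.

Lemma snbhs_filter (phi : schwartz) : ProperFilter (nbhs phi).
Proof.
split.
  by move=> [N [e [e0 /(_ phi)]]]; apply; exact: sball_center.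
split.
- by exists 0%N, 1; split.
- move=> A B [N [e [e0 hA]]] [M [d [d0 hB]]].
  exists (maxn N M), (Num.min e d); split; first by rewrite lt_min e0.
  move=> psi h; split; [apply: hA | apply: hB] => k s hk hs.
    have := h k s (leq_trans hk (leq_maxl _ _)) (leq_trans hs (leq_maxl _ _)).
    by rewrite lt_min => /andP[].
  have := h k s (leq_trans hk (leq_maxr _ _)) (leq_trans hs (leq_maxr _ _)).
  by rewrite lt_min => /andP[].
- by move=> A B AB [N [e [e0 hA]]]; exists N, e; split=> // psi /hA /AB.
Qed.

Lemma snbhs_singleton (phi : schwartz) (A : set schwartz) :
  nbhs phi A -> A phi.
Proof. by move=> [N [e [e0]]]; apply; exact: sball_center. Qed.

Lemma snbhs_nbhs (phi : schwartz) (A : set schwartz) :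
  nbhs phi A -> nbhs phi (nbhs^~ A).
Proof.
move=> [N [e [e0 hA]]]; exists N, (e / 2); split; first by rewrite divr_gt0.
move=> psi hpsi; exists N, (e / 2); split; first by rewrite divr_gt0.
move=> chi hchi; apply: hA => k s hk hs.
rewrite -(subrKA psi chi) [e]splitr.
by apply: le_lt_trans (ler_seminormD _ _ _ _) _; rewrite ltrD ?hchi ?hpsi.
Qed.

HB.instance Definition _ := Nbhs_isNbhsTopological.Build schwartz
  snbhs_filter snbhs_singleton snbhs_nbhs.

Lemma pderivsZ s (a : R[i]) u : smooth u -> pderivs s (a *: u) = a *: pderivs s u.
Proof.
move=> su; rewrite -[a *: u]addr0 pderivs_lin //; first by rewrite pderivs0 addr0.
by move=> r x; rewrite pderivs0; split; exact: differentiable_cst.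
Qed.

Lemma cdiffZ (a : R[i]) u : cdifferentiable u -> cdifferentiable (a *: u).
Proof.
move=> du; rewrite -[a *: u]addr0; apply: cdiff_lin => // x.
by split; exact: differentiable_cst.
Qed.

Lemma pderivZ i (a : R[i]) u : cdifferentiable u ->
  pderiv i (a *: u) = a *: pderiv i u.
Proof.
move=> du; rewrite -[a *: u]addr0 pderiv_lin //; first by rewrite pderiv0 addr0.
by move=> x; split; exact: differentiable_cst.
Qed.

Definition affcomp (x : 'rV[R]_n) (c : R) u : 'rV[R]_n -> R[i]^o :=
  fun t => u (c *: (t - x)).

Lemma is_diff_aff (x t : 'rV[R]_n) (c : R) :
  is_diff t (fun t : 'rV[R]_n => c *: (t - x)) (fun t => c *: t).
Proof.
have -> : (fun t => c *: t) = c *: (id - 0) :> ('rV[R]_n -> 'rV[R]_n).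
  by apply/funext => v; rewrite !fctE subr0.
exact: is_diffZ.
Qed.

Lemma cdiff_affcomp x c u : cdifferentiable u -> cdifferentiable (affcomp x c u).
Proof.
move=> du t; have [dr di] := du (c *: (t - x)).
have [da _] := is_diff_aff x t c.
split; first exact: (differentiable_comp da dr).
exact: (differentiable_comp da di).
Qed.

Lemma derive_aff (f : 'rV[R]_n -> R) (x t v : 'rV[R]_n) (c : R) :
  differentiable f (c *: (t - x)) ->
  'D_v (fun t => f (c *: (t - x))) t = c * 'D_v f (c *: (t - x)).
Proof.
move=> df; have [da dE] := is_diff_aff x t c.
rewrite [LHS]deriveE; last exact: (differentiable_comp da df).
rewrite (diff_comp da df) /= dE deriveE // linearZ.
by [].
Qed.

Lemma pderiv_affcomp i x c u : cdifferentiable u ->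
  pderiv i (affcomp x c u) = c%:C *: affcomp x c (pderiv i u).
Proof.
move=> du; apply/funext => t; have [dr di] := du (c *: (t - x)).
rewrite /pderiv /affcomp.
rewrite (derive_aff _ dr) (derive_aff _ di).
have -> : forall w : 'rV[R]_n -> R[i]^o, (c%:C *: w) t = c%:C * w t by [].
by simpc.
Qed.

Lemma pderivs_affcomp s x c u : smooth u ->
  pderivs s (affcomp x c u) = (c ^+ size s)%:C *: affcomp x c (pderivs s u).
Proof.
move=> su; elim: s => [|i s IH] /=; first by rewrite expr0 scale1r.
rewrite IH pderivZ; last exact: cdiff_affcomp.
by rewrite pderiv_affcomp // scalerA exprSr rmorphM.
Qed.

(* t |-> y^(-n) phi((t - x) / y) *)
Definition rescale_fun (x : 'rV[R]_n) (y : R) u : 'rV[R]_n -> R[i]^o :=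
  fun t => ((y^-1) ^+ n)%:C * u (y^-1 *: (t - x)).

Lemma rescale_schwartz x y u : y != 0 -> u \in schwartz_pred ->
  rescale_fun x y u \in schwartz_pred.
Proof.
move=> y0 /asboolP[su bu]; apply/asboolP.
have -> : rescale_fun x y u = ((y^-1) ^+ n)%:C *: affcomp x y^-1 u by [].
have sa : smooth (affcomp x y^-1 u).
  by move=> s; rewrite pderivs_affcomp //; apply: cdiffZ; exact: cdiff_affcomp.
have sZ : smooth (((y^-1) ^+ n)%:C *: affcomp x y^-1 u).
  rewrite -[_ *: _]addr0; apply: smooth_lin => // s t; rewrite pderivs0.
  by split; exact: differentiable_cst.
split=> // k s; have [M hM] := bu k s.
pose K := 1 + `|x| + `|y|; pose c : R[i] := ((y^-1) ^+ n)%:C * ((y^-1) ^+ size s)%:C.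
exists (rnorm c * (K ^+ k * M)) => t; set z := y^-1 *: (t - x).
have -> : pderivs s (((y^-1) ^+ n)%:C *: affcomp x y^-1 u) t = c * pderivs s u z.
  rewrite pderivsZ // pderivs_affcomp // scalerA; congr (_ * _).
have K0 : 0 <= K by rewrite /K !addr_ge0.
rewrite rnormM mulrCA ler_wpM2l ?rnorm_ge0 //.
apply: (le_trans _ (ler_wpM2l (exprn_ge0 k K0) (hM z))).
rewrite mulrA ler_wpM2r ?rnorm_ge0 // -exprMn lerXn2r ?nnegrE ?mulr_ge0 ?addr_ge0 //.
have -> : t = x + y *: z by rewrite /z scalerA divff // scale1r addrC subrK.
apply: (@le_trans _ _ (1 + (`|x| + `|y| * `|z|))).
  by rewrite lerD2l -normrZ ler_normD.
rewrite /K mulrDr mulr1 !mulrDl mul1r.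
rewrite -subr_ge0 (_ : _ - _ = `|y| + (`|z| + `|x| * `|z|)); last by ring.
by rewrite !addr_ge0 ?mulr_ge0.
Qed.

(* The junk value 0 is taken only for y = 0. *)
Definition rescale (x : 'rV[R]_n) (y : R) (phi : schwartz) : schwartz :=
  insubd 0 (rescale_fun x y phi).

Lemma rescaleE x y (phi : schwartz) t : y != 0 ->
  rescale x y phi t = ((y^-1) ^+ n)%:C * phi (y^-1 *: (t - x)).
Proof.
move=> y0; have h := rescale_schwartz x y0 (schwartz_funP phi).
have -> : schwartz_fun (rescale x y phi) = rescale_fun x y phi by exact: insubdK.
by [].
Qed.

End Schwartz.

Section LebesgueTuple.
Variable R : realType.
Local Open Scope ereal_scope.

Definition tuple_of_pair (n : nat)
    (p : measurableTypeR R * n.-tuple (measurableTypeR R)) :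
  n.+1.-tuple (measurableTypeR R) := [tuple of p.1 :: p.2].

Lemma measurable_tuple_of_pair n :
  measurable_fun [set: _] (@tuple_of_pair n).
Proof. exact: measurable_cons. Qed.

Definition lebesgue_tupleS (n : nat)
    (m : {sigma_finite_measure set (n.-tuple (measurableTypeR R)) -> \bar R}) :
  set (n.+1.-tuple (measurableTypeR R)) -> \bar R :=
  pushforward (@lebesgue_measure R \x m) (@tuple_of_pair n).

Section instances.
Variables (n : nat)
  (m : {sigma_finite_measure set (n.-tuple (measurableTypeR R)) -> \bar R}).

Let mf := @measurable_tuple_of_pair n.

Let lebesgue_tupleS0 : lebesgue_tupleS m set0 = 0.
Proof. exact: measure0. Qed.

Let lebesgue_tupleS_ge0 A : 0 <= lebesgue_tupleS m A.
Proof. exact: measure_ge0. Qed.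

Let lebesgue_tupleS_sigma_additive : semi_sigma_additive (lebesgue_tupleS m).
Proof. exact: measure_semi_sigma_additive. Qed.

HB.instance Definition _ := isMeasure.Build _ _ _ (lebesgue_tupleS m)
  lebesgue_tupleS0 lebesgue_tupleS_ge0 lebesgue_tupleS_sigma_additive.

Lemma lebesgue_tupleS_sigma_finite : sigma_finite setT (lebesgue_tupleS m).
Proof.
have /sigma_finiteP[F [TF ndF Foo]] := sigma_finiteT (@lebesgue_measure R).
have /sigma_finiteP[G [TG ndG Goo]] := sigma_finiteT m.
pose unc (v : n.+1.-tuple (measurableTypeR R)) := (thead v, [tuple of behead v]).
have munc : measurable_fun [set: _] unc.
  apply/measurable_fun_pair => /=; first exact: measurable_tnth.
  exact: measurable_behead.
have uncK : unc \o @tuple_of_pair n = id.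
  by apply/funext => -[a w]; congr pair; apply/val_inj.
exists (fun k => unc @^-1` (F k `*` G k)).
  rewrite -preimage_bigcup; apply/esym; rewrite -subTset => v _ /=.
  have [i _ Fi] : (\bigcup_i F i) (unc v).1 by rewrite -TF.
  have [j _ Gj] : (\bigcup_i G i) (unc v).2 by rewrite -TG.
  exists (maxn i j) => //; split.
  - by move: (unc v).1 Fi; exact/subsetPset/ndF/leq_maxl.
  - by move: (unc v).2 Gj; exact/subsetPset/ndG/leq_maxr.
move=> k; have [mF Fk] := Foo k; have [mG Gk] := Goo k; split.
  by rewrite -[X in measurable X]setTI; apply: munc => //; exact: measurableX.
rewrite /lebesgue_tupleS /pushforward -comp_preimage uncK preimage_id.
by rewrite product_measure1E// lte_mul_pinfty// ge0_fin_numE.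
Qed.

HB.instance Definition _ := Measure_isSigmaFinite.Build _ _ _
  (lebesgue_tupleS m) lebesgue_tupleS_sigma_finite.
End instances.

Fixpoint lebesgue_tuple (n : nat) :
    {sigma_finite_measure set (n.-tuple (measurableTypeR R)) -> \bar R} :=
  match n with
  | 0 => \d_([tuple] : 0.-tuple (measurableTypeR R))
  | n'.+1 => lebesgue_tupleS (lebesgue_tuple n')
  end.

End LebesgueTuple.

Definition schwartz_integral (R : realType) (n : nat) (phi : schwartz R n) : R[i] :=
  (\int[lebesgue_tuple R n]_t complex.Re (phi (\row_i tnth t i))) +i*
  (\int[lebesgue_tuple R n]_t complex.Im (phi (\row_i tnth t i))).

(* measurable_fun over R itself means Borel measurable; this is measurability
   for the Lebesgue sigma-algebra. *)
Definition lebesgue_measurable_fun (R : realType) (D : set R) (L : R -> R) :=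
  @measurable_fun _ _
    (g_sigma_algebraType (completed_algebra_gen (@lebesgue_measure R))) R D L.

Definition slowly_varying_origin (R : realType) (L : R -> R) :=
  exists2 A : R, 0 < A &
    [/\ lebesgue_measurable_fun `]0, A]%classic L,
        forall x, 0 < x <= A -> 0 < L x &
        forall a, 0 < a -> L (a * e) / L e @[e --> 0^'+] --> (1 : R)].

Definition slowly_varying_infinity (R : realType) (L : R -> R) :=
  exists2 A : R, 0 < A &
    [/\ lebesgue_measurable_fun `[A, +oo[%classic L,
        forall x, A <= x -> 0 < L x &
        forall a, 0 < a -> L (a * l) / L l @[l --> +oo] --> (1 : R)].

Section Tempered.
Variables (R : realType) (n : nat) (E : completeNormedModType R[i]).

Record tempered := Tempered {
  tempered_fun :> {linear schwartz R n -> E};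
  tempered_continuous : continuous tempered_fun }.

Implicit Types (f g : tempered) (phi psi : schwartz R n) (L : R -> R)
  (alpha : R) (x : 'rV[R]_n).

(* rescale 0 a psi is t |-> a^(-n) psi(t / a), so g (rescale 0 a psi) is the
   value of g(at) at psi. *)
Definition homogeneous alpha g := forall (a : R) psi, 0 < a ->
  g (rescale 0 a psi) = (a `^ alpha)%:C *: g psi.

Definition phi_transform phi f x (y : R) : E := f (rescale x y phi).

(* The intersection of the upper half-space and the Euclidean unit sphere. *)
Definition half_sphere : set ('rV[R]_n * R) :=
  [set p : 'rV[R]_n * R | (\sum_i p.1 ord0 i ^+ 2) + p.2 ^+ 2 = 1 /\ 0 < p.2].

(* Below G is 0^'+, or the filter of neighbourhoods of +oo with x0 = 0. *)
Variables (G : set_system R) (x0 : 'rV[R]_n).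

Definition quasiasymptotic alpha L f g := forall psi,
  ((e `^ alpha * L e)^-1)%:C *: f (rescale x0 e psi) @[e --> G] --> g psi.

Definition transform_limit phi alpha L f (F : 'rV[R]_n -> R -> E) :=
  forall x y, half_sphere (x, y) ->
    ((e `^ alpha * L e)^-1)%:C *: phi_transform phi f (x0 + e *: x) (e * y)
      @[e --> G] --> F x y.

Definition transform_growth phi alpha L f (k : nat) :=
  (limf_esup (fun e : R => ereal_sup
    [set (p.2 ^+ k / (e `^ alpha * L e) *
          rnorm (phi_transform phi f (x0 + e *: p.1) (e * p.2)))%:E
     | p in half_sphere]) G < +oo)%E.

End Tempered.

(* Main.v *)
Require Import Defs.
From HB Require Import structures.
From mathcomp Require Import all_boot all_order all_algebra.
From mathcomp Require Import all_classical all_reals all_analysis.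
From mathcomp Require Import complex measurable_realfun ring lra.

Set Implicit Arguments.
Unset Strict Implicit.
Unset Printing Implicit Defensive.

Import Order.TTheory GRing.Theory Num.Theory.
Import numFieldNormedType.Exports.

Local Open Scope classical_set_scope.
Local Open Scope ring_scope.
Local Open Scope complex_scope.

(** Let A_y rho (t) = \int phi(x) rho(t - y x) dx. These operators commute,
    1 - A_y is O(y) between Schwartz seminorms, and A_y rho is a superposition of
    the functions y^(-n) phi((t - x) / y). Telescoping (1 - A_y)^m over y = 2^(-j)
    bounds any continuous seminorm tau on the Schwartz space by its values on the
    rescalings of phi, as soon as these grow at most polynomially in x and 1/y,
    with constants independent of tau. Applied to the seminorms
    |f(x0 + e t)(psi)| / (e^alpha L(e)), this turns (b), extended to the half-space
    by homogeneity and Potter bounds for L, into equicontinuity; applied to the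
    oscillation of these quantities as e varies, it turns (a) into convergence for
    every test function; applied to |h - g|, it shows that the transform determines
    the distribution. The converse is the uniform boundedness principle. *)

(** No function with values in the Schwartz space is ever integrated. [A_y rho] is the limit, in
    every seminorm, of finite sums, and a continuous seminorm is estimated on these sums before the
    limit is taken. Two families of sums are needed: translates of [rho] display the algebra of the
    operators and the [O(y)] estimate, whereas rescalings of [phi] are what the transform sees. The
    obstacle is a mismatch of powers: the moments of [phi] of order at least 1 are arbitrary, so
    [1 - A_y] gains a single power of [y], while control by the transform loses a power of [y^-1]
    that grows with the polynomial bound and the dimension. Only a high power of [1 - A_y] makes the
    dyadic series summable. Working with seminorms, rather than with distributions, lets the same
    estimate serve equicontinuity, convergence and uniqueness; in the last two uses the bound on the
    rescalings is 0. *)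

Section RowNorm.
Variables (R : realType) (n : nat).
Implicit Type x : 'rV[R]_n.

Lemma coord_le_norm x i : `|x ord0 i| <= `|x|.
Proof.
rewrite [leRHS]mx_normrE.
exact: (le_bigmax_cond _ (fun ij : 'I_1 * 'I_n => `|x ij.1 ij.2|) (j := (ord0, i))).
Qed.

Lemma row_norm_le x (c : R) : 0 <= c -> (forall i, `|x ord0 i| <= c) -> `|x| <= c.
Proof.
move=> c0 h; rewrite [leLHS]mx_normrE; apply: bigmax_le => // -[a b] _ /=.
by rewrite (ord1 a).
Qed.

End RowNorm.

(** * Riemann sums on R^n and their convergence to the Lebesgue integral *)

Section RiemannSums.
Variable R : realType.

Definition tcube n (b : 'I_n -> R) (h : R) : set (n.-tuple (measurableTypeR R)) :=
  [set v | forall i, b i - h < tnth v i <= b i].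

Lemma measurable_tcube n (b : 'I_n -> R) h : measurable (tcube b h).
Proof.
rewrite (_ : tcube b h = \bigcap_(i in [set: 'I_n])
   ((fun v => tnth v i) @^-1` `](b i - h), (b i)]%classic)); last first.
  apply/seteqP; split => v /= hv i; first by move=> _ /=; rewrite in_itv; exact: hv.
  by have := hv i I; rewrite /= in_itv.
apply: fin_bigcap_measurable => // i _.
rewrite -[X in measurable X]setTI; apply: measurable_tnth => //.
Qed.

Lemma lebesgue_tcube n (b : 'I_n -> R) h : 0 <= h ->
  lebesgue_tuple R n (tcube b h) = (h ^+ n)%:E.
Proof.
move=> h0; elim: n b => [|n IH] b.
  rewrite /= diracE mem_set //; by case.
rewrite /= /lebesgue_tupleS /pushforward.
rewrite (_ : _ @^-1` _ = `](b ord0 - h), (b ord0)]%classic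
   `*` tcube (fun i => b (lift ord0 i)) h); last first.
  apply/seteqP; split => -[x v] /=.
    move=> hv; split; first by rewrite in_itv; exact: (hv ord0).
    by move=> i; have := hv (lift ord0 i); rewrite tnthS.
  move=> [hx hv] i; case: (unliftP ord0 i) => [j ->|->] //.
  by rewrite tnthS.
rewrite product_measure1E //; last exact: measurable_tcube.
rewrite [X in (_ * X)%E](IH (fun i => b (lift ord0 i))).
rewrite [X in (X * _)%E]lebesgue_measure_itv /= lte_fin.
have [hb|hb] := ltP (b ord0 - h) (b ord0).
  by rewrite -EFinD opprB addrC subrK -EFinM exprS.
have -> : h = 0 by lra.
by rewrite mul0e exprS mul0r.
Qed.

Lemma oneDsqrV_gt0 (x : R) : 0 < (oneDsqr x)^-1.
Proof. by rewrite invr_gt0 (lt_le_trans ltr01) // oneDsqr_ge1. Qed.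

(** An integrable weight that factors over the coordinates, so that its integral is reached by
    Tonelli and induction on the dimension. It supplies the majorant of the Riemann sums below. *)
Definition wt n (x : 'rV[R]_n) : R := \prod_i (oneDsqr (x ord0 i))^-1.

Lemma wt_gt0 n (x : 'rV[R]_n) : 0 < wt x.
Proof. by apply: prodr_gt0 => i _; exact: oneDsqrV_gt0. Qed.

Definition row_of n (v : n.-tuple (measurableTypeR R)) : 'rV[R]_n :=
  \row_i (tnth v i : R).

Lemma measurable_wt n : measurable_fun setT (fun v => wt (@row_of n v)).
Proof.
apply: measurable_prod => i _; under eq_fun do rewrite mxE.
apply: (@measurableT_comp _ _ _ _ _ _ (fun x : R => (oneDsqr x)^-1) _ (fun v => tnth v i)).
  exact: continuous_measurable_fun (@continuous_oneDsqrV R).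
exact: measurable_tnth.
Qed.

Lemma integral_oneDsqrV_lty :
  (\int[@lebesgue_measure R]_x (oneDsqr x)^-1%:E < +oo)%E.
Proof.
rewrite (ge0_symfun_integralT (f := fun x => (oneDsqr x)^-1)) /=.
- rewrite -set_itvcy integral0y_oneDsqr -EFinM; exact: ltry.
- by move=> x; rewrite /= ltW // oneDsqrV_gt0.
- exact: continuous_oneDsqrV.
- by move=> x; rewrite /= /oneDsqr sqrrN.
Qed.

Lemma wt_lty n : (\int[lebesgue_tuple R n]_v (wt (row_of v))%:E < +oo)%E.
Proof.
have mw k : measurable_fun setT (fun v => (wt (@row_of k v))%:E).
  by apply/measurable_EFinP; exact: measurable_wt.
elim: n => [|n IH].
  by rewrite /= integral_dirac // ?diracE ?mem_set // ?mul1e ?ltry //; exact: (mw 0%N).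
have mD : measurable_fun setT (fun x : R => (oneDsqr x)^-1%:E : \bar R).
  apply/measurable_EFinP; exact: continuous_measurable_fun (@continuous_oneDsqrV R).
rewrite [lebesgue_tuple _ _]/= /lebesgue_tupleS.
rewrite ge0_integral_pushforward //=; first last.
- by move=> v _; rewrite lee_fin ltW // wt_gt0.
- exact: mw.
- exact: measurable_tuple_of_pair.
rewrite preimage_setT.
rewrite (eq_integral (fun p : measurableTypeR R * n.-tuple (measurableTypeR R) => ((oneDsqr (p.1 : R))^-1%:E * (wt (row_of p.2))%:E)%E)); last first.
  move=> [x v] _; rewrite /= -EFinM; congr EFin.
  rewrite /wt big_ord_recl; congr (_ * _); first by rewrite mxE.
  by apply: eq_bigr => i _; rewrite !mxE tnthS.
rewrite fubini_tonelli1 /fubini_F /=; first last.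
- by move=> p; rewrite -EFinM lee_fin mulr_ge0 ?(ltW (wt_gt0 _)) ?(ltW (oneDsqrV_gt0 _)).
- apply: emeasurable_funM; first exact: (measurableT_comp mD measurable_fst).
  exact: (measurableT_comp (mw n) measurable_snd).
rewrite (eq_integral (fun x : measurableTypeR R => ((oneDsqr (x : R))^-1%:E *
    \int[lebesgue_tuple R n]_v (wt (row_of v))%:E)%E)); last first.
  move=> x _; rewrite ge0_integralZl //.
  - exact: mw.
  - by move=> v _; rewrite lee_fin ltW // wt_gt0.
have w0 : (0 <= \int[lebesgue_tuple R n]_v (wt (row_of v))%:E)%E.
  by apply: integral_ge0 => v _; rewrite lee_fin ltW // wt_gt0.
have d0 : (0 <= \int[@lebesgue_measure R]_x (oneDsqr x)^-1%:E)%E.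
  by apply: integral_ge0 => v _; rewrite lee_fin ltW // oneDsqrV_gt0.
rewrite ge0_integralZr //.
  by rewrite lte_mul_pinfty // ?ge0_fin_numE // integral_oneDsqrV_lty.
Qed.

Definition mesh m : R := m.+1%:R^-1.

Lemma mesh_gt0 m : 0 < mesh m.
Proof. by rewrite invr_gt0. Qed.

Lemma mesh_le1 m : mesh m <= 1.
Proof. by rewrite invf_le1 // ler1n. Qed.

(** With mesh [1/(m+1)] and [2 (m+1)^2] indices per axis, the grid spans [[-(m+1), m+1[]: it becomes
    finer and larger at the same time. *)
Definition gsize m := (m.+1 * m.+1)%N.

Definition gidx n m := {ffun 'I_n -> 'I_(gsize m + gsize m)}.

Definition gpt n m (j : gidx n m) : 'rV[R]_n :=
  \row_i (mesh m * ((j i)%:R - (gsize m)%:R)).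

(** The free origin [a] and the sign in [a - gpt j] allow the substitution [x := (t - x) / y] to be
    made exactly, on the finite sums. *)
Definition rsum n m (F : 'rV[R]_n -> R) (a : 'rV[R]_n) : R :=
  mesh m ^+ n * \sum_(j : gidx n m) F (a - gpt j).

Definition cell n m (a : 'rV[R]_n) (j : gidx n m) :=
  tcube (fun i => (a - gpt j) ord0 i) (mesh m).

Definition step n m (F : 'rV[R]_n -> R) (a : 'rV[R]_n)
    (v : n.-tuple (measurableTypeR R)) : R :=
  \sum_(j : gidx n m) F (a - gpt j) * \1_(cell a j) v.

Lemma cell_inj n m (a : 'rV[R]_n) (j k : gidx n m) v :
  cell a j v -> cell a k v -> j = k.
Proof.
move=> hj hk; apply/ffunP => i; apply/val_inj => /=.
have := hj i; have := hk i; rewrite !mxE.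
set t := tnth v i; set h := mesh m; have h0 : 0 < h := mesh_gt0 m.
move=> /andP[k1 k2] /andP[j1 j2].
have hlt p q : h * (p%:R - (gsize m)%:R) < h * (q%:R - (gsize m)%:R) + h -> (p <= q)%N.
  have -> : h * (q%:R - (gsize m)%:R) + h = h * (q.+1%:R - (gsize m)%:R).
    by rewrite -natr1; ring.
  by rewrite ltr_pM2l // ltrD2r ltr_nat.
by apply/eqP; rewrite eqn_leq; apply/andP; split; apply: hlt; lra.
Qed.

Lemma step_in n m F (a : 'rV[R]_n) (j : gidx n m) v :
  cell a j v -> step m F a v = F (a - gpt j).
Proof.
move=> hj; rewrite /step (bigD1 j) //= indicE mem_set // mulr1 big1 ?addr0 //.
move=> k kj; rewrite indicE memNset ?mulr0 // => hk.
by move/eqP: kj; apply; exact: cell_inj hk hj.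
Qed.

Lemma step_out n m F (a : 'rV[R]_n) v :
  (forall j : gidx n m, ~ cell a j v) -> step m F a v = 0.
Proof. by move=> h; rewrite /step big1 // => j _; rewrite indicE memNset ?mulr0. Qed.

Lemma cell_ex n (a : 'rV[R]_n) v :
  \forall m \near \oo, exists j : gidx n m, cell a j v.
Proof.
pose S := \sum_i `|a ord0 i - tnth v i|.
have hS i : `|a ord0 i - tnth v i| <= S.
  by rewrite /S (bigD1 i) //= lerDl sumr_ge0.
near=> m.
have Sm : S <= m%:R by near: m; exact: nbhs_infty_ger.
have h0 := mesh_gt0 m.
pose u i := (a ord0 i - tnth v i) / mesh m + (gsize m)%:R.
have u0 i : 0 <= u i /\ u i < (gsize m + gsize m)%:R.
  have : `|(a ord0 i - tnth v i) / mesh m| < (gsize m)%:R.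
    rewrite /mesh invrK normrM [`|_.+1%:R|]ger0_norm // natrM ltr_pM2r //.
    by rewrite (le_lt_trans (hS i)) // (le_lt_trans Sm) // ltr_nat.
  rewrite ltr_norml natrD /u => /andP[w1 w2]; split; lra.
pose k i := Num.truncn (u i).
have hk i : (k i < gsize m + gsize m)%N.
  by rewrite /k truncn_lt_nat ?(u0 i).1 ?(u0 i).2.
exists [ffun i => Ordinal (hk i)] => i; rewrite !mxE ffunE /=.
have := truncn_itv (u0 i).1; rewrite -/(k i) -natr1 => /andP[k1 k2].
have e1 : a ord0 i - tnth v i = mesh m * (u i - (gsize m)%:R).
  by rewrite /u addrK mulrC divfK // gt_eqF.
have e2 : mesh m * ((k i)%:R - (gsize m)%:R) <= a ord0 i - tnth v i.
  by rewrite e1 ler_pM2l // lerD2r.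
have e3 : a ord0 i - tnth v i < mesh m * ((k i)%:R - (gsize m)%:R) + mesh m.
  rewrite e1; have -> : mesh m * ((k i)%:R - (gsize m)%:R) + mesh m =
      mesh m * ((k i)%:R + 1 - (gsize m)%:R) by ring.
  by rewrite ltr_pM2l // ltrD2r.
apply/andP; split; lra.
Unshelve. all: by end_near. Qed.

Lemma cell_close n m (a : 'rV[R]_n) (j : gidx n m) v i :
  cell a j v -> `|(a - gpt j) ord0 i - tnth v i| <= mesh m.
Proof.
move=> /(_ i) /andP[h1 h2]; rewrite ler_norml; have := mesh_gt0 m => h0.
apply/andP; split; lra.
Qed.

(** [1 + q^2 <= 3 (1 + p^2)] as soon as [|p - q| <= 1]: sampling at the corner of a cell of side at
    most 1 costs a constant factor. *)
Lemma wt_close n (x y : 'rV[R]_n) : (forall i, `|x ord0 i - y ord0 i| <= 1) ->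
  wt x <= 3 ^+ n * wt y.
Proof.
move=> h; rewrite /wt -[X in 3 ^+ X]card_ord -prodr_const -big_split /=.
apply: ler_prod => i _; rewrite ltW ?oneDsqrV_gt0 //=.
rewrite -[X in X <= _]mul1r ler_pdivrMr ?(lt_le_trans ltr01) ?oneDsqr_ge1 //.
rewrite -mulrA [_^-1 * _]mulrC mulrA ler_pdivlMr ?(lt_le_trans ltr01) ?oneDsqr_ge1 //.
rewrite mul1r /oneDsqr; have := h i.
move: (x ord0 i) (y ord0 i) => p q; rewrite ler_norml => /andP[h1 h2].
have := sqr_ge0 (2 * p - q); nra.
Qed.

Lemma step_bound n m (F : 'rV[R]_n -> R) (C : R) a v :
  0 <= C -> (forall x, `|F x| <= C * wt x) ->
  `|step m F a v| <= C * 3 ^+ n * wt (row_of v).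
Proof.
move=> C0 hF.
have [[j hj]|h] := pselect (exists j : gidx n m, cell a j v).
  rewrite (step_in F hj) (le_trans (hF _)) // -mulrA ler_wpM2l //.
  apply: wt_close => i; rewrite [row_of v ord0 i]mxE.
  by rewrite (le_trans (cell_close i hj)) // mesh_le1.
rewrite step_out; last by move=> j hj; apply: h; exists j.
by rewrite normr0 mulr_ge0 ?(ltW (wt_gt0 _)) // mulr_ge0 // exprn_ge0.
Qed.

Lemma step_cvg n (F : 'rV[R]_n -> R) a v : continuous F ->
  step m F a v @[m --> \oo] --> F (row_of v).
Proof.
move=> cF; apply/cvgrPdist_lt => e e0.
have := cF (row_of v); move=> /cvgrPdist_lt /(_ e e0) /nbhs_normP [d /= d0 hd].
near=> m.
have [j hj] : exists j : gidx n m, cell a j v by near: m; exact: cell_ex.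
rewrite (step_in F hj); apply: hd => /=.
have md : mesh m < d.
  by near: m; exact: (near_infty_natSinv_lt (PosNum d0)).
apply: (le_lt_trans _ md); apply: row_norm_le => [|i]; first exact: ltW (mesh_gt0 m).
have -> : (row_of v - (a - gpt j)) ord0 i = - ((a - gpt j) ord0 i - tnth v i).
  by rewrite !mxE; ring.
by rewrite normrN cell_close.
Unshelve. all: by end_near. Qed.

Lemma measurable_step n m (F : 'rV[R]_n -> R) a : measurable_fun setT (step m F a).
Proof.
apply: measurable_sum => j; apply: measurable_funM => //.
by apply: measurable_indic; exact: measurable_tcube.
Qed.

Lemma integral_step n m (F : 'rV[R]_n -> R) a :
  (\int[lebesgue_tuple R n]_v (step m F a v)%:E = (rsum m F a)%:E)%E.
Proof.
have h0 : 0 <= mesh m by exact: ltW (mesh_gt0 m).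
have ii (j : gidx n m) : (lebesgue_tuple R n).-integrable setT
    (fun v => (\1_(cell a j) v)%:E).
  apply/integrableP; split.
    by apply/measurable_EFinP; apply: measurable_indic; exact: measurable_tcube.
  under eq_integral do rewrite gee0_abs ?lee_fin //.
  rewrite integral_indic //; last exact: measurable_tcube.
  by rewrite setIT [X in (X < _)%E](lebesgue_tcube _ h0) ltry.
transitivity (\sum_(j : gidx n m) \int[lebesgue_tuple R n]_v
    ((F (a - gpt j))%:E * (\1_(cell a j) v)%:E))%E.
  rewrite -integral_sum //; last by move=> j; exact: integrableZl.
  by apply: eq_integral => v _; rewrite /step -sumEFin; apply: eq_bigr.
rewrite /rsum mulr_sumr -sumEFin; apply: eq_bigr => j _.
rewrite integralZl // integral_indic //; last exact: measurable_tcube.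
by rewrite setIT [X in (_ * X)%E](lebesgue_tcube _ h0) -EFinM mulrC.
Qed.

(** The sum is the integral of a step function, and dominated convergence applies on the whole space
    at once, with majorant [C * 3 ^+ n * wt]. *)
Lemma rsum_cvg n (F : 'rV[R]_n -> R) (C : R) a :
  continuous F -> (forall x, `|F x| <= C * wt x) ->
  rsum m F a @[m --> \oo] --> \int[lebesgue_tuple R n]_v F (row_of v).
Proof.
move=> cF hF.
have C0 : 0 <= C.
  by have := le_trans (normr_ge0 _) (hF 0); rewrite (pmulr_lge0 _ (wt_gt0 _)).
(* Measurability on tuples is inherited from the step functions, which converge pointwise to [F]. *)
have mF : measurable_fun setT (fun v => F (@row_of n v)).
  apply: (measurable_fun_cvg (h := fun m => step m F a)).
    by move=> m; exact: measurable_step.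
  by move=> v _; exact: step_cvg.
have [] := @dominated_convergence _ _ _ (lebesgue_tuple R n) setT measurableT
  (fun m v => (step m F a v)%:E) (fun v => (F (row_of v))%:E)
  (fun v => ((C * 3 ^+ n)%:E * (wt (row_of v))%:E)%E).
- by move=> m; apply/measurable_EFinP; exact: measurable_step.
- exact/measurable_EFinP.
- apply: aeW => v _; apply: cvg_EFin; first by near=> m.
  exact: step_cvg.
- apply: integrableZl => //; apply/integrableP; split.
    by apply/measurable_EFinP; exact: measurable_wt.
  under eq_integral do rewrite gee0_abs ?lee_fin ?(ltW (wt_gt0 _)) //.
  exact: wt_lty.
- apply: aeW => v m _; rewrite abse_EFin -EFinM lee_fin.
  exact: step_bound.
move=> iF _; rewrite -(fineK (integrable_fin_num measurableT iF)).
under eq_fun do rewrite integral_step.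
by move=> /fine_cvg.
Unshelve. all: by end_near. Qed.

End RiemannSums.

(** * Real-valued norms, and real and imaginary parts *)

Section RealNorm.
Variables (R : realType) (V : normedModType R[i]).
Implicit Types u v : V.

Lemma rnormN v : rnorm (- v) = rnorm v.
Proof. by rewrite /rnorm normrN. Qed.

Lemma ler_rnormB u v : rnorm (u - v) <= rnorm u + rnorm v.
Proof. by rewrite (le_trans (ler_rnormD _ _)) // rnormN. Qed.

Lemma rnorm_distC u v : rnorm (u - v) = rnorm (v - u).
Proof. by rewrite -rnormN opprB. Qed.

Lemma rnormZ (a : R[i]) v : rnorm (a *: v) = rnorm a * rnorm v.
Proof. by rewrite {1}/rnorm normrZ !rnormE -rmorphM. Qed.

Lemma rnorm_eq0 v : rnorm v = 0 -> v = 0.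
Proof. by move=> h; apply/normr0_eq0; rewrite rnormE h. Qed.

Lemma cvg_rnormP T (F : set_system T) {FF : Filter F} (f : T -> V) (l : V) :
  f @ F --> l <-> forall e : R, 0 < e -> \forall t \near F, rnorm (l - f t) < e.
Proof.
split=> [/cvgrPdist_lt h e e0|h].
  have /h : 0 < (e%:C : R[i]) by rewrite ltcR.
  by apply: filterS => t; rewrite rnormE ltcR.
apply/cvgrPdist_lt => -[a b]; rewrite ltcE /= => /andP[/eqP -> a0].
by apply: filterS (h a a0) => t ht; rewrite rnormE ltcR.
Qed.

Lemma cvg_rnorm_le T (F : set_system T) {FF : ProperFilter F} (f : T -> V) (l : V) (c : R) :
  f @ F --> l -> (\forall t \near F, rnorm (f t) <= c) -> rnorm l <= c.
Proof.
move=> /cvg_rnormP fl fc; apply/ler_addgt0Pr => e e0.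
have [t [h1 h2]] := filter_ex (filterI (fl e e0) fc).
have -> : l = f t + (l - f t) by rewrite addrC subrK.
by rewrite (le_trans (ler_rnormD _ _)) // lerD // ltW.
Qed.

End RealNorm.

Section ComplexParts.
Variable R : realType.
Implicit Types z : R[i].

Lemma rnorm_def z : rnorm z = Num.sqrt (complex.Re z ^+ 2 + complex.Im z ^+ 2).
Proof. by rewrite /rnorm normc_def. Qed.

Lemma rnorm_real (r : R) : rnorm r%:C = `|r|.
Proof. by rewrite rnorm_def /= expr0n /= addr0 sqrtr_sqr. Qed.

Lemma rnorm1 : rnorm (1 : R[i]) = 1.
Proof. by rewrite (_ : 1 = 1%:C) // rnorm_real normr1. Qed.

Lemma Re_le_rnorm z : `|complex.Re z| <= rnorm z.
Proof. by rewrite rnorm_def -sqrtr_sqr ler_wsqrtr // lerDl sqr_ge0. Qed.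

Lemma Im_le_rnorm z : `|complex.Im z| <= rnorm z.
Proof. by rewrite rnorm_def -sqrtr_sqr ler_wsqrtr // lerDr sqr_ge0. Qed.

Lemma rnorm_le_ReIm z : rnorm z <= `|complex.Re z| + `|complex.Im z|.
Proof.
have h : 0 <= `|complex.Re z| + `|complex.Im z| by rewrite addr_ge0.
rewrite -[X in _ <= X]ger0_norm // -sqrtr_sqr rnorm_def ler_wsqrtr //.
rewrite sqrrD !real_normK ?num_real // addrAC lerDl mulrn_wge0 // mulr_ge0 //.
Qed.

Lemma cvg_complexP T (F : set_system T) {FF : Filter F} (f : T -> R[i]^o) (l : R[i]^o) :
  f @ F --> l <-> (complex.Re (f t) @[t --> F] --> complex.Re l) /\
                  (complex.Im (f t) @[t --> F] --> complex.Im l).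
Proof.
split=> [/cvg_rnormP h|[/cvgrPdist_lt hr /cvgrPdist_lt hi]].
  split; apply/cvgrPdist_lt => e e0; apply: filterS (h e e0) => t; apply: le_lt_trans.
    by rewrite -raddfB Re_le_rnorm.
  by rewrite -raddfB Im_le_rnorm.
apply/cvg_rnormP => e e0; have e2 : 0 < e / 2 by rewrite divr_gt0.
near=> t; rewrite (le_lt_trans (rnorm_le_ReIm _)) // [e]splitr !raddfB /=.
by rewrite ltrD //; near: t; [exact: hr|exact: hi].
Unshelve. all: by end_near. Qed.

End ComplexParts.

(** * Mean value and Taylor estimates on R^n *)

Section RealCalculus.
Variables (R : realType) (n : nat).
Implicit Types (w : 'rV[R]_n -> R) (x v : 'rV[R]_n).

Lemma derive_coord w x v : differentiable w x ->
  'D_v w x = \sum_i v ord0 i * 'D_(delta_mx ord0 i) w x.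
Proof.
move=> dw; rewrite deriveE // {1}(row_sum_delta v) linear_sum.
by apply: eq_bigr => i _; rewrite linearZ deriveE.
Qed.

Lemma is_derive_line w x v (t : R) : differentiable w (x + t *: v) ->
  is_derive t 1 (fun s => w (x + s *: v)) ('D_v w (x + t *: v)).
Proof.
move=> dw.
have dl : is_diff t (fun s : R => x + s *: v) (fun s => s *: v).
  rewrite (_ : (fun s => s *: v) = 0 + (fun s : R => s *: v)); last first.
    by apply/funext => s; rewrite !fctE add0r.
  exact: is_diffD.
have dc := is_diff_comp dl (differentiableP dw).
have [d1 d2] := dc.
split; first exact/derivable1_diffP.
by rewrite deriveE // d2 /= scale1r deriveE.
Qed.

Lemma mvt_line w x v : (forall y, differentiable w y) ->
  exists2 t : R, 0 <= t <= 1 & w (x + v) - w x = 'D_v w (x + t *: v).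
Proof.
move=> dw; have [] := @MVT_segment R (fun s => w (x + s *: v))
  (fun s => 'D_v w (x + s *: v)) 0 1 ler01.
- by move=> t _; exact: is_derive_line.
- apply: continuous_subspaceT => t.
  by apply/differentiable_continuous/derivable1_diffP; have [] := is_derive_line (dw (x + t *: v)).
move=> t; rewrite in_itv /= => t01.
by rewrite scale1r scale0r addr0 subr0 mulr1 => ->; exists t.
Qed.

Lemma ler_sum_coord (v : 'rV[R]_n) (F : 'I_n -> R) (c : R) :
  (forall i, `|F i| <= c) -> `|\sum_i v ord0 i * F i| <= n%:R * (`|v| * c).
Proof.
move=> h; rewrite (le_trans (ler_norm_sum _ _ _)) //.
rewrite mulr_natl -[X in _ *+ X]card_ord -sumr_const ler_sum // => i _.
by rewrite normrM ler_pM // coord_le_norm.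
Qed.

Lemma lipschitz_line w x v (c : R) : (forall y, differentiable w y) ->
  (forall i (t : R), 0 <= t <= 1 -> `|'D_(delta_mx ord0 i) w (x + t *: v)| <= c) ->
  `|w (x + v) - w x| <= n%:R * (`|v| * c).
Proof.
move=> dw h; have [t t01 ->] := mvt_line x v dw.
by rewrite derive_coord //; apply: ler_sum_coord => i; exact: h.
Qed.

Lemma taylor1 w x v (c : R) : (forall y, differentiable w y) ->
  (forall i y, differentiable ('D_(delta_mx ord0 i) w) y) ->
  (forall i j y, `|'D_(delta_mx ord0 j) ('D_(delta_mx ord0 i) w) y| <= c) ->
  `|w (x + v) - w x - \sum_i v ord0 i * 'D_(delta_mx ord0 i) w x|
     <= n%:R * (`|v| * (n%:R * (`|v| * c))).
Proof.
move=> dw ddw h; have [t /andP[t0 t1] ->] := mvt_line x v dw.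
rewrite derive_coord // -sumrB.
under eq_bigr do rewrite -mulrBr.
apply: ler_sum_coord => i.
have c0 : 0 <= c by exact: le_trans (normr_ge0 _) (h i i 0).
apply: (le_trans (lipschitz_line (ddw i) (c := c) _)); first by move=> *; exact: h.
by rewrite ler_wpM2l // ler_wpM2r // normrZ ger0_norm // ler_piMl.
Qed.

Definition lindot (g : 'I_n -> R) v : R := \sum_i v ord0 i * g i.

Lemma lindot_is_linear g : linear (lindot g).
Proof.
move=> a u v; rewrite /lindot scaler_sumr -big_split; apply: eq_bigr => i _ /=.
by rewrite !mxE mulrDl -mulrA.
Qed.

HB.instance Definition _ g := GRing.isLinear.Build R 'rV[R]_n R _ (lindot g)
  (lindot_is_linear g).

Lemma continuous_lindot g : continuous (lindot g).
Proof.
move=> v; rewrite /lindot.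
apply: (@cvg_big _ _ _ _ _ _ _ (nbhs v) _ _ (fun i => v ord0 i * g i)) => [|i _].
  exact: add_continuous.
apply: (@cvgM _ _ (nbhs v) _ (fun M : 'rV[R]_n => M ord0 i) (fun=> g i)); last exact: cvg_cst.
exact: (@coord_continuous R 1 n ord0 i v).
Qed.

(** A converse to [taylor1]. A quadratic remainder with a uniform constant survives pointwise
    limits, which is how limits of Schwartz functions are seen to be differentiable. *)
Lemma differentiable_taylor w x (g : 'I_n -> R) (c : R) :
  (forall v, `|w (x + v) - w x - lindot g v| <= c * (`|v| * `|v|)) ->
  differentiable w x /\ forall i, 'D_(delta_mx ord0 i) w x = g i.
Proof.
move=> h.
have e : forall e : R, 0 < e -> \forall v \near (0 : 'rV[R]_n),
    `|w (v + x) - (w x + lindot g v)| <= e * `|v|.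
  move=> e e0.
  have c0 : 0 < `|c| + 1 by rewrite ltr_wpDl.
  have : \forall v \near (0 : 'rV[R]_n), `|v| < e / (`|c| + 1).
    apply/nbhs_normP; exists (e / (`|c| + 1)); first by rewrite /= divr_gt0.
    by move=> v /=; rewrite sub0r normrN.
  apply: filterS => v hv; rewrite [v + x]addrC opprD addrA.
  rewrite (le_trans (h v)) // mulrA ler_wpM2r //.
  rewrite (le_trans (ler_norm _)) // normrM normr_id.
  rewrite (@le_trans _ _ ((`|c| + 1) * `|v|)) ?ler_wpM2r ?lerDl //.
  by rewrite mulrC -ler_pdivlMr // ltW.
have d : 'd w x = lindot g :> ('rV[R]_n -> R).
  by apply: diff_unique; [exact: continuous_lindot|apply/eqaddoP; exact: e].
have dw : differentiable w x.
  apply/diff_locallyP; rewrite d; split; first exact: continuous_lindot.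
  by apply/eqaddoP; exact: e.
split=> // i; rewrite deriveE // d /= /lindot (bigD1 i) //= big1 => [|j ji].
  by rewrite mxE !eqxx mul1r addr0.
by rewrite mxE eqxx (negbTE ji) mul0r.
Qed.

End RealCalculus.

(** * Seminorm bounds for Schwartz functions *)

Section SchwartzBounds.
Variables (R : realType) (n : nat).
Implicit Types (psi chi : schwartz R n) (s : seq 'I_n) (x v t : 'rV[R]_n).

Definition sder s x psi : R[i]^o := pderivs s psi x.

Lemma sder_is_linear s x : linear (sder s x).
Proof.
move=> a psi chi; rewrite /sder.
rewrite [schwartz_fun _](_ : _ = a *: (psi : _ -> R[i]^o) + chi) //.
by rewrite pderivs_lin //; [exact: (schwartzP psi).1|exact: (schwartzP chi).1].
Qed.

HB.instance Definition _ s x := GRing.isLinear.Build R[i] (schwartz R n) R[i]^o _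
  (sder s x) (sder_is_linear s x).

Lemma schwartz_ext psi chi : (forall t, psi t = chi t) -> psi = chi.
Proof. by move=> h; apply/val_inj/funext. Qed.

(** A bound instead of a supremum: all seminorms of order at most [N] at once, with a constant that
    can be added, scaled and passed to the limit. *)
Definition sbound N (c : R) psi := forall s x, (size s <= N)%N ->
  (1 + `|x|) ^+ N * rnorm (sder s x psi) <= c.

Lemma weight_ge1 x : 1 <= 1 + `|x|.
Proof. by rewrite lerDl. Qed.

Lemma weight_gt0 x : 0 < 1 + `|x|.
Proof. exact: lt_le_trans ltr01 (weight_ge1 x). Qed.

Lemma weightX_gt0 x N : 0 < (1 + `|x|) ^+ N.
Proof. by rewrite exprn_gt0 // weight_gt0. Qed.

Lemma weightD x v : 1 + `|x + v| <= (1 + `|x|) * (1 + `|v|).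
Proof.
rewrite (le_trans (lerD (lexx 1) (ler_normD x v))) //.
by rewrite mulrDl mul1r mulrDr mulr1 -!addrA lerD2l addrCA lerD2l lerDl mulr_ge0.
Qed.

Lemma sbound_ge0 N c psi : sbound N c psi -> 0 <= c.
Proof.
move=> /(_ [::] 0 isT); apply: le_trans.
by rewrite mulr_ge0 ?rnorm_ge0 // ltW // weightX_gt0.
Qed.

Lemma sboundW N N' c c' psi : (N <= N')%N -> c <= c' ->
  sbound N' c psi -> sbound N c' psi.
Proof.
move=> NN cc h s x sN; apply: le_trans cc; apply: le_trans (h s x (leq_trans sN NN)).
by rewrite ler_wpM2r ?rnorm_ge0 // ler_weXn2l // weight_ge1.
Qed.

Lemma sbound_le N c psi s x : sbound N c psi -> (size s <= N)%N ->
  rnorm (sder s x psi) <= c.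
Proof.
move=> h sN; apply: le_trans (h s x sN).
by rewrite ler_peMl ?rnorm_ge0 // exprn_ege1 // weight_ge1.
Qed.

Lemma sbound_weight N c psi s x k : sbound N c psi -> (size s <= N)%N -> (k <= N)%N ->
  (1 + `|x|) ^+ k * rnorm (sder s x psi) <= c.
Proof.
move=> h sN kN; apply: le_trans (h s x sN).
by rewrite ler_wpM2r ?rnorm_ge0 // ler_weXn2l // weight_ge1.
Qed.

Lemma sboundD N c d psi chi : sbound N c psi -> sbound N d chi ->
  sbound N (c + d) (psi + chi).
Proof.
move=> h k s x sN; rewrite linearD.
apply: (le_trans (ler_wpM2l (ltW (weightX_gt0 x N)) (ler_rnormD _ _))).
by rewrite mulrDr lerD ?h ?k.
Qed.

Lemma sboundN N c psi : sbound N c psi -> sbound N c (- psi).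
Proof. by move=> h s x sN; rewrite linearN rnormN h. Qed.

Lemma sboundB N c d psi chi : sbound N c psi -> sbound N d chi ->
  sbound N (c + d) (psi - chi).
Proof. by move=> h k; apply: sboundD => //; exact: sboundN. Qed.

Lemma sboundZ N c (a : R[i]) psi : sbound N c psi -> sbound N (rnorm a * c) (a *: psi).
Proof.
move=> h s x sN; rewrite linearZ /= rnormM mulrCA ler_wpM2l ?rnorm_ge0 //.
exact: h.
Qed.

Lemma sbound0 N : sbound N 0 0.
Proof. by move=> s x sN; rewrite linear0 rnorm0 mulr0. Qed.

Lemma sbound_sum N I (r : seq I) (c : I -> R) (psi : I -> schwartz R n) :
  (forall i, sbound N (c i) (psi i)) ->
  sbound N (\sum_(i <- r) c i) (\sum_(i <- r) psi i).
Proof.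
move=> h; elim/big_rec2: _ => [|i y x _ k]; first exact: sbound0.
exact: sboundD.
Qed.

(** Only finitely many words have length at most [N]; the induction peels off the first letter. *)
Lemma words_forall (T : Type) (F : set_system T) {FF : Filter F} N
    (P : seq 'I_n -> T -> Prop) :
  (forall s, (size s <= N)%N -> \forall t \near F, P s t) ->
  \forall t \near F, forall s, (size s <= N)%N -> P s t.
Proof.
elim: N P => [|N IH] P h.
  by apply: filterS (h [::] isT) => t Pt s; rewrite leqn0 => /nilP ->.
have h1 : \forall t \near F, forall i : 'I_n, forall s, (size s <= N)%N -> P (i :: s) t.
  apply: filter_forall => i; apply: (IH (fun s => P (i :: s))) => s sN.
  exact: h.
apply: filterS2 h1 (h [::] isT) => t Pt P0 [|i s] // sN.
exact: Pt.
Qed.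

Lemma sbound_ex N psi : exists c, sbound N c psi.
Proof.
have h : \forall c \near +oo, forall s, (size s <= N)%N ->
    forall x, (1 + `|x|) ^+ N * rnorm (sder s x psi) <= c.
  apply: words_forall => s sN; have [M hM] := (schwartzP psi).2 N s.
  apply: filterS (nbhs_pinfty_ge (num_real M)) => c Mc x.
  exact: le_trans (hM x) Mc.
by have [c hc] := filter_ex h; exists c => s x sN; exact: hc.
Qed.

Lemma sder_Re_diff s psi x : differentiable (fun t => complex.Re (sder s t psi)) x.
Proof. exact: ((schwartzP psi).1 s x).1. Qed.

Lemma sder_Im_diff s psi x : differentiable (fun t => complex.Im (sder s t psi)) x.
Proof. exact: ((schwartzP psi).1 s x).2. Qed.

(** Derivatives on the segment decay with the weight of their own point; returning to the weight at
    [x] costs [(1 + |v|)^N]. The factor 2 counts real and imaginary parts, [n] the coordinates. *)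
Lemma sder_lip N c s psi x v : sbound N.+1 c psi -> (size s <= N)%N ->
  (1 + `|x|) ^+ N * rnorm (sder s (x + v) psi - sder s x psi)
    <= 2 * n%:R * c * (`|v| * (1 + `|v|) ^+ N).
Proof.
move=> h sN; set d := c * (1 + `|v|) ^+ N / (1 + `|x|) ^+ N.
have hd i (t : R) : 0 <= t <= 1 -> rnorm (sder (i :: s) (x + t *: v) psi) <= d.
  move=> /andP[t0 t1]; rewrite /d ler_pdivlMr ?weightX_gt0 //.
  have := @sbound_weight _ _ _ (i :: s) (x + t *: v) N h sN (leqnSn _).
  have hw : 1 + `|x| <= (1 + `|x + t *: v|) * (1 + `|v|).
    have e : 1 + `|x| = 1 + `|(x + t *: v) + (- t *: v)| by rewrite scaleNr addrK.
    rewrite e (le_trans (weightD _ _)) // ler_wpM2l ?(ltW (weight_gt0 _)) //.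
    by rewrite lerD2l normrZ normrN ger0_norm // ler_piMl.
  move=> /(ler_wpM2r (ltW (weightX_gt0 v N))); apply: le_trans.
  rewrite mulrC mulrAC ler_wpM2r ?rnorm_ge0 // -exprMn.
  by rewrite lerXn2r ?nnegrE ?mulr_ge0 ?(ltW (weight_gt0 _)).
have w0 := weightX_gt0 x N.
rewrite mulrC -ler_pdivlMr //.
have -> : 2 * n%:R * c * (`|v| * (1 + `|v|) ^+ N) / (1 + `|x|) ^+ N =
    n%:R * (`|v| * d) + n%:R * (`|v| * d) by rewrite /d; ring.
apply: (le_trans (rnorm_le_ReIm _)); rewrite !raddfB /=; apply: lerD.
- apply: (lipschitz_line (w := fun t => complex.Re (sder s t psi))) => [y|i t t01].
    exact: sder_Re_diff.
  exact: le_trans (Re_le_rnorm (sder (i :: s) (x + t *: v) psi)) (hd i t t01).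
- apply: (lipschitz_line (w := fun t => complex.Im (sder s t psi))) => [y|i t t01].
    exact: sder_Im_diff.
  exact: le_trans (Im_le_rnorm (sder (i :: s) (x + t *: v) psi)) (hd i t t01).
Qed.

Lemma sder_rescale s x (y : R) psi t : y != 0 ->
  sder s t (rescale x y psi) =
    ((y^-1) ^+ n)%:C * (((y^-1) ^+ size s)%:C * sder s (y^-1 *: (t - x)) psi).
Proof.
move=> y0; rewrite /sder.
have -> : (rescale x y psi : _ -> R[i]^o) = ((y^-1) ^+ n)%:C *: affcomp x y^-1 psi.
  by apply/funext => z; rewrite rescaleE.
have sp := (schwartzP psi).1.
rewrite pderivsZ; last first.
  by move=> r z; rewrite pderivs_affcomp //; apply: cdiffZ; exact: cdiff_affcomp.
by rewrite pderivs_affcomp.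
Qed.

(** The constant is explicit because its polynomial form in [|x|], [y] and [y^-1] is what the growth
    estimates use. *)
Lemma sbound_rescale N c x (y : R) psi : 0 < y -> sbound N c psi ->
  sbound N (c * ((1 + `|x|) ^+ N * (1 + y) ^+ N * (1 + y^-1) ^+ (n + N)))
    (rescale x y psi).
Proof.
move=> y0 h s t sN; have yn0 : y != 0 by rewrite gt_eqF.
have yi0 : 0 <= y^-1 by rewrite invr_ge0 ltW.
rewrite sder_rescale //; set z := y^-1 *: (t - x).
have -> : t = x + y *: z by rewrite /z scalerA divff // scale1r addrC subrK.
have hw : 1 + `|x + y *: z| <= (1 + `|x|) * ((1 + y) * (1 + `|z|)).
  apply: (le_trans (weightD _ _)); rewrite ler_wpM2l ?(ltW (weight_gt0 _)) //.
  rewrite normrZ (gtr0_norm y0) mulrDl mul1r mulrDr mulr1.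
  have := mulr_ge0 (ltW y0) (normr_ge0 z); have := normr_ge0 z; lra.
rewrite !rnormM !rnorm_real !ger0_norm ?exprn_ge0 // mulrA -exprD.
have e1 : y^-1 ^+ (n + size s) <= (1 + y^-1) ^+ (n + N).
  apply: (@le_trans _ _ ((1 + y^-1) ^+ (n + size s))).
    by rewrite lerXn2r ?nnegrE ?addr_ge0 // lerDr.
  by rewrite ler_weXn2l ?lerDl // leq_add2l.
have e2 : (1 + `|x + y *: z|) ^+ N * rnorm (sder s z psi) <=
    (1 + `|x|) ^+ N * (1 + y) ^+ N * c.
  apply: (le_trans _ (ler_wpM2l _ (h s z sN))); last first.
    by rewrite mulr_ge0 ?exprn_ge0 // addr_ge0 // ltW.
  rewrite mulrA ler_wpM2r ?rnorm_ge0 // -!exprMn -mulrA.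
  apply: lerXn2r => //; rewrite nnegrE; first exact: ltW (weight_gt0 _).
  by rewrite !mulr_ge0 ?(ltW (weight_gt0 _)) // addr_ge0 // ltW.
rewrite mulrCA [leRHS](_ : _ = (1 + y^-1) ^+ (n + N) * ((1 + `|x|) ^+ N * (1 + y) ^+ N * c)).
  by apply: ler_pM => //; [rewrite exprn_ge0|rewrite mulr_ge0 ?rnorm_ge0 // ltW // weightX_gt0].
ring.
Qed.

End SchwartzBounds.

(** * From pointwise convergence to convergence of Schwartz functions *)

Section Montel.
Variables (R : realType) (n : nat).
Implicit Types (psi chi : schwartz R n) (s : seq 'I_n) (x v t : 'rV[R]_n).

Lemma cvg_norm_le (u : nat -> R) (l c : R) :
  u m @[m --> \oo] --> l -> (forall m, `|u m| <= c) -> `|l| <= c.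
Proof.
move=> ul uc; apply/ler_addgt0Pr => e e0.
have [m hm] := filter_ex ((cvgrPdist_lt _ _).1 ul e e0).
have -> : l = u m + (l - u m) by rewrite addrC subrK.
by rewrite (le_trans (ler_normD _ _)) // lerD // ltW.
Qed.

Definition scvg (u : nat -> schwartz R n) psi :=
  forall N (e : R), 0 < e -> \forall m \near \oo, sbound N e (u m - psi).

Section Limit.
Variable u : nat -> schwartz R n.
Hypothesis bu : forall N, exists c, forall m, sbound N c (u m).
Variable l : seq 'I_n -> 'rV[R]_n -> R[i]^o.
Hypothesis ul : forall s x, sder s x (u m) @[m --> \oo] --> l s x.

Let limit_part (p : {additive R[i] -> R}) s x :
  (forall z, `|p z| <= rnorm z) ->
  (forall (s : seq 'I_n) psi x, differentiable (fun t => p (sder s t psi)) x) ->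
  (forall (s : seq 'I_n) psi i x, 'D_(delta_mx ord0 i) (fun t => p (sder s t psi)) x =
     p (sder (i :: s) x psi)) ->
  (forall (s : seq 'I_n) x, p (sder s x (u m)) @[m --> \oo] --> p (l s x)) ->
  differentiable (fun t => p (l s t)) x /\
  forall i, 'D_(delta_mx ord0 i) (fun t => p (l s t)) x = p (l (i :: s) x).
Proof.
move=> pn pd pD pl; have [c hc] := bu (size s).+2.
(* Bounds two orders higher make the Taylor remainder uniform in the sequence index, so it persists
   in the limit. *)
apply: (differentiable_taylor (c := n%:R * (n%:R * c))) => v.
have [->|v0] := eqVneq v 0.
  rewrite addr0 subrr sub0r normrN normr0 mul0r mulr0.
  by rewrite (_ : lindot _ 0 = 0) ?normr0 // linear0.
apply: (@cvg_norm_le (fun m => p (sder s (x + v) (u m)) - p (sder s x (u m)) -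
   lindot (fun i => p (sder (i :: s) x (u m))) v)).
  apply: cvgB; first by apply: cvgB; exact: pl.
  rewrite /lindot; apply: cvg_big => [|i _]; first exact: add_continuous.
  apply: cvgMl_tmp; exact: pl.
move=> m.
have -> : n%:R * (n%:R * c) * (`|v| * `|v|) = n%:R * (`|v| * (n%:R * (`|v| * c))) by ring.
have pD' i : 'D_(delta_mx ord0 i) (fun t => p (sder s t (u m))) =
    fun t => p (sder (i :: s) t (u m)) by apply/funext => t; rewrite pD.
have := @taylor1 R n (fun t => p (sder s t (u m))) x v c.
rewrite /lindot; under eq_bigr do rewrite pD.
apply => [y|i y|i j y]; first exact: pd.
  by rewrite pD'; exact: pd.
rewrite pD' pD (le_trans (pn _)) //.
exact: sbound_le (hc m) _.
Qed.

Lemma limit_schwartz : exists psi, forall s x, sder s x psi = l s x.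
Proof.
have ulR s x : complex.Re (sder s x (u m)) @[m --> \oo] --> complex.Re (l s x).
  by have [] := (cvg_complexP (fun m => sder s x (u m)) (l s x)).1 (@ul s x).
have ulI s x : complex.Im (sder s x (u m)) @[m --> \oo] --> complex.Im (l s x).
  by have [] := (cvg_complexP (fun m => sder s x (u m)) (l s x)).1 (@ul s x).
have HR s x := @limit_part (@complex.Re R) s x (@Re_le_rnorm R)
  (fun s psi x => sder_Re_diff s psi x) (fun _ _ _ _ => erefl) ulR.
have HI s x := @limit_part (@complex.Im R) s x (@Im_le_rnorm R)
  (fun s psi x => sder_Im_diff s psi x) (fun _ _ _ _ => erefl) ulI.
have lE s : pderivs s (l [::]) = l s.
  elim: s => // i s IH; apply/funext => x /=.
  rewrite IH /pderiv (HR s x).2 (HI s x).2.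
  by case: (l _ x).
have sl : is_schwartz (l [::]).
  split=> [s x|k s]; first by rewrite lE; split; [exact: (HR s x).1|exact: (HI s x).1].
  have [c hc] := bu (k + size s); exists c => x; rewrite lE mulrC -ler_pdivlMr ?weightX_gt0 //.
  apply: (cvg_rnorm_le (@ul s x)); near=> m.
  rewrite ler_pdivlMr ?weightX_gt0 // mulrC.
  by apply: sbound_weight (hc m) _ _; rewrite ?leq_addl ?leq_addr.
exists (Schwartz (asboolT sl)) => s x.
by rewrite /sder /= lE.
Unshelve. all: by end_near. Qed.

End Limit.

(** Far away, the spare power of the weight at order [N + 1] makes everything small; on the
    remaining ball, equi-Lipschitz bounds and compactness turn pointwise convergence into uniform
    convergence. *)
Lemma pointwise_scvg (u : nat -> schwartz R n) psi :
  (forall N, exists c, forall m, sbound N c (u m)) ->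
  (forall s x, sder s x (u m) @[m --> \oo] --> sder s x psi) -> scvg u psi.
Proof.
move=> bu ul N e e0.
suff : \forall m \near \oo, forall s, (size s <= N)%N ->
    forall x, (1 + `|x|) ^+ N * rnorm (sder s x (u m - psi)) <= e.
  by apply: filterS => m h s x sN; exact: h.
apply: words_forall => s sN.
have [c1 h1] := bu N.+1; have [c2 h2] := sbound_ex N.+1 psi.
pose c := c1 + c2.
have hd m : sbound N.+1 c (u m - psi) by exact: sboundB.
have c0 : 0 <= c := sbound_ge0 (hd 0%N).
pose r := c / e.
have far m x : r <= `|x| -> (1 + `|x|) ^+ N * rnorm (sder s x (u m - psi)) <= e.
  rewrite /r ler_pdivrMr // => hx.
  rewrite -(ler_pM2l (weight_gt0 x)) mulrA -exprS.
  apply: (le_trans (hd m s x (leqW sN))); rewrite (le_trans hx) //.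
  by rewrite ler_wpM2r ?(ltW e0) // lerDr.
pose K := [set x : 'rV[R]_n | `|x| <= r].
have cK : compact K.
  apply: bounded_closed_compact.
    exists r; split; first exact: num_real.
    by move=> y ry x /= hx; rewrite (le_trans hx) // ltW.
  apply: (@closed_comp _ _ (fun x : 'rV[R]_n => `|x|) [set y | y <= r]).
    by move=> x _; exact: norm_continuous.
  exact: closed_le.
have near_K : \forall m \near \oo, forall x, K x ->
    (1 + `|x|) ^+ N * rnorm (sder s x (u m - psi)) <= e.
  apply: ((compact_near_coveringP K).1 cK nat \oo (fun m x =>
    (1 + `|x|) ^+ N * rnorm (sder s x (u m - psi)) <= e)) => x Kx.
  (* [W] bounds the weight within distance 1 of the ball. Half of [e / W] is spent on the value at
     [x], half on the variation from [x] to [x'], whose Lipschitz constant is below [M]. *)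
  pose W := (2 + r) ^+ N.
  have r0 : 0 <= r by rewrite (le_trans (normr_ge0 x)).
  have W0 : 0 < W by rewrite exprn_gt0 // ltr_wpDr.
  pose d := e / W / 2; have d0 : 0 < d by rewrite !divr_gt0.
  pose M := 2 * n%:R * c * 2 ^+ N + 1.
  have M0 : 0 < M by rewrite ltr_wpDl // !mulr_ge0.
  have h0 : \forall m \near \oo, rnorm (sder s x (u m - psi)) < d.
    have /cvg_rnormP/(_ d d0) := ul s x; apply: filterS => m.
    by rewrite rnorm_distC linearB.
  have hx : \forall x' \near x, `|x' - x| < Num.min 1 (d / M).
    apply/nbhs_normP; exists (Num.min 1 (d / M)); first by rewrite /= lt_min ltr01 divr_gt0.
    by move=> y /=; rewrite distrC.
  exists ([set x' | `|x' - x| < Num.min 1 (d / M)], [set m | rnorm (sder s x (u m - psi)) < d]) => //.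
  move=> [x' m] /= []; rewrite lt_min => /andP[v1 vd] hm; set v := x' - x in v1 vd.
  have ev : x' = x + v by rewrite /v addrC subrK.
  have lip : rnorm (sder s x' (u m - psi) - sder s x (u m - psi)) <= d.
    have w1 : 1 <= (1 + `|x|) ^+ N by rewrite exprn_ege1 // weight_ge1.
    apply: (@le_trans _ _ ((1 + `|x|) ^+ N *
        rnorm (sder s x' (u m - psi) - sder s x (u m - psi)))).
      by rewrite ler_peMl ?rnorm_ge0.
    rewrite {1}ev (le_trans (sder_lip x v (hd m) sN)) //.
    have v2 : (1 + `|v|) ^+ N <= 2 ^+ N.
      by rewrite lerXn2r ?nnegrE ?addr_ge0 // -[2]/(1 + 1) lerD2l ltW.
    apply: (@le_trans _ _ (2 * n%:R * c * (`|v| * 2 ^+ N))).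
      by rewrite !ler_wpM2l // !mulr_ge0.
    rewrite (_ : 2 * n%:R * c * (`|v| * 2 ^+ N) = `|v| * (2 * n%:R * c * 2 ^+ N)); last by ring.
    apply: (@le_trans _ _ (`|v| * M)); first by rewrite ler_wpM2l // lerDl.
    by rewrite -ler_pdivlMr // ltW.
  have hW : (1 + `|x'|) ^+ N <= W.
    rewrite lerXn2r ?nnegrE ?addr_ge0 // ev.
    rewrite (le_trans (lerD (lexx 1) (ler_normD x v))) //.
    have := Kx; rewrite /K /=; move: v1; lra.
  have hs : rnorm (sder s x' (u m - psi)) <= e / W.
    rewrite -[sder s x' _](subrK (sder s x (u m - psi))).
    rewrite (le_trans (ler_rnormD _ _)) // [e / W]splitr lerD // ltW //.
  rewrite (le_trans (ler_pM _ _ hW hs)) ?rnorm_ge0 //.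
  by rewrite mulrC divfK // gt_eqF.
near=> m => x; have [|hx] := leP `|x| r; last by apply: far; exact: ltW.
by move: x; near: m; exact: near_K.
Unshelve. all: by end_near. Qed.

Lemma montel (u : nat -> schwartz R n) (l : seq 'I_n -> 'rV[R]_n -> R[i]^o) :
  (forall N, exists c, forall m, sbound N c (u m)) ->
  (forall s x, sder s x (u m) @[m --> \oo] --> l s x) ->
  exists2 psi, scvg u psi & forall s x, sder s x psi = l s x.
Proof.
move=> bu ul; have [psi hpsi] := limit_schwartz bu ul.
exists psi; last exact: hpsi.
apply: pointwise_scvg => [|s x]; first exact: bu.
by rewrite hpsi; exact: ul.
Qed.

End Montel.

(** * Complex Riemann sums and integrable weights *)

Section ComplexRiemannSums.
Variables (R : realType) (n : nat).
Implicit Types (F : 'rV[R]_n -> R[i]^o) (x a : 'rV[R]_n).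

Definition ccontinuous F := continuous (fun x => complex.Re (F x)) /\
  continuous (fun x => complex.Im (F x)).

Lemma ccontinuousM F G : ccontinuous F -> ccontinuous G ->
  ccontinuous (fun x => F x * G x).
Proof.
move=> [Fr Fi] [Gr Gi]; split=> x.
  rewrite (_ : (fun _ => _) = fun x => complex.Re (F x) * complex.Re (G x) -
      complex.Im (F x) * complex.Im (G x)); last first.
    by apply/funext => y; case: (F y) (G y) => ? ? [].
  exact: (cvgB (cvgM (Fr x) (Gr x)) (cvgM (Fi x) (Gi x))).
rewrite (_ : (fun _ => _) = fun x => complex.Re (F x) * complex.Im (G x) +
    complex.Im (F x) * complex.Re (G x)); last first.
  by apply/funext => y; case: (F y) (G y) => ? ? [].
exact: (cvgD (cvgM (Fr x) (Gi x)) (cvgM (Fi x) (Gr x))).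
Qed.

Definition cint F : R[i]^o :=
  (\int[lebesgue_tuple R n]_v complex.Re (F (row_of v))) +i*
  (\int[lebesgue_tuple R n]_v complex.Im (F (row_of v))).

Definition crsum m F a : R[i]^o :=
  (mesh R m ^+ n)%:C * \sum_(j : gidx n m) F (a - gpt R j).

Lemma Re_realM (r : R) (z : R[i]) : complex.Re (r%:C * z) = r * complex.Re z.
Proof. by case: z => a b /=; rewrite mul0r subr0. Qed.

Lemma Im_realM (r : R) (z : R[i]) : complex.Im (r%:C * z) = r * complex.Im z.
Proof. by case: z => a b /=; rewrite mul0r addr0. Qed.

Lemma crsum_cvg F (C : R) a : ccontinuous F -> (forall x, rnorm (F x) <= C * wt x) ->
  crsum m F a @[m --> \oo] --> cint F.
Proof.
move=> [Fr Fi] FC; apply/cvg_complexP; split.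
  rewrite (_ : (fun _ => _) = fun m => rsum m (fun x => complex.Re (F x)) a).
    apply: (rsum_cvg (C := C)) => // x.
    exact: le_trans (Re_le_rnorm _) (FC x).
  apply/funext => m; by rewrite /crsum Re_realM raddf_sum.
rewrite (_ : (fun _ => _) = fun m => rsum m (fun x => complex.Im (F x)) a).
  apply: (rsum_cvg (C := C)) => // x.
  exact: le_trans (Im_le_rnorm _) (FC x).
apply/funext => m; by rewrite /crsum Im_realM raddf_sum.
Qed.

Lemma wtN x : wt (- x) = wt x.
Proof. by rewrite /wt; apply: eq_bigr => i _; rewrite mxE /oneDsqr sqrrN. Qed.

(** Each factor [1 + x_i^2] is at most [(1 + |x|)^2]: integrability is bought with [2 n] powers of
    decay. *)
Lemma wt_weight x : 1 <= (1 + `|x|) ^+ (2 * n) * wt x.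
Proof.
rewrite exprM /wt -[X in _ ^+ X]card_ord -prodr_const -big_split /=.
apply: (@le_trans _ _ (\prod_(i < n) 1)); first by rewrite big1.
apply: ler_prod => i _; rewrite ler01 /= ler_pdivlMr ?mul1r.
  rewrite /oneDsqr sqrrD expr1n mul1r -addrA lerD2l.
  rewrite -[x ord0 i ^+ 2]real_normK ?num_real //.
  by rewrite ler_wpDl ?mulrn_wge0 // lerXn2r ?nnegrE // coord_le_norm.
by rewrite (lt_le_trans ltr01) // oneDsqr_ge1.
Qed.

Lemma le_wt (r c : R) x k : (1 + `|x|) ^+ (2 * n + k) * r <= c ->
  0 <= r -> r * (1 + `|x|) ^+ k <= c * wt x.
Proof.
move=> h r0; apply: le_trans (ler_wpM2r (ltW (wt_gt0 x)) h).
rewrite exprD -[leLHS]mul1r.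
rewrite (_ : _ * wt x =
   ((1 + `|x|) ^+ (2 * n) * wt x) * (r * (1 + `|x|) ^+ k)); last by ring.
by rewrite ler_wpM2r ?wt_weight // mulr_ge0 // ltW // weightX_gt0.
Qed.

(** This is where [y^-(2 n)] is lost when [rho] is sampled on the contracted grid [y *: gpt j]. *)
Lemma wt_scale (s : R) x : 0 < s -> s <= 1 -> wt (s *: x) <= s^-1 ^+ (2 * n) * wt x.
Proof.
move=> s0 s1; rewrite exprM /wt -[X in _ ^+ X * _]card_ord -prodr_const -big_split /=.
apply: ler_prod => i _; rewrite ltW ?oneDsqrV_gt0 //= mxE.
have p y : 0 < @oneDsqr R y by rewrite (lt_le_trans ltr01) // oneDsqr_ge1.
rewrite exprVn -invfM lef_pV2 ?posrE ?mulr_gt0 ?exprn_gt0 //.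
rewrite /oneDsqr mulrDr mulr1 exprMn lerD2r.
by rewrite exprn_ile1 // ltW.
Qed.

Lemma continuous_wt : continuous (@wt R n).
Proof.
move=> x; rewrite /wt.
apply: (@cvg_big _ _ _ _ _ _ _ (nbhs x) _ _ (fun i => (oneDsqr (x ord0 i))^-1)) => [|i _].
  exact: mul_continuous.
apply: (@cvg_comp _ _ _ (fun y : 'rV[R]_n => y ord0 i) (fun r : R => (oneDsqr r)^-1)
   _ (nbhs (x ord0 i))); first exact: (@coord_continuous R 1 n ord0 i x).
exact: continuous_oneDsqrV.
Qed.

(** A convergent sequence is bounded; this makes the estimates of the finite sums below uniform in
    the mesh. *)
Lemma wt_sum_bounded : exists2 W : R, 0 < W & forall m,
  \sum_(j : gidx n m) mesh R m ^+ n * wt (gpt R j) <= W.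
Proof.
have h : rsum m (@wt R n) 0 @[m --> \oo] --> \int[lebesgue_tuple R n]_v wt (row_of v).
  apply: (rsum_cvg (C := 1)); first exact: continuous_wt.
  by move=> x; rewrite mul1r ger0_norm // ltW // wt_gt0.
have /cvg_seq_bounded [M [_ hM]] := cvgP _ h.
exists (`|M| + 1); first by rewrite ltr_wpDl.
move=> m; have := hM (`|M| + 1); rewrite (le_lt_trans (ler_norm M)) ?ltrDl //.
move=> /(_ isT m I) /=; apply: le_trans.
apply: le_trans (ler_norm _); rewrite /rsum mulr_sumr.
by rewrite ler_sum // => j _; rewrite sub0r wtN.
Qed.

End ComplexRiemannSums.

(** * Affine changes of variable and sequences of Schwartz functions *)

Section RescaleLinear.
Variables (R : realType) (n : nat).
Implicit Types (psi chi : schwartz R n) (s : seq 'I_n) (x v t : 'rV[R]_n).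

Lemma rescaleP x (y : R) (a : R[i]) psi chi : y != 0 ->
  rescale x y (a *: psi + chi) = a *: rescale x y psi + rescale x y chi.
Proof.
move=> y0; apply: schwartz_ext => t; rewrite rescaleE //.
have E (b : R[i]) (p q : schwartz R n) : (b *: p + q) t = b * p t + q t by [].
by rewrite !E !rescaleE // mulrDr mulrCA.
Qed.

(** The composition law of the affine group, source of the commutation and polar identities
    below. *)
Lemma rescaleA x x' (y y' : R) psi : y != 0 -> y' != 0 ->
  rescale x y (rescale x' y' psi) = rescale (x + y *: x') (y * y') psi.
Proof.
move=> y0 y0'; apply: schwartz_ext => t; rewrite !rescaleE ?mulf_neq0 //.
rewrite mulrA -rmorphM -exprMn -invfM; congr (_ * psi _).
rewrite invfM [y^-1 * _]mulrC -scalerA; congr (_ *: _).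
by rewrite opprD addrA [in RHS]scalerBr scalerA mulVf // scale1r.
Qed.

Definition strans x psi := rescale x 1 psi.

Lemma strans_is_linear x : linear (strans x).
Proof. by move=> a psi chi; rewrite /strans rescaleP // oner_eq0. Qed.

HB.instance Definition _ x := GRing.isLinear.Build R[i] (schwartz R n) (schwartz R n) _
  (strans x) (strans_is_linear x).

Lemma sder_strans s x t psi : sder s t (strans x psi) = sder s (t - x) psi.
Proof.
by rewrite /strans sder_rescale ?oner_eq0 // invr1 !expr1n !mul1r scale1r.
Qed.

Lemma stransC x v psi : strans x (strans v psi) = strans v (strans x psi).
Proof. by rewrite /strans !rescaleA ?oner_eq0 // !scale1r addrC. Qed.

Lemma sbound_strans N c x psi : sbound N c psi ->
  sbound N (c * (1 + `|x|) ^+ N) (strans x psi).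
Proof.
move=> h s t sN; rewrite sder_strans.
apply: le_trans (ler_wpM2r (ltW (weightX_gt0 x N)) (h s (t - x) sN)).
rewrite mulrAC ler_wpM2r ?rnorm_ge0 // -exprMn lerXn2r ?nnegrE ?mulr_ge0 //.
have e : 1 + `|t| = 1 + `|(t - x) + x| by rewrite subrK.
by rewrite e weightD.
Qed.

End RescaleLinear.

Section Convergence.
Variables (R : realType) (n : nat).
Implicit Types (psi chi : schwartz R n) (s : seq 'I_n) (u v : nat -> schwartz R n).

Lemma scvg_unique u psi chi : scvg u psi -> scvg u chi -> psi = chi.
Proof.
move=> h k; apply: schwartz_ext => t; apply/eqP; rewrite -subr_eq0; apply/eqP.
have E : psi t - chi t = sder [::] t psi - sder [::] t chi by [].
rewrite E; apply: (@rnorm_eq0 R R[i]^o); apply/eqP; rewrite eq_le rnorm_ge0 andbT.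
apply/ler_addgt0Pr => e e0; rewrite add0r.
have e2 : 0 < e / 2 by rewrite divr_gt0.
have [m [h1 h2]] := filter_ex (filterI (h 0%N _ e2) (k 0%N _ e2)).
have := sbound_le (s := [::]) t (sboundB h2 h1) isT.
by rewrite -splitr opprB addrC addrA subrK linearB.
Qed.

Lemma scvg_sbound N c u psi : scvg u psi ->
  (forall e : R, 0 < e -> \forall m \near \oo, sbound N (c + e) (u m)) -> sbound N c psi.
Proof.
move=> h k s x sN; apply/ler_addgt0Pr => e e0.
have e2 : 0 < e / 2 by rewrite divr_gt0.
have [m [h1 h2]] := filter_ex (filterI (h N _ e2) (k _ e2)).
have := sboundB h2 h1 x sN.
have -> : u m - (u m - psi) = psi by rewrite opprB addrC subrK.
by rewrite -addrA -splitr.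
Qed.

Lemma scvgB u v psi chi : scvg u psi -> scvg v chi ->
  scvg (fun m => u m - v m) (psi - chi).
Proof.
move=> h k N e e0; have e2 : 0 < e / 2 by rewrite divr_gt0.
apply: filterS2 (h N _ e2) (k N _ e2) => m h1 h2.
have := sboundB h1 h2; rewrite -splitr.
by rewrite !opprB addrACA [in X in _ -> X]addrACA [- psi - _]addrC.
Qed.

Lemma scvg_image (T : schwartz R n -> schwartz R n) u psi :
  (forall a b, T (a - b) = T a - T b) ->
  (forall N, exists N' C, 0 <= C /\ forall c chi, sbound N' c chi -> sbound N (C * c) (T chi)) ->
  scvg u psi -> scvg (T \o u) (T psi).
Proof.
move=> Tsub Tb h N e e0; have [N' [C [C0 hC]]] := Tb N.
have C1 : 0 < C + 1 by rewrite ltr_wpDl.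
apply: filterS (h N' (e / (C + 1)) _); last by rewrite divr_gt0.
move=> m hm; rewrite /= -Tsub; apply: sboundW (leqnn _) _ (hC _ _ hm).
by rewrite mulrA ler_pdivrMr // mulrC ler_wpM2l ?lerDl // ltW.
Qed.

End Convergence.

(** * The averaging operators A_y *)

Section Averaging.
Variables (R : realType) (n : nat) (phi : schwartz R n).
Implicit Types (rho psi chi : schwartz R n) (x v t a : 'rV[R]_n) (r y : R).

Definition kern rho (sg ta : seq 'I_n) y t : 'rV[R]_n -> R[i]^o :=
  fun x => sder sg x phi * sder ta (t - y *: x) rho.

Lemma ccontinuous_sder sg psi : ccontinuous (fun x => sder sg x psi).
Proof.
split=> x; apply: differentiable_continuous; first exact: sder_Re_diff.
exact: sder_Im_diff.
Qed.

Lemma kern_cvg rho sg ta y t a :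
  crsum m (kern rho sg ta y t) a @[m --> \oo] --> cint (kern rho sg ta y t).
Proof.
have [c hc] := sbound_ex (2 * n + size sg) phi.
have [d hd] := sbound_ex (size ta) rho.
apply: (crsum_cvg (C := c * d)).
  apply: ccontinuousM; first exact: ccontinuous_sder.
  have cl : continuous (fun x => t - y *: x).
    by move=> x; apply: (@cvgB _ _ _ (nbhs x) _ (fun=> t)); [exact: cvg_cst|exact: scaler_continuous].
  have [cr ci] := ccontinuous_sder ta rho.
  by split=> x; [exact: (continuous_comp (cl x) (cr _))|
    exact: (continuous_comp (cl x) (ci _))].
move=> x; rewrite rnormM mulrAC.
apply: ler_pM; rewrite ?rnorm_ge0 //; last exact: sbound_le hd _.
have hx : (1 + `|x|) ^+ (2 * n + 0) * rnorm (sder sg x phi) <= c.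
  by apply: (sbound_weight x hc); rewrite ?leq_addl // addn0 leq_addr.
by have := le_wt hx (rnorm_ge0 _); rewrite expr0 mulr1.
Qed.

(** The sign is that of the sampling points of [crsum] with origin 0. *)
Definition coef m (j : gidx n m) : R[i] := (mesh R m ^+ n)%:C * phi (- gpt R j).

(* Two Riemann sums for the function t |-> \int phi(x) rho(t - y x) dx: by
   translates of rho, and, substituting x := (t - x) / y, by rescalings of phi. *)
Definition avgU y rho m : schwartz R n :=
  \sum_(j : gidx n m) coef j *: strans (- (y *: gpt R j)) rho.

Definition avgV y rho m : schwartz R n :=
  \sum_(j : gidx n m) ((mesh R m ^+ n * y ^+ n)%:C * rho (y *: gpt R j)) *:
    rescale (y *: gpt R j) y phi.

Lemma avgU_cvg y rho sg t :
  sder sg t (avgU y rho m) @[m --> \oo] --> cint (kern rho [::] sg y t).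
Proof.
rewrite (_ : (fun _ => _) = fun m => crsum m (kern rho [::] sg y t) 0).
  exact: kern_cvg.
apply/funext => m; rewrite /avgU /crsum linear_sum mulr_sumr.
apply: eq_bigr => j _; rewrite linearZ /= sder_strans sub0r /kern scalerN opprK.
by rewrite mulrA.
Qed.

(** Here the derivatives fall on [phi], at the price of [y^-1] each, whereas in [avgU_cvg] they fall
    on [rho]. The two limits are visibly the same only for the empty word. *)
Lemma avgV_cvg y rho sg t : 0 < y ->
  sder sg t (avgV y rho m) @[m --> \oo] -->
    ((y^-1 ^+ size sg)%:C * cint (kern rho sg [::] y t) : R[i]^o).
Proof.
move=> y0; have yn : y != 0 by rewrite gt_eqF.
(* With origin [y^-1 *: t], the values of [rho] are taken on the grid [y *: gpt j], which no longer
   depends on [t]. *)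
rewrite (_ : (fun _ => _) = fun m => ((y^-1 ^+ size sg)%:C : R[i]^o) *
    crsum m (kern rho sg [::] y t) (y^-1 *: t)).
  apply: cvgMl_tmp; exact: kern_cvg.
apply/funext => m; rewrite /avgV /crsum linear_sum mulrA mulr_sumr.
apply: eq_bigr => j _; rewrite linearZ /= sder_rescale // /kern.
have -> : y^-1 *: (t - y *: gpt R j) = y^-1 *: t - gpt R j.
  by rewrite scalerBr scalerA mulVf // scale1r.
have -> : t - y *: (y^-1 *: t - gpt R j) = y *: gpt R j.
  by rewrite scalerBr scalerA mulfV // scale1r opprB addrC subrK.
have -> : sder [::] (y *: gpt R j) rho = rho (y *: gpt R j) by [].
have e : (y ^+ n)%:C * (y^-1 ^+ n)%:C = 1 :> R[i].
  by rewrite -rmorphM -exprMn mulfV // expr1n.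
rewrite rmorphM /=.
rewrite (_ : _ *: _ = ((y ^+ n)%:C * (y^-1 ^+ n)%:C) *
  ((y^-1 ^+ size sg)%:C * (mesh R m ^+ n)%:C *
   (sder sg (y^-1 *: t - gpt R j) phi * rho (y *: gpt R j)))).
  by rewrite e mul1r.
by rewrite [LHS]/GRing.scale /=; ring.
Qed.

(** The discrete counterpart, uniform in the mesh, of the finiteness of a weighted [L^1] norm of
    [phi]. *)
Lemma coef_sum N : exists2 D : R, 0 <= D & forall m,
    \sum_(j : gidx n m) rnorm (coef j) * (1 + `|gpt R j|) ^+ N <= D.
Proof.
have [W W0 hW] := wt_sum_bounded R n.
have [c hc] := sbound_ex (2 * n + N) phi.
have c0 := sbound_ge0 hc.
exists (c * W) => [|m]; first by rewrite mulr_ge0 // ltW.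
apply: le_trans (ler_wpM2l c0 (hW m)); rewrite mulr_sumr ler_sum // => j _.
have h0 : 0 <= mesh R m ^+ n by rewrite exprn_ge0 // ltW // mesh_gt0.
rewrite /coef rnormM rnorm_real (ger0_norm h0) [leRHS]mulrCA -mulrA ler_wpM2l //.
rewrite -wtN -normrN; apply: le_wt; last exact: rnorm_ge0.
exact: (hc [::] (- gpt R j) isT).
Qed.

End Averaging.

Section AveragingOperator.
Variables (R : realType) (n : nat) (phi : schwartz R n).
Implicit Types (rho psi chi : schwartz R n) (x v t a : 'rV[R]_n) (r y : R).

Lemma weight_scale y x N : 0 <= y <= 1 -> (1 + `|y *: x|) ^+ N <= (1 + `|x|) ^+ N.
Proof.
move=> /andP[y0 y1]; rewrite lerXn2r ?nnegrE ?addr_ge0 // lerD2l normrZ ger0_norm //.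
by rewrite ler_piMl.
Qed.

Lemma avgU_sbound N : exists2 D : R, 0 <= D & forall rho c y m, 0 <= y <= 1 ->
  sbound N c rho -> sbound N (D * c) (avgU phi y rho m).
Proof.
have [D D0 hD] := coef_sum phi N; exists D => // rho c y m y01 hc.
have c0 := sbound_ge0 hc.
have h (j : gidx n m) : sbound N (rnorm (coef phi j) * (c * (1 + `|- (y *: gpt R j)|) ^+ N))
    (coef phi j *: strans (- (y *: gpt R j)) rho).
  by apply: sboundZ; exact: sbound_strans.
apply: sboundW (leqnn _) _ (sbound_sum _ h).
rewrite mulrC; apply: le_trans (ler_wpM2l c0 (hD m)); rewrite mulr_sumr ler_sum // => j _.
rewrite mulrCA ler_wpM2l // ler_wpM2l ?rnorm_ge0 // normrN.
exact: weight_scale.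
Qed.

(** This constant degenerates as [y] tends to 0; it serves to make the sums converge for a fixed
    [y]. Seminorm bounds uniform in [y] come from [avgU_sbound]. *)
Lemma avgV_sbound N rho y : 0 < y <= 1 -> exists D, forall m,
  sbound N D (avgV phi y rho m).
Proof.
move=> /andP[y0 y1]; have [c hc] := sbound_ex N phi.
have [d hd] := sbound_ex (2 * n + N) rho.
have [W W0 hW] := wt_sum_bounded R n.
have c0 := sbound_ge0 hc; have d0 := sbound_ge0 hd.
pose K := y ^+ n * c * ((1 + y) ^+ N * (1 + y^-1) ^+ (n + N)) * (d * y^-1 ^+ (2 * n)).
exists (K * W) => m.
pose g j := rnorm ((mesh R m ^+ n * y ^+ n)%:C * rho (y *: gpt R (j : gidx n m))) *
  (c * ((1 + `|y *: gpt R j|) ^+ N * (1 + y) ^+ N * (1 + y^-1) ^+ (n + N))).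
have h (j : gidx n m) : sbound N (g j)
   (((mesh R m ^+ n * y ^+ n)%:C * rho (y *: gpt R j)) *: rescale (y *: gpt R j) y phi).
  by apply: sboundZ; exact: sbound_rescale.
apply: sboundW (leqnn _) _ (sbound_sum _ h).
have y0' := ltW y0; have yi0 : 0 <= y^-1 by rewrite invr_ge0.
have K0 : 0 <= K.
  by rewrite /K !mulr_ge0 ?exprn_ge0 ?addr_ge0 ?mulr_ge0 ?exprn_ge0 ?addr_ge0.
apply: le_trans (ler_wpM2l K0 (hW m)); rewrite mulr_sumr ler_sum // => j _.
have h0 : 0 <= mesh R m ^+ n by rewrite exprn_ge0 // ltW // mesh_gt0.
have q : rnorm (rho (y *: gpt R j)) * (1 + `|y *: gpt R j|) ^+ N <=
    d * y^-1 ^+ (2 * n) * wt (gpt R j).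
  rewrite -mulrA; apply: le_trans (ler_wpM2l d0 (wt_scale _ y0 y1)).
  by apply: le_wt; [exact: (hd [::] _ isT)|exact: rnorm_ge0].
rewrite /g rnormM rnorm_real ger0_norm ?mulr_ge0 ?exprn_ge0 // ?(ltW (mesh_gt0 R m)) //.
set A := rnorm (rho _) in q *; set B := (1 + _) ^+ N in q *.
rewrite [leLHS](_ : _ = (mesh R m ^+ n * (y ^+ n * c * ((1 + y) ^+ N * (1 + y^-1) ^+ (n + N)))) *
   (A * B)); last by ring.
rewrite [leRHS](_ : _ = (mesh R m ^+ n * (y ^+ n * c * ((1 + y) ^+ N * (1 + y^-1) ^+ (n + N)))) *
   (d * y^-1 ^+ (2 * n) * wt (gpt R j))); last by rewrite /K; ring.
apply: ler_wpM2l => //.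
by do ![exact: h0|apply: mulr_ge0|apply: exprn_ge0|apply: addr_ge0].
Qed.

(** Both sums converge by [montel], and their limits take the same values, hence are the same
    Schwartz function. *)
Lemma avg_ex y rho : 0 < y <= 1 ->
  exists psi, scvg (avgU phi y rho) psi /\ scvg (avgV phi y rho) psi.
Proof.
move=> y01; have /andP[y0 y1] := y01.
have bU N : exists c, forall m, sbound N c (avgU phi y rho m).
  have [D _ hD] := avgU_sbound N; have [c hc] := sbound_ex N rho.
  by exists (D * c) => m; apply: hD => //; rewrite ltW.
have [psi hpsi Epsi] := montel bU (@avgU_cvg R n phi y rho).
have [chi hchi Echi] := montel (fun N => avgV_sbound N rho y01)
  (fun sg t => @avgV_cvg R n phi y rho sg t y0).
suff e : psi = chi by exists psi; split=> //; rewrite e.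
apply: schwartz_ext => t; have E2 := Echi [::] t; rewrite mul1r in E2.
by rewrite -[psi t]/(sder [::] t psi) Epsi -E2.
Qed.

(** Chosen as a common limit, so that each property of the operator is transferred from the more
    convenient of the two sums. *)
Definition avg y rho : schwartz R n :=
  xget 0 [set psi | scvg (avgU phi y rho) psi /\ scvg (avgV phi y rho) psi].

Lemma avgP y rho : 0 < y <= 1 ->
  scvg (avgU phi y rho) (avg y rho) /\ scvg (avgV phi y rho) (avg y rho).
Proof.
move=> y01; rewrite /avg.
apply: (@xgetPex _ 0 [set psi | scvg (avgU phi y rho) psi /\ scvg (avgV phi y rho) psi]).
exact: avg_ex.
Qed.

Lemma avg_sbound N : exists2 D : R, 0 <= D & forall rho c y, 0 < y <= 1 ->
  sbound N c rho -> sbound N (D * c) (avg y rho).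
Proof.
have [D D0 hD] := avgU_sbound N; exists D => // rho c y y01 hc.
have /andP[y0 y1] := y01.
apply: (scvg_sbound (avgP rho y01).1) => e e0; near=> m.
apply: (sboundW (leqnn _) _ (hD rho c y m _ hc)); first by rewrite lerDl ltW.
by rewrite ltW.
Unshelve. all: by end_near. Qed.

Lemma avgB y rho psi : 0 < y <= 1 -> avg y (rho - psi) = avg y rho - avg y psi.
Proof.
move=> y01; apply: (scvg_unique (avgP _ y01).1).
have := scvgB (avgP rho y01).1 (avgP psi y01).1.
rewrite (_ : (fun _ => _) = avgU phi y (rho - psi)) //.
apply/funext => m; rewrite /avgU -sumrB; apply: eq_bigr => j _.
by rewrite linearB scalerBr.
Qed.

Lemma avgU_strans y x rho m :
  avgU phi y (strans x rho) m = strans x (avgU phi y rho m).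
Proof.
rewrite /avgU linear_sum; apply: eq_bigr => j _.
by rewrite [RHS]linearZ /= stransC.
Qed.

Lemma avgU_Z y (b : R[i]) rho m : avgU phi y (b *: rho) m = b *: avgU phi y rho m.
Proof.
rewrite /avgU scaler_sumr; apply: eq_bigr => j _.
by rewrite [strans _ (_ *: _)]linearZ /= !scalerA [b * _]mulrC.
Qed.

Lemma avgZ y b rho : 0 < y <= 1 -> avg y (b *: rho) = b *: avg y rho.
Proof.
move=> y01; apply: (scvg_unique (avgP _ y01).1).
rewrite (_ : avgU _ _ _ = *:%R b \o avgU phi y rho); last first.
  by apply/funext => m; exact: avgU_Z.
apply: scvg_image (avgP rho y01).1 => [c d|N]; first exact: scalerBr.
by exists N, (rnorm b); split=> [|c chi]; [exact: rnorm_ge0|exact: sboundZ].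
Qed.

Lemma avg_strans y x rho : 0 < y <= 1 -> avg y (strans x rho) = strans x (avg y rho).
Proof.
move=> y01; apply: (scvg_unique (avgP _ y01).1).
rewrite (_ : avgU _ _ _ = strans x \o avgU phi y rho); last first.
  by apply/funext => m; exact: avgU_strans.
apply: scvg_image (avgP rho y01).1 => [c d|N]; first exact: linearB.
exists N, ((1 + `|x|) ^+ N); split=> [|c chi h]; first exact: ltW (weightX_gt0 _ _).
by rewrite mulrC; exact: sbound_strans.
Qed.

Lemma avg_avgU y r rho m : 0 < y <= 1 -> avg y (avgU phi r rho m) = avgU phi r (avg y rho) m.
Proof.
move=> y01; have a0 : avg y 0 = 0 by rewrite -[X in avg y X](subrr 0) avgB // subrr.
have aD psi chi : avg y (psi + chi) = avg y psi + avg y chi.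
  by rewrite -[chi in LHS]opprK avgB // -[- chi]scaleN1r avgZ // scaleN1r opprK.
rewrite /avgU; elim/big_rec2: _ => [|j p q _ e]; first exact: a0.
by rewrite aD avgZ // avg_strans // e.
Qed.

(** [avg y] is linear and commutes with translations, hence with each finite sum [avgU]; its
    continuity carries this to the limit. *)
Lemma avgC y r rho : 0 < y <= 1 -> 0 < r <= 1 -> avg y (avg r rho) = avg r (avg y rho).
Proof.
move=> y01 r01; apply: (@scvg_unique _ _ (avgU phi r (avg y rho))); last first.
  exact: (avgP _ r01).1.
rewrite (_ : avgU _ _ _ = avg y \o avgU phi r rho); last first.
  by apply/funext => m; rewrite /= avg_avgU.
apply: scvg_image (avgP rho r01).1 => [c d|N]; first exact: avgB.
have [D D0 hD] := avg_sbound N; exists N, D; split=> // c chi; exact: hD.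
Qed.

End AveragingOperator.

(** * Powers of 1 - A_y *)

Section Approximation.
Variables (R : realType) (n : nat) (phi : schwartz R n).
Hypothesis phi1 : schwartz_integral phi = 1.
Implicit Types (rho psi chi : schwartz R n) (x v t a : 'rV[R]_n) (r y : R).

Lemma coef_sum_cvg : (\sum_(j : gidx n m) coef phi j : R[i]^o) @[m --> \oo] --> (1 : R[i]^o).
Proof.
have [c hc] := sbound_ex (2 * n + 0) phi.
have h : crsum m phi 0 @[m --> \oo] --> cint phi.
  apply: (crsum_cvg (C := c)) => [|x]; first exact: (ccontinuous_sder [::] phi).
  by have := le_wt (hc [::] x isT) (rnorm_ge0 _); rewrite expr0 mulr1.
rewrite -phi1 -[schwartz_integral phi]/(cint phi).
rewrite (_ : (fun _ => _) = fun m => crsum m phi 0) //.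
by apply/funext => m; rewrite /crsum mulr_sumr; apply: eq_bigr => j _; rewrite sub0r.
Qed.

Lemma sbound_strans_sub N c v rho : sbound N.+1 c rho ->
  sbound N (2 * n%:R * c * (`|v| * (1 + `|v|) ^+ N)) (rho - strans (- v) rho).
Proof.
move=> h s x sN; rewrite linearB /= sder_strans opprK rnorm_distC.
exact: sder_lip.
Qed.

(** As [phi] has mass 1, [rho - A_y rho] is an average of differences of translates, each [O(y)] at
    the cost of one order. For the finite sums the defect of mass is a separate term, which vanishes
    in the limit. *)
Lemma avg_approx N : exists2 D : R, 0 <= D & forall rho c y, 0 < y <= 1 ->
  sbound N.+1 c rho -> sbound N (D * y * c) (rho - avg phi y rho).
Proof.
have [D D0 hD] := coef_sum phi N.+1; exists (2 * n%:R * D); first by rewrite !mulr_ge0.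
move=> rho c y y01 hc; have /andP[y0 y1] := y01; have c0 := sbound_ge0 hc.
have cv : scvg (fun m => rho - avgU phi y rho m) (rho - avg phi y rho).
  apply: scvgB (avgP phi rho y01).1 => M e e0; near=> m.
  rewrite subrr; apply: (sboundW (leqnn M) (ltW e0)); exact: sbound0.
apply: (scvg_sbound cv) => e e0.
have c1 : 0 < c + 1 by rewrite ltr_wpDl.
have /cvg_rnormP/(_ (e / (c + 1))) := coef_sum_cvg.
rewrite divr_gt0 // => /(_ isT); apply: filterS => m hm.
rewrite (_ : rho - avgU phi y rho m = (\sum_(j : gidx n m) coef phi j *:
    (rho - strans (- (y *: gpt R j)) rho)) + (1 - \sum_(j : gidx n m) coef phi j) *: rho); last first.
  under eq_bigr do rewrite scalerBr.
  by rewrite sumrB -scaler_suml scalerBl scale1r [RHS]addrC addrA subrK.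
apply: sboundD.
  have h (j : gidx n m) : sbound N (rnorm (coef phi j) *
      (2 * n%:R * c * (`|y *: gpt R j| * (1 + `|y *: gpt R j|) ^+ N)))
      (coef phi j *: (rho - strans (- (y *: gpt R j)) rho)).
    by apply: sboundZ; exact: sbound_strans_sub.
  apply: sboundW (leqnn _) _ (sbound_sum _ h).
  have k0 : 0 <= 2 * n%:R * c * y by rewrite !mulr_ge0 // ltW.
  rewrite [leRHS](_ : _ = 2 * n%:R * c * y * D); last by ring.
  apply: le_trans (ler_wpM2l k0 (hD m)); rewrite mulr_sumr ler_sum // => j _.
  rewrite [leRHS]mulrCA ler_wpM2l ?rnorm_ge0 //.
  rewrite -[leRHS]mulrA ler_wpM2l ?mulr_ge0 // normrZ gtr0_norm // -mulrA ler_wpM2l ?(ltW y0) //.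
  rewrite exprS ler_pM ?exprn_ge0 ?addr_ge0 ?mulr_ge0 ?(ltW y0) // ?lerDr //.
  by rewrite lerXn2r ?nnegrE ?addr_ge0 ?mulr_ge0 ?(ltW y0) // lerD2l ler_piMl.
apply: sboundW (leqnn _) _ (sboundZ _ (sboundW (leqnSn N) (lexx c) hc)).
rewrite (le_trans (ler_wpM2r c0 (ltW hm))) // mulrAC ler_pdivrMr //.
by rewrite ler_wpM2l ?lerDl // ltW.
Unshelve. all: by end_near. Qed.

Definition dev y rho : schwartz R n := rho - avg phi y rho.

Definition devs y m rho := iter m (dev y) rho.

Lemma devC y r rho : 0 < y <= 1 -> 0 < r <= 1 -> dev y (dev r rho) = dev r (dev y rho).
Proof.
move=> y01 r01; rewrite /dev (avgB _ _ _ y01) (avgB _ _ _ r01) (avgC phi rho y01 r01).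
move: (avg phi y rho) (avg phi r rho) (avg phi r _) => b c d.
by rewrite !opprB [LHS]addrACA [RHS]addrACA; congr (_ + _); exact: addrC.
Qed.

Lemma devs_devC y r k rho : 0 < y <= 1 -> 0 < r <= 1 ->
  devs y k (dev r rho) = dev r (devs y k rho).
Proof.
move=> y01 r01; elim: k => [|k IH]; first by [].
exact: (etrans (congr1 (dev y) IH) (devC (devs y k rho) y01 r01)).
Qed.

Lemma devsC y r k m rho : 0 < y <= 1 -> 0 < r <= 1 ->
  devs y k (devs r m rho) = devs r m (devs y k rho).
Proof.
move=> y01 r01; elim: m => [|m IH]; first by [].
exact: (etrans (devs_devC k (devs r m rho) y01 r01) (congr1 (dev r) IH)).
Qed.

Lemma devs_sbound N m : exists2 D : R, 0 <= D & forall rho c y, 0 < y <= 1 ->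
  sbound (N + m) c rho -> sbound N (D * y ^+ m * c) (devs y m rho).
Proof.
elim: m N => [|m IH] N.
  by exists 1 => // rho c y _; rewrite addn0 expr0 !mul1r.
have [D D0 hD] := IH N.+1; have [D' D'0 hD'] := avg_approx N.
exists (D' * D); first by rewrite mulr_ge0.
move=> rho c y y01; rewrite addnS -addSn => /(hD _ _ _ y01) /(hD' _ _ _ y01).
by congr (sbound _ _ _); rewrite exprS; ring.
Qed.

End Approximation.

(** * Continuous seminorms controlled on the rescalings of phi *)

Section Seminorms.
Variables (R : realType) (n : nat).
Implicit Types (rho psi chi : schwartz R n) (x v t : 'rV[R]_n) (y c B : R).

(** The order [M] and the constant [C] are hidden on purpose: the estimate to be proved must not
    depend on them. *)
Definition cseminorm (tau : schwartz R n -> R) :=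
  [/\ forall psi chi, tau (psi + chi) <= tau psi + tau chi,
      forall (a : R[i]) psi, tau (a *: psi) = rnorm a * tau psi &
      exists M (C : R), 0 <= C /\ forall c psi, sbound M c psi -> tau psi <= C * c].

Section Theory.
Variable tau : schwartz R n -> R.
Hypothesis htau : cseminorm tau.

Lemma cseminorm0 : tau 0 = 0.
Proof. by case: htau => _ h _; rewrite -(scale0r 0) h rnorm0 mul0r. Qed.

Lemma cseminormN psi : tau (- psi) = tau psi.
Proof.
case: htau => _ h _; rewrite -scaleN1r h.
by rewrite (rnormN (1 : R[i]^o)) rnorm1 mul1r.
Qed.

Lemma cseminormD psi chi : tau (psi + chi) <= tau psi + tau chi.
Proof. by case: htau. Qed.

Lemma cseminormB psi chi : tau (psi - chi) <= tau psi + tau chi.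
Proof. by rewrite -(cseminormN chi) cseminormD. Qed.

Lemma cseminorm_sum I (r : seq I) (P : pred I) (F : I -> schwartz R n) :
  tau (\sum_(i <- r | P i) F i) <= \sum_(i <- r | P i) tau (F i).
Proof.
elim/big_rec2: _ => [|i y x _ h]; first by rewrite cseminorm0.
by rewrite (le_trans (cseminormD _ _)) // lerD2l.
Qed.

Lemma cseminorm_cvg u psi c : scvg u psi -> (forall m : nat, tau (u m) <= c) -> tau psi <= c.
Proof.
move=> h uc; case: (htau) => _ _ [M [C [C0 hC]]].
apply/ler_addgt0Pr => e e0; have C1 : 0 < C + 1 by rewrite ltr_wpDl.
have [|m hm] := filter_ex (h M (e / (C + 1)) _); first by rewrite divr_gt0.
have -> : psi = u m - (u m - psi) by rewrite opprB addrC subrK.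
rewrite (le_trans (cseminormB _ _)) // lerD // (le_trans (hC _ _ hm)) //.
by rewrite mulrA ler_pdivrMr // mulrC ler_wpM2l ?lerDl // ltW.
Qed.

End Theory.
End Seminorms.

Section Boundedness.
Variables (R : realType) (n : nat) (phi : schwartz R n).
Hypothesis phi1 : schwartz_integral phi = 1.
Variable K : nat.
Implicit Types (rho psi chi : schwartz R n) (x v t : 'rV[R]_n) (y c B : R).

Definition tbound (tau : schwartz R n -> R) B := forall x y, 0 < y <= 1 ->
  tau (rescale x y phi) <= B * ((1 + `|x|) ^+ K * y^-1 ^+ K).

(** [avgV] combines the very functions on which [tau] is controlled, so subadditivity bounds it
    uniformly in the mesh. In the exponent, [K] comes from [tbound] and [2 n] from [wt_scale]. *)
Lemma cseminorm_avg : exists2 D : R, 0 <= D & forall tau B rho c y,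
  cseminorm tau -> 0 <= B -> tbound tau B -> 0 < y <= 1 ->
  sbound (2 * n + K) c rho -> tau (avg phi y rho) <= D * B * y^-1 ^+ (K + 2 * n) * c.
Proof.
have [W W0 hW] := wt_sum_bounded R n; exists W; first exact: ltW.
move=> tau B rho c y htau B0 hB y01 hc; have c0 := sbound_ge0 hc.
have /andP[y0 y1] := y01; have y0' := ltW y0; have yi0 : 0 <= y^-1 by rewrite invr_ge0.
apply: (cseminorm_cvg htau (avgP phi rho y01).2) => m.
apply: (le_trans (cseminorm_sum htau _ _ _)).
pose k := B * y^-1 ^+ (K + 2 * n) * c.
have k0 : 0 <= k by rewrite /k !mulr_ge0 ?exprn_ge0.
rewrite [leRHS](_ : _ = k * W); last by rewrite /k; ring.
apply: le_trans (ler_wpM2l k0 (hW m)); rewrite mulr_sumr ler_sum // => j _.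
case: (htau) => _ -> _; rewrite rnormM rnorm_real.
have h0 : 0 <= mesh R m ^+ n by rewrite exprn_ge0 // ltW // mesh_gt0.
rewrite ger0_norm; last by rewrite mulr_ge0 // exprn_ge0.
have q : rnorm (rho (y *: gpt R j)) * (1 + `|y *: gpt R j|) ^+ K <=
    c * y^-1 ^+ (2 * n) * wt (gpt R j).
  rewrite -mulrA; apply: le_trans (ler_wpM2l c0 (wt_scale _ y0 y1)).
  by apply: le_wt; [exact: (hc [::] _ isT)|exact: rnorm_ge0].
have A0 := rnorm_ge0 (rho (y *: gpt R j)).
set A := rnorm (rho _) in q A0 *.
apply: (@le_trans _ _ (mesh R m ^+ n * y ^+ n * A *
    (B * ((1 + `|y *: gpt R j|) ^+ K * y^-1 ^+ K)))).
  by apply: ler_wpM2l; [rewrite !mulr_ge0 // exprn_ge0|exact: hB].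
set w := (1 + _) ^+ K in q *.
rewrite [leLHS](_ : _ = (mesh R m ^+ n * y ^+ n * B * y^-1 ^+ K) * (A * w)); last by ring.
apply: (@le_trans _ _ ((mesh R m ^+ n * y ^+ n * B * y^-1 ^+ K) *
   (c * y^-1 ^+ (2 * n) * wt (gpt R j)))).
  by apply: ler_wpM2l; [do ![exact: h0|apply: mulr_ge0|exact: B0|apply: exprn_ge0]|exact: q].
rewrite (_ : _ * (c * _ * _) = y ^+ n * (k * (mesh R m ^+ n * wt (gpt R j)))); last first.
  by rewrite /k exprD; ring.
have wg := ltW (wt_gt0 (gpt R j)).
by apply: ler_piMl; [do ![exact: h0|exact: k0|exact: wg|apply: mulr_ge0]|exact: exprn_ile1].
Qed.

(** Induction on [1 - (1 - A)^(m+1) = A (1 - A)^m + (1 - (1 - A)^m)], whose first term is an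
    average. *)
Lemma cseminorm_sub_devs m : exists2 D : R, 0 <= D & forall tau B rho c y,
  cseminorm tau -> 0 <= B -> tbound tau B -> 0 < y <= 1 ->
  sbound (2 * n + K + m) c rho ->
  tau (rho - devs phi y m rho) <= D * B * y^-1 ^+ (K + 2 * n) * c.
Proof.
have [D D0 hD] := cseminorm_avg; elim: m => [|m [D1 D10 IH]].
  exists 0 => // tau B rho c y htau *; rewrite /devs /= subrr (cseminorm0 htau).
  by rewrite !mul0r.
have [D2 D20 hD2] := devs_sbound phi1 (2 * n + K) m.
exists (D1 + D * D2); first by rewrite addr_ge0 // mulr_ge0.
move=> tau B rho c y htau B0 hB y01 hc; have c0 := sbound_ge0 hc.
have /andP[y0 y1] := y01; have yi0 : 0 <= y^-1 by rewrite invr_ge0 ltW.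
have hc' : sbound (2 * n + K + m) c rho by apply: sboundW hc => //; rewrite leq_add2l.
rewrite (_ : rho - devs phi y m.+1 rho =
    avg phi y (devs phi y m rho) + (rho - devs phi y m rho)); last first.
  by rewrite -[devs phi y m.+1 rho]/(devs phi y m rho - avg phi y (devs phi y m rho))
    opprB addrCA.
apply: (le_trans (cseminormD htau _ _)).
rewrite [leRHS](_ : _ = D * D2 * B * y^-1 ^+ (K + 2 * n) * c +
    D1 * B * y^-1 ^+ (K + 2 * n) * c); last by ring.
apply: lerD; last exact: IH htau B0 hB y01 hc'.
apply: (le_trans (hD tau B _ _ y htau B0 hB y01 (hD2 _ _ _ y01 hc'))).
rewrite [leLHS](_ : _ = y ^+ m * (D * D2 * B * y^-1 ^+ (K + 2 * n) * c)); last by ring.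
have y0' := ltW y0.
by apply: ler_piMl; [do ![exact: D0|apply: mulr_ge0|apply: exprn_ge0]|exact: exprn_ile1].
Qed.

Definition dy (j : nat) : R := 2^-1 ^+ j.

Lemma dy_itv j : 0 < dy j <= 1.
Proof. by rewrite /dy exprn_gt0 //= exprn_ile1 // invf_le1 // ler1n. Qed.

Lemma sum_dy J : \sum_(j < J) dy j <= 2.
Proof.
suff -> : \sum_(j < J) dy j = 2 - 2 * dy J.
  by rewrite gerBl mulr_ge0 //; have /andP[/ltW] := dy_itv J.
elim: J => [|J IH]; first by rewrite big_ord0 /dy expr0; lra.
by rewrite big_ord_recr /= IH /dy exprS; field.
Qed.

Lemma cseminorm_sub_chain (tau : schwartz R n -> R) (u : nat -> schwartz R n) J :
  cseminorm tau -> tau (u 0%N - u J) <= \sum_(j < J) tau (u j - u j.+1).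
Proof.
move=> htau; elim: J => [|J IH]; first by rewrite subrr big_ord0 (cseminorm0 htau).
rewrite big_ord_recr /=; apply: le_trans (lerD IH (lexx _)).
rewrite (_ : u 0%N - u J.+1 = (u 0%N - u J) + (u J - u J.+1)); last by rewrite addrA subrK.
exact: cseminormD.
Qed.

(* With E_y = (1 - A_y)^m, 1 - E_y has A_y as a factor, hence is controlled by
   the transform, while E_y is O(y^m). For the commuting operators a = E_j and
   b = E_(j+1), a - b = (1 - b) a - (1 - a) b, so both gains are available in
   each term of the telescoping sum over y = 2^-j. *)
Lemma cseminorm_bounded : exists N, exists2 D : R, 0 <= D & forall tau B psi c,
  cseminorm tau -> 0 <= B -> tbound tau B -> sbound N c psi -> tau psi <= D * B * c.
Proof.
(* [p] is the loss in [cseminorm_sub_devs]; with [m = p + 1] exactly one power of [y] remains,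
   summable over [y = 2^-j]. *)
pose p := (K + 2 * n)%N; pose m := p.+1; pose N0 := (2 * n + K)%N.
have [D1 D10 h1] := cseminorm_sub_devs m.
have [D2 D20 h2] := devs_sbound phi1 (N0 + m) m.
pose D3 := D1 * D2 * (2 ^+ p + 1).
have D30 : 0 <= D3 by rewrite /D3 !mulr_ge0 // addr_ge0 // exprn_ge0.
exists (N0 + m + m)%N, (D1 + D3 * 2); first by rewrite addr_ge0 // mulr_ge0.
move=> tau B psi c htau B0 hB hc; have c0 := sbound_ge0 hc.
pose E j := devs phi (dy j) m psi.
have dyp j : 0 < dy j by have /andP[] := dy_itv j.
have diff j : tau (E j - E j.+1) <= D3 * B * c * dy j.
  have s1 := h2 _ _ _ (dy_itv j) hc; have s2 := h2 _ _ _ (dy_itv j.+1) hc.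
  have t1 := h1 _ _ _ _ _ htau B0 hB (dy_itv j.+1) s1.
  have t2 := h1 _ _ _ _ _ htau B0 hB (dy_itv j) s2.
  have e : E j - E j.+1 = (E j - devs phi (dy j.+1) m (E j)) -
      (E j.+1 - devs phi (dy j) m (E j.+1)).
    have ec : devs phi (dy j.+1) m (E j) = devs phi (dy j) m (E j.+1).
      exact: (devsC phi m m psi (dy_itv j.+1) (dy_itv j)).
    rewrite ec; move: (E j) (E j.+1) (devs _ _ _ _) => a b d.
    by rewrite opprB addrA subrK.
  rewrite e (le_trans (cseminormB htau _ _)) //.
  rewrite (le_trans (lerD t1 t2)) //.
  (* The estimate at the finer scale costs [2^p] more than the other one: hence [2 ^+ p + 1] in
     [D3]. *)
  have -> : (dy j.+1)^-1 = 2 * (dy j)^-1 by rewrite /dy exprS invfM invrK.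
  have hy : (dy j)^-1 ^+ p * dy j ^+ m = dy j.
    by rewrite /m exprSr mulrA -exprMn mulVf ?gt_eqF // expr1n mul1r.
  have hy1 : dy j.+1 ^+ m <= dy j ^+ m.
    have [a b] := (dyp j, dyp j.+1).
    by rewrite lerXn2r ?nnegrE ?(ltW a) ?(ltW b) // /dy exprS ler_piMl ?exprn_ge0 // invf_le1 // ler1n.
  rewrite -/p [leLHS](_ : _ = D1 * D2 * B * c * (2 ^+ p * ((dy j)^-1 ^+ p * dy j ^+ m)) +
     D1 * D2 * B * c * ((dy j)^-1 ^+ p * dy j.+1 ^+ m)); last by rewrite exprMn; ring.
  rewrite [leRHS](_ : _ = D1 * D2 * B * c * (2 ^+ p * dy j) + D1 * D2 * B * c * dy j);
    last by rewrite /D3; ring.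
  have q0 : 0 <= D1 * D2 * B * c by rewrite !mulr_ge0.
  rewrite hy lerD2l ler_wpM2l // -{2}hy ler_wpM2l // exprn_ge0 // invr_ge0 ltW //.
have start : tau (psi - E 0%N) <= D1 * B * c.
  have hc' : sbound (N0 + m) c psi by apply: sboundW hc => //; rewrite leq_addr.
  have := h1 _ _ _ _ _ htau B0 hB (dy_itv 0) hc'.
  by rewrite /dy expr0 invr1 expr1n mulr1.
(* The order and constant of [tau] itself enter only here, to make [tau (E J)] small for one large
   [J]; the final bound keeps no trace of them. *)
apply/ler_addgt0Pr => e e0; case: (htau) => _ _ [M [C [C0 hC]]].
have [D4 D40 h4] := devs_sbound phi1 M m; have [d hd] := sbound_ex (M + m) psi.
have d0 := sbound_ge0 hd.
have [J hJ] : exists J, tau (E J) <= e.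
  have q1 : 0 < C * (D4 * d) + 1 by rewrite ltr_wpDl // !mulr_ge0.
  have [J hJ] : exists J, dy J < e / (C * (D4 * d) + 1).
    have half : `|2^-1 : R| < 1 by rewrite ger0_norm // invf_lt1 // ltr1n.
    have /cvgrPdist_lt/(_ (e / (C * (D4 * d) + 1))) := cvg_expr half.
    rewrite divr_gt0 // => /(_ isT)/filter_ex[J]; rewrite sub0r normrN ger0_norm ?exprn_ge0 // => hJ.
    by exists J.
  exists J; apply: (le_trans (hC _ _ (h4 _ _ _ (dy_itv J) hd))).
  have yJ : dy J ^+ m <= dy J.
    by rewrite /m exprS ler_piMr ?(ltW (dyp J)) // exprn_ile1 ?(ltW (dyp J)) //; have /andP[] := dy_itv J.
  rewrite [leLHS](_ : _ = (C * (D4 * d)) * dy J ^+ m); last by ring.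
  apply: (@le_trans _ _ ((C * (D4 * d) + 1) * dy J)).
    by rewrite ler_pM ?exprn_ge0 ?(ltW (dyp J)) // ?lerDl // !mulr_ge0.
  by rewrite mulrC -ler_pdivlMr // ltW.
have key a b : tau psi <= tau (psi - a) + (tau (a - b) + tau b).
  apply: (@le_trans _ _ (tau (psi - a) + tau a)).
    by rewrite -{1}(subrK a psi); exact: cseminormD.
  by rewrite lerD2l -{1}(subrK b a); exact: cseminormD.
apply: (le_trans (key (E 0%N) (E J))).
rewrite [leRHS](_ : _ = D1 * B * c + (D3 * B * c * 2 + e)); last by ring.
apply: lerD; first exact: start.
apply: lerD; last exact: hJ.
apply: (le_trans (cseminorm_sub_chain E J htau)).
apply: (@le_trans _ _ (\sum_(j < J) D3 * B * c * dy j)).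
  by apply: ler_sum => j _; exact: diff.
rewrite -mulr_sumr.
by rewrite ler_wpM2l ?sum_dy // !mulr_ge0.
Qed.

End Boundedness.

(** * Completeness of the Schwartz space and uniform boundedness *)

Section Completeness.
Variables (R : realType) (n : nat).
Implicit Types (psi chi : schwartz R n) (u : nat -> schwartz R n).

Lemma real_cauchy_cvg (a : nat -> R) :
  (forall e, 0 < e -> exists k, forall l, (k <= l)%N -> `|a l - a k| <= e) ->
  a m @[m --> \oo] --> limn a.
Proof.
move=> h; apply: cauchy_cvg; apply: cauchy_exP => e e0.
have e2 : 0 < e / 2 by rewrite divr_gt0.
have [k hk] := h _ e2; exists (a k); exists k => // l /= kl.
rewrite -ball_normE /= distrC (le_lt_trans (hk l kl)) //.
by rewrite ltr_pdivrMr // ltr_pMr // ltr1n.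
Qed.

Lemma schwartz_complete u :
  (forall N e, 0 < e -> exists k, forall l, (k <= l)%N -> sbound N e (u l - u k)) ->
  exists psi, scvg u psi.
Proof.
move=> h.
have bu N : exists c, forall m, sbound N c (u m).
  have [k hk] := h N 1 ltr01.
  have [c hc] := choice (fun m => sbound_ex N (u m)).
  have c0 m : 0 <= c m := sbound_ge0 (hc m).
  have S0 (J : nat) : 0 <= \sum_(j < J) c j by rewrite sumr_ge0.
  exists (\sum_(j < k.+1) c j + 1) => m; have [km|mk] := leqP k m.
    rewrite (_ : u m = u k + (u m - u k)); last by rewrite addrC subrK.
    apply: sboundD; last exact: hk.
    by apply: sboundW (leqnn _) _ (hc k); rewrite big_ord_recr /= lerDr; exact: S0.
  apply: sboundW (leqnn _) _ (hc m).
  rewrite (bigD1 (Ordinal (leqW mk))) //= -addrA lerDl.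
  by apply: addr_ge0; [exact: sumr_ge0|exact: ler01].
have hp (p : {additive R[i] -> R}) s x : (forall z, `|p z| <= rnorm z) ->
    p (sder s x (u m)) @[m --> \oo] --> limn (fun m => p (sder s x (u m))).
  move=> pn; apply: real_cauchy_cvg => e e0; have [k hk] := h (size s) e e0.
  exists k => l kl; rewrite -raddfB -linearB (le_trans (pn _)) //.
  exact: sbound_le (hk l kl) (leqnn _).
have [||psi hpsi _] := @montel R n u (fun s x =>
  limn (fun m => complex.Re (sder s x (u m))) +i*
  limn (fun m => complex.Im (sder s x (u m)))).
- exact: bu.
- move=> s x; apply/cvg_complexP; split.
    exact: (hp (@complex.Re R) s x (@Re_le_rnorm R)).
  exact: (hp (@complex.Im R) s x (@Im_le_rnorm R)).
by exists psi.
Qed.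

Lemma uniform_boundedness (I : Type) (tau : I -> schwartz R n -> R) :
  (forall i, cseminorm (tau i)) -> (forall psi, exists c, forall i, tau i psi <= c) ->
  exists N, exists2 C : R, 0 <= C & forall i psi c, sbound N c psi -> tau i psi <= C * c.
Proof.
move=> htau hp; apply: contrapT => hno.
have H N (C : R) : 0 < C -> exists i psi c, sbound N c psi /\ C * c < tau i psi.
  move=> C0; apply: contrapT => h2; apply: hno; exists N, C; first exact: ltW.
  move=> i psi c hc; rewrite leNgt; apply/negP => hlt; apply: h2.
  by exists i, psi, c.
pose St := (schwartz R n * nat * {posnum R})%type.
pose P (a : St * nat) (b : St) := [/\ (maxn a.1.1.2 a.2 <= b.1.2)%N,
  b.2%:num <= a.2.+1%:R^-1,
  forall chi, sbound b.1.2 b.2%:num (chi - b.1.1) -> sbound a.1.1.2 a.1.2%:num (chi - a.1.1.1) &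
  exists i, forall chi, sbound b.1.2 b.2%:num (chi - b.1.1) -> a.2%:R <= tau i chi].
(* A state (p, N, r) is a seminorm ball around p; it shrinks to a ball on which
   some tau i is at least k. *)
have step a : exists b, P a b.
  case: a => [[[p N] r] k] /=.
  have r0 : 0 < r%:num by [].
  (* Chosen so that the multiple [xi] of [psi] with bound [r / 2] satisfies
     [tau i xi > 2 (k + 1)]. *)
  pose C := 4 * k.+1%:R / r%:num; have C0 : 0 < C by rewrite !(divr_gt0, mulr_gt0).
  have [i [psi [c [hc hlt]]]] := H N C C0.
  have c0 := sbound_ge0 hc.
  (* [c] may be 0; the midpoint is still below [tau i psi / C] and can be divided by. *)
  pose c' := (c + tau i psi / C) / 2.
  have cq : c < tau i psi / C by rewrite ltr_pdivlMr // mulrC.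
  have c'0 : 0 < c' by rewrite /c' divr_gt0 // ltr_wpDl // (le_lt_trans c0).
  have hc' : sbound N c' psi by apply: sboundW hc => //; rewrite /c' ler_pdivlMr //; lra.
  have hlt' : C * c' < tau i psi.
    by rewrite mulrC -ltr_pdivlMr // /c' ltr_pdivrMr //; lra.
  pose t := r%:num / 2 / c'; have t0 : 0 < t.
    by apply: divr_gt0 => //; apply: divr_gt0.
  pose xi := t%:C *: psi.
  have hxi : sbound N (r%:num / 2) xi.
    have e : t * c' = r%:num / 2 by rewrite /t -mulrA mulVf ?mulr1 // lt0r_neq0.
    apply: (sboundW (leqnn N) _ (sboundZ t%:C hc')).
    by rewrite rnorm_real (gtr0_norm t0) e.
  have txi : 2 * k.+1%:R < tau i xi.
    case: (htau i) => _ -> _; rewrite rnorm_real (gtr0_norm t0).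
    have -> : 2 * k.+1%:R = t * (C * c').
      rewrite /t /C; have := lt0r_neq0 c'0; have := lt0r_neq0 r0 => ? ?; field.
      by apply/andP.
    by rewrite ltr_pM2l.
  (* Since [2 xi = (p + xi) - (p - xi)], at least one of these two points has a large seminorm; it
     becomes the new centre. *)
  have [q hq hqN] : exists2 q, k.+1%:R <= tau i q & sbound N (r%:num / 2) (q - p).
    have h2 : tau i xi + tau i xi <= tau i (p + xi) + tau i (p - xi).
      have e : xi + xi = (p + xi) - (p - xi) by rewrite opprB [p + xi]addrC -addrA [p + _]addrC subrK.
      rewrite -[tau i xi + _]mulr2n -mulr_natl.
      have {1}-> : (2%:R : R) = rnorm (2%:R%:C : R[i]) by rewrite rnorm_real ger0_norm.
      case: (htau i) => _ <- _.
      have -> : (2%:R)%:C *: xi = xi + xi by rewrite rmorph_nat scaler_nat mulr2n.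
      by rewrite e; exact: cseminormB.
    have [h3|h3] := leP k.+1%:R (tau i (p + xi)).
      by exists (p + xi) => //; rewrite [X in sbound _ _ X](_ : _ = xi) // addrC addrA addNr add0r.
    exists (p - xi); last first.
      by rewrite [X in sbound _ _ X](_ : _ = - xi); [exact: sboundN|rewrite addrC addrA addNr add0r].
    by move: h2 h3 txi; rewrite -!natr1; have : 0 <= k%:R :> R by []; lra.
  have [_ _ [M [D [D0 hD]]]] := htau i.
  (* The three radii respectively nest the balls, send the radii to 0, and keep [tau i] within 1 of
     its value at [q], hence at least [k]. *)
  pose r1 := Num.min (r%:num / 2) (Num.min k.+1%:R^-1 (D + 1)^-1).
  have r10 : 0 < r1 by rewrite !lt_min divr_gt0 //= !invr_gt0 ltr0n /= ltr_wpDl.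
  exists (q, maxn (maxn N k) M, PosNum r10); split=> /=.
  - exact: leq_maxl.
  - by rewrite /r1 !ge_min lexx orbT.
  - move=> chi hchi; rewrite (_ : chi - p = (chi - q) + (q - p)); last by rewrite addrA subrK.
    apply: (sboundW (leqnn N) _ (sboundD (sboundW _ (lexx _) hchi) hqN)).
      by rewrite [leRHS]splitr lerD2r /r1 ge_min lexx.
    by rewrite -maxnA leq_maxl.
  - exists i => chi hchi.
    have h4 : tau i (chi - q) <= 1.
      have hM : sbound M r1 (chi - q) by apply: sboundW hchi => //; rewrite leq_maxr.
      rewrite (le_trans (hD _ _ hM)) //.
      apply: (@le_trans _ _ (D * (D + 1)^-1)).
        by rewrite ler_wpM2l // /r1 !ge_min lexx !orbT.
      by rewrite ler_pdivrMr ?ltr_wpDl // mul1r lerDl.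
    have h5 := cseminormB (htau i) chi (chi - q).
    have e : chi - (chi - q) = q by rewrite opprB addrC subrK.
    by move: hq h4 h5; rewrite e -natr1; lra.
have [F hF] := choice step.
pose st := fix st k : St := if k is k'.+1 then F (st k', k') else (0, 0%N, PosNum ltr01).
have hst k : P (st k, k) (st k.+1) by exact: hF.
pose u k := (st k).1.1.
have ball_sub k l : (k <= l)%N -> forall chi,
    sbound (st l).1.2 (st l).2%:num (chi - u l) -> sbound (st k).1.2 (st k).2%:num (chi - u k).
  elim: l => [|l IH]; first by rewrite leqn0 => /eqP ->.
  rewrite leq_eqVlt => /predU1P[->//|]; rewrite ltnS => kl chi hchi.
  by apply: (IH kl); have [_ _ + _] := hst l; apply.
have uin k l : (k <= l)%N -> sbound (st k).1.2 (st k).2%:num (u l - u k).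
  move=> kl; apply: ball_sub kl _ _; rewrite subrr.
  have r0 : 0 <= (st l).2%:num by [].
  by apply: (sboundW (leqnn _) r0); exact: sbound0.
(* From step [k + 1] on, the orders are at least [k] and the radii at most [1/(k+1)], so the centres
   are Cauchy in every seminorm. *)
have [psi hpsi] : exists psi, scvg u psi.
  apply: schwartz_complete => N e e0.
  have [k hk] := filter_ex (filterI (near_infty_natSinv_lt (PosNum e0)) (nbhs_infty_ge N)).
  case: hk => hk1 hk2; exists k.+1 => l kl.
  have [m1 m2 _ _] := hst k.
  apply: sboundW _ _ (uin _ _ kl).
    by rewrite (leq_trans hk2) // (leq_trans _ m1) //= leq_maxr.
  by rewrite (le_trans m2) // ltW.
have [c hc] := hp psi.
have [k hk] := filter_ex (nbhs_infty_gtr c).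
have [_ _ _ [i hi]] := hst k.
have : k%:R <= tau i psi.
  apply: hi; have cv : scvg (fun l => u l - u k.+1) (psi - u k.+1).
    apply: scvgB => // N e e0; near=> m.
    by rewrite subrr; apply: (sboundW (leqnn _) (ltW e0)); exact: sbound0.
  apply: (scvg_sbound cv) => e e0; near=> l.
  apply: (sboundW (leqnn _) _ (uin k.+1 l _)); first by rewrite lerDl ltW.
  by near: l; exact: nbhs_infty_ge.
by rewrite leNgt (le_lt_trans (hc i)).
Unshelve. all: by end_near. Qed.

End Completeness.

(** * Measure-theoretic input for slowly varying functions *)

Section SlowVariation.
Variable R : realType.
Local Notation leb := (@lebesgue_measure R).
Implicit Types (L : R -> R) (D : set R) (p q c e r : R).

(** By uniqueness of Lebesgue measure: the normalised pushforward agrees with it on half-open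
    intervals. *)
Lemma lebesgue_scale e (X : set R) : 0 < e -> measurable X ->
  leb ((fun a => a * e) @^-1` X) = ((e^-1)%:E * leb X)%E.
Proof.
move=> e0 mX; pose k : {nonneg R} := NngNum (ltW e0).
pose f : measurableTypeR R -> measurableTypeR R := fun a : R => a * e.
have mf : measurable_fun setT f.
  have : measurable_fun setT (fun a : R => a * e) by exact: measurable_funM.
  by [].
pose mu : {measure set (measurableTypeR R) -> \bar R} :=
  mscale k (measure_function_pushforward__canonical__measure_function_Measure leb mf).
have -> : leb X = mu X.
  apply: (@lebesgue_measure_unique R mu) => //= _ [[a b]] _ <-.
  have hp : f @^-1` `]a, b]%classic = `](a / e), (b / e)]%classic.
    by apply/seteqP; split => x /=; rewrite !in_itv /= ltr_pdivrMr // ler_pdivlMr.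
  have -> : mu `]a, b]%classic = (e%:E * leb (f @^-1` `]a, b]%classic))%E by [].
  rewrite hp.
  rewrite !lebesgue_measure_itv /= !lte_fin ltr_pM2r ?invr_gt0 //.
  case: ifP => _; last by rewrite mule0.
  by rewrite -!EFinD -EFinM -mulrBl mulrC divfK // gt_eqF.
by rewrite /mu /mscale /= muleA -EFinM mulVf ?gt_eqF // mul1e.
Qed.

(** Dominated convergence for indicators. It converts pointwise limits of ratios of [L] into a
    statement about the measure of exceptional sets. *)
Lemma cvg_null_sets (X : nat -> set R) p q :
  (forall l, measurable (X l)) -> (forall l, X l `<=` `[p, q]%classic) ->
  (forall a, \forall l \near \oo, ~ X l a) -> leb (X l) @[l --> \oo] --> 0%E.
Proof.
move=> mX Xpq Xn.
have [] := @dominated_convergence _ _ R leb setT measurableT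
  (fun l a => (\1_(X l) a)%:E) (fun=> 0%E) (fun a => (\1_(`[p, q]%classic) a)%:E).
- by move=> l; apply/measurable_EFinP; apply: measurable_indic; exact: mX.
- exact: measurable_cst.
- apply: aeW => a _; apply: cvg_near_cst.
  by apply: filterS (Xn a) => l hl; rewrite indicE memNset.
- exact: integrable_indic_itv.
- apply: aeW => a l _; rewrite gee0_abs ?lee_fin // !indicE.
  have [/set_mem/Xpq/mem_set -> //|_] := boolP (a \in X l).
  by rewrite ler0n.
move=> _ _; rewrite integral0.
rewrite (_ : [sequence _]_n = fun l => leb (X l)) //.
apply/funext => l; transitivity (leb (X l `&` setT)); last by rewrite setIT.
by apply: integral_indic => //; exact: mX.
Qed.

(* lebesgue_measurable_fun refers to the completed sigma-algebra, whose members
   are Borel up to a null set. *)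
Lemma lebesgue_approx D L (Y : set R) : measurable D -> lebesgue_measurable_fun D L ->
  measurable Y -> exists X Z : set R, [/\ measurable X, measurable Z, leb Z = 0%E,
    X `<=` D `&` L @^-1` Y & D `&` L @^-1` Y `<=` X `|` Z].
Proof.
move=> mD mL mY.
have mD' : (completed_algebra_gen leb).-sigma.-measurable D.
  rewrite g_sigma_completed_algebra_genE; exists D => //; exists set0; last by rewrite setU0.
  exact: negligible_set0.
have := mL mD' Y mY; rewrite g_sigma_completed_algebra_genE => -[X mX [N [Z [mZ Z0 NZ]]] e].
exists X, Z; split=> //; first by rewrite -e => x; left.
by rewrite -e; exact: setUS.
Qed.

Lemma lebesgue_approx_scale D L (Y : set R) p q e : measurable D ->
  lebesgue_measurable_fun D L -> measurable Y -> 0 < e ->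
  (forall a, p <= a <= q -> D (a * e)) ->
  exists X Z : set R, [/\ measurable X, measurable Z, leb Z = 0%E,
    (forall a, X a -> p <= a <= q /\ Y (L (a * e))) &
    (forall a, p <= a <= q -> Y (L (a * e)) -> X a \/ Z a)].
Proof.
move=> mD mL mY e0 hD.
have [X [Z [mX mZ Z0 XD DX]]] := lebesgue_approx mD mL mY.
have ms W : measurable W -> measurable ((fun a : R => a * e) @^-1` W).
  move=> mW; rewrite -[X in measurable X]setTI.
  by apply: (measurable_funM (@measurable_id _ _ setT) (@measurable_cst _ _ _ _ setT e)).
exists (`[p, q]%classic `&` (fun a => a * e) @^-1` X), ((fun a => a * e) @^-1` Z); split.
- by apply: measurableI => //; exact: ms.
- exact: ms.
- by rewrite lebesgue_scale // Z0 mule0.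
- by move=> a /= []; rewrite in_itv /= => pq /XD [].
- move=> a pq Ya; have [Xa|Za] := DX _ (conj (hD a pq) Ya); [left|by right].
  by split; rewrite //= in_itv.
Qed.

(* If the conclusion fails for every l, then each a in [1, 2] has
   2 L(e l) < L(a (e l)) or 2 L(a (e l)) < L((r l) (e l)). Both alternatives
   define sets of measure tending to 0, which cannot cover [1, 2]. *)
Lemma steinhaus D L (e r : nat -> R) : measurable D -> lebesgue_measurable_fun D L ->
  (forall x, D x -> 0 < L x) -> (forall l, 0 < e l) -> (forall l, 2^-1 <= r l <= 2) ->
  (forall l a, 4^-1 <= a <= 8 -> D (a * e l)) ->
  (forall a, 0 < a -> L (a * e l) / L (e l) @[l --> \oo] --> (1 : R)) ->
  (forall a, 0 < a -> L (a * (r l * e l)) / L (r l * e l) @[l --> \oo] --> (1 : R)) ->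
  exists l, L (r l * e l) <= 4 * L (e l).
Proof.
move=> mD mL L0 e0 r12 hD h1 h2; apply: contrapT => hno.
have r0 l : 0 < r l by have /andP[h _] := r12 l; apply: lt_le_trans h.
have eD l : D (e l) by rewrite -[e l]mul1r; apply: hD; lra.
have reD l : D (r l * e l) by have /andP[? ?] := r12 l; apply: hD; lra.
have hl l : 4 * L (e l) < L (r l * e l).
  by rewrite ltNge; apply/negP => h; apply: hno; exists l.
have A l := @lebesgue_approx_scale D L `]2 * L (e l), +oo[%classic 1 2 (e l) mD mL
  (measurable_itv _) (e0 l).
have /choice[XZ hXZ] : forall l, exists XZ : set R * set R,
    [/\ measurable XZ.1, measurable XZ.2, leb XZ.2 = 0%E,
    (forall a, XZ.1 a -> 1 <= a <= 2 /\ 2 * L (e l) < L (a * e l)) &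
    (forall a, 1 <= a <= 2 -> 2 * L (e l) < L (a * e l) -> XZ.1 a \/ XZ.2 a)].
  move=> l; have [|X [Z [q1 q2 q3 q4 q5]]] := A l.
    by move=> a /andP[? ?]; apply: hD; lra.
  exists (X, Z); split=> //=.
    by move=> a /q4 []; rewrite /= in_itv /= andbT.
  by move=> a pq ha; apply: q5 => //; rewrite /= in_itv /= andbT.
(* The range [[1/2, 4]] contains [a / r l] for every [a] in [[1, 2]]. *)
have B l := @lebesgue_approx_scale D L `]-oo, (2^-1 * L (r l * e l))[%classic 2^-1 4 (r l * e l)
  mD mL (measurable_itv _) (mulr_gt0 (r0 l) (e0 l)).
have /choice[YW hYW] : forall l, exists YW : set R * set R,
    [/\ measurable YW.1, measurable YW.2, leb YW.2 = 0%E,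
    (forall a, YW.1 a -> 2^-1 <= a <= 4 /\ L (a * (r l * e l)) < 2^-1 * L (r l * e l)) &
    (forall a, 2^-1 <= a <= 4 -> L (a * (r l * e l)) < 2^-1 * L (r l * e l) ->
       YW.1 a \/ YW.2 a)].
  move=> l; have [|X [Z [q1 q2 q3 q4 q5]]] := B l.
    move=> a /andP[? ?]; rewrite mulrA; apply: hD; have /andP[? ?] := r12 l.
    apply/andP; split; nra.
  exists (X, Z); split=> //=.
have cX : leb (XZ l).1 @[l --> \oo] --> 0%E.
  apply: (@cvg_null_sets _ 1 2) => [l|l a|a].
  - by have [] := hXZ l.
  - by have [_ _ _ h _] := hXZ l; move=> /h [h' _]; rewrite /= in_itv.
  - have [a0|a0] := ltP 0 a; last first.
      near=> l => Xa; have [_ _ _ h _] := hXZ l; have [/andP[h3 _] _] := h _ Xa.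
      by have := le_trans h3 a0; rewrite ler10.
    have /cvgrPdist_lt/(_ 1 ltr01) := h1 a a0.
    apply: filterS => l hd Xa; have [_ _ _ h _] := hXZ l; have [_ h3] := h _ Xa.
    have Le := L0 _ (eD l); move: hd; rewrite ltr_norml => /andP[h4 _].
    have : 2 < L (a * e l) / L (e l) by rewrite ltr_pdivlMr.
    by lra.
have cY : leb (YW l).1 @[l --> \oo] --> 0%E.
  apply: (@cvg_null_sets _ 2^-1 4) => [l|l a|a].
  - by have [] := hYW l.
  - by have [_ _ _ h _] := hYW l; move=> /h [h' _]; rewrite /= in_itv.
  - have [a0|a0] := ltP 0 a; last first.
      near=> l => Xa; have [_ _ _ h _] := hYW l; have [/andP[h3 _] _] := h _ Xa.
      by have := le_trans h3 a0; rewrite invr_le0 lern0.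
    have /cvgrPdist_lt/(_ 2^-1) := h2 a a0; rewrite invr_gt0 ltr0n => /(_ isT).
    apply: filterS => l hd Xa; have [_ _ _ h _] := hYW l; have [_ h3] := h _ Xa.
    have Le := L0 _ (reD l); move: hd; rewrite ltr_norml => /andP[_ h4].
    have : L (a * (r l * e l)) / L (r l * e l) < 2^-1 by rewrite ltr_pdivrMr.
    by lra.
have c4 : (0 < (4^-1 : R)%:E)%E by rewrite lte_fin invr_gt0.
have [l [lX lY]] : exists l, (leb (XZ l).1 < (4^-1 : R)%:E)%E /\ (leb (YW l).1 < (4^-1 : R)%:E)%E.
  have fX : \forall l \near \oo, (leb (XZ l).1 < (4^-1 : R)%:E)%E.
    exact: cX _ (open_ereal_lt' c4).
  have fY : \forall l \near \oo, (leb (YW l).1 < (4^-1 : R)%:E)%E.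
    exact: cY _ (open_ereal_lt' c4).
  exact: filter_ex (filterI fX fY).
have [mX mZ Z0 _ hX] := hXZ l; have [mY mW W0 _ hY] := hYW l.
pose sc (W : set R) := (fun a => a * (r l)^-1) @^-1` W.
have ri0 : 0 < (r l)^-1 by rewrite invr_gt0.
have ms W : measurable W -> measurable (sc W).
  move=> mW'; rewrite -[X in measurable X]setTI.
  by apply: (measurable_funM (@measurable_id _ _ setT) (@measurable_cst _ _ _ _ setT (r l)^-1)).
have cover : `[1, 2]%classic `<=` (XZ l).1 `|` (XZ l).2 `|` (sc (YW l).1 `|` sc (YW l).2).
  move=> a /=; rewrite in_itv /= => a12; have /andP[a1 a2] := a12.
  have [hA|hA] := ltP (2 * L (e l)) (L (a * e l)); first by left; exact: hX.
  right; apply: hY.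
    have /andP[? ?] := r12 l; rewrite ler_pdivlMr // ler_pdivrMr //; apply/andP; split; nra.
  have -> : a / r l * (r l * e l) = a * e l by rewrite mulrA divfK // gt_eqF.
  by have := hl l; lra.
have mU : measurable ((XZ l).1 `|` (XZ l).2) by exact: measurableU.
have mV : measurable (sc (YW l).1 `|` sc (YW l).2) by apply: measurableU; exact: ms.
(* Dilation by [r l <= 2] at most doubles the second measure, and [1/4 + 2/4] is less than the
   length of [[1, 2]]. *)
have h3 : (leb `[1%R, 2%R]%classic <= (4^-1 : R)%:E + (2^-1 : R)%:E)%E.
  apply: (@le_trans _ _ (leb ((XZ l).1 `|` (XZ l).2 `|` (sc (YW l).1 `|` sc (YW l).2)))).
    by apply: le_measure; rewrite ?inE //; exact: measurableU.
  apply: (le_trans (measureU2 leb mU mV)); apply: leeD.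
    by rewrite (le_trans (measureU2 leb mX mZ)) // [X in (_ + X)%E]Z0 adde0 ltW.
  rewrite (le_trans (measureU2 leb (ms _ mY) (ms _ mW))) //.
  rewrite [X in (X + _)%E](lebesgue_scale ri0 mY) [X in (_ + X)%E](lebesgue_scale ri0 mW).
  rewrite W0 mule0 adde0 invrK.
  apply: (@le_trans _ _ ((2%:R : R)%:E * (4^-1 : R)%:E)%E).
    apply: lee_pmul; [by rewrite lee_fin ltW|exact: measure_ge0| |exact: ltW].
    by rewrite lee_fin; have /andP[] := r12 l.
  by rewrite -EFinM lee_fin; lra.
move: h3; rewrite lebesgue_measure_itv /= lte_fin ltr1n -EFinD -EFinD lee_fin; lra.
Unshelve. all: by end_near. Qed.

End SlowVariation.

(** * A common setting for the origin and infinity *)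

Section Regimes.
Variable R : realType.
Implicit Types (L : R -> R) (D : set R) (e r c : R) (m k : nat).

(* The filter 0^'+ with the intervals ]0, 1/(m+1)[, or the filter +oo with the
   intervals ]m+1, +oo[. *)
Record regime (G : set_system R) (I : nat -> set R) : Prop := Regime {
  regimeP : forall A : set R, G A <-> exists m, I m `<=` A;
  regime_anti : forall m k, (m <= k)%N -> I k `<=` I m;
  regime_gt0 : forall m e, I m e -> 0 < e;
  regime_ex : forall m, exists e, I m e;
  regime_convex : forall m e e' e'', I m e -> I m e'' -> e <= e' <= e'' -> I m e';
  regime_scale : forall m c, 1 <= c -> exists k, forall e r, I k e -> c^-1 <= r <= c -> I m (r * e);
  regime_exit : forall m, exists2 C : R, 0 < C & forall e r, I m e -> 0 < r -> ~ I m (r * e) ->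
    Num.max e e^-1 <= C * Num.max r r^-1 }.

(** [D] stands for the interval []0, A]] or [[A, +oo[]. *)
Definition slowly_varying (G : set_system R) L := exists D,
  [/\ measurable D, lebesgue_measurable_fun D L, forall x, D x -> 0 < L x, G D &
   forall a, 0 < a -> L (a * e) / L e @[e --> G] --> (1 : R)].

Definition near0 m : set R := [set e | 0 < e < m.+1%:R^-1].
Definition neary m : set R := [set e | m.+1%:R < e].

Lemma max_inv_ge1 r : 0 < r -> 1 <= Num.max r r^-1.
Proof.
move=> r0; rewrite le_max; have [//|r1] := leP 1 r.
by rewrite invf_ge1 // ltW.
Qed.

Lemma regime_origin : regime 0^'+ near0.
Proof.
have m0 m : 0 < (m.+1%:R : R)^-1 by rewrite invr_gt0.
split.
- move=> A; split=> [[d /= d0 hd]|[m hm]].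
    have [m hm] := filter_ex (near_infty_natSinv_lt (PosNum d0)).
    exists m => e /andP[e0 em]; apply: hd => //=.
    by rewrite sub0r normrN gtr0_norm // (lt_trans em).
  near=> e; apply: hm; apply/andP; split; first by near: e; exact: nbhs_right_gt.
  by near: e; exact: nbhs_right_lt.
- move=> m k mk e /andP[e0 ek]; apply/andP; split=> //; apply: lt_le_trans ek _.
  by rewrite lef_pV2 ?posrE // ler_nat.
- by move=> m e /andP[].
- by move=> m; exists (m.+1%:R^-1 / 2); rewrite /near0 /= divr_gt0 //= ltr_pdivrMr // ltr_pMr // ltr1n.
- move=> m e e' e'' /andP[h1 h2] /andP[h3 h4] /andP[h5 h6].
  by rewrite /near0 /= (lt_le_trans h1 h5) (le_lt_trans h6 h4).
- move=> m c c1; have c0 : 0 < c by rewrite (lt_le_trans ltr01).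
  pose k := Num.truncn (c * m.+1%:R); exists k => e r /andP[e0 ek] /andP[r1 r2].
  have r0 : 0 < r by rewrite (lt_le_trans _ r1) // invr_gt0.
  rewrite /near0 /= mulr_gt0 //=.
  apply: (@le_lt_trans _ _ (c * e)); first by rewrite ler_wpM2r // ltW.
  rewrite -ltr_pdivlMl // (lt_le_trans ek) // -invfM lef_pV2 ?posrE ?mulr_gt0 //.
  rewrite ltW //; exact: truncnS_gt.
(* Leaving the interval means [r e >= 1/(m+1)], that is, [e^-1 <= (m+1) r], while [e] itself is
   below 1. *)
- move=> m; exists m.+1%:R => // e r /andP[e0 em] r0 hn.
  have h1 := max_inv_ge1 r0.
  have h2 : m.+1%:R^-1 <= r * e.
    by rewrite leNgt; apply/negP => h; apply: hn; rewrite /near0 /= mulr_gt0.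
  rewrite ge_max; apply/andP; split.
    apply: (@le_trans _ _ 1).
      by rewrite (le_trans (ltW em)) // invf_le1 // ler1n.
    by rewrite mulr_ege1 // ler1n.
  apply: (@le_trans _ _ (m.+1%:R * r)); last by rewrite ler_wpM2l // le_max lexx.
  by rewrite -[e^-1]mul1r ler_pdivrMr // -mulrA -ler_pdivrMl // mulr1.
Unshelve. all: by end_near. Qed.

Lemma regime_infinity : regime +oo neary.
Proof.
split.
- move=> A; split=> [[M [_ hM]]|[m hm]].
    exists (Num.truncn M) => e he; apply: hM.
    by rewrite (lt_trans _ he) // truncnS_gt.
  by exists m.+1%:R; split; [exact: num_real|exact: hm].
- by move=> m k mk e; apply: le_lt_trans; rewrite ler_nat.
- by move=> m e; apply: lt_trans.
- by move=> m; exists (m.+1%:R + 1); rewrite /neary /= ltrDl.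
- move=> m e e' e'' h1 h2 /andP[h3 h4]; exact: lt_le_trans h1 h3.
- move=> m c c1; have c0 : 0 < c by rewrite (lt_le_trans ltr01).
  pose k := Num.truncn (c * m.+1%:R); exists k => e r ek /andP[r1 r2].
  have e0 : 0 < e by exact: lt_trans ek.
  rewrite /neary /=; apply: (@lt_le_trans _ _ (c^-1 * e)); last by rewrite ler_wpM2r // ltW.
  by rewrite -ltr_pdivrMl ?invr_gt0 // invrK (lt_trans _ ek) //; exact: truncnS_gt.
- move=> m; exists m.+1%:R => // e r ek r0 hn.
  have e0 : 0 < e by exact: lt_trans ek.
  have h1 := max_inv_ge1 r0.
  have h2 : r * e <= m.+1%:R by rewrite leNgt; apply/negP => h; apply: hn.
  rewrite ge_max; apply/andP; split.
    apply: (@le_trans _ _ (m.+1%:R * r^-1)).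
      by rewrite ler_pdivlMr // mulrC.
    by rewrite ler_wpM2l // le_max lexx orbT.
  apply: (@le_trans _ _ 1).
    by rewrite invf_le1 // (le_trans _ (ltW ek)) // ler1n.
  by rewrite mulr_ege1 // ler1n.
Qed.

End Regimes.

(** * Potter bounds *)

Section Potter.
Variables (R : realType) (G : set_system R) (I : nat -> set R) (L : R -> R).
Hypothesis HG : regime G I.
Implicit Types (e r c : R) (m k : nat).

Lemma regime_filter : ProperFilter G.
Proof.
split.
  move=> /(regimeP HG)[m hm]; have [e he] := regime_ex HG m; exact: hm e he.
split.
- by apply/(regimeP HG); exists 0%N.
- move=> A B /(regimeP HG)[m hm] /(regimeP HG)[k hk]; apply/(regimeP HG).
  exists (maxn m k) => e he; split; [apply: hm|apply: hk]; apply: (regime_anti HG) he.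
    exact: leq_maxl.
  exact: leq_maxr.
- by move=> A B AB /(regimeP HG)[m hm]; apply/(regimeP HG); exists m; exact: subset_trans AB.
Qed.

Lemma regime_in m : G (I m).
Proof. by apply/(regimeP HG); exists m. Qed.

Lemma regime_seq (e : nat -> R) : (forall m, I m (e m)) -> e m @[m --> \oo] --> G.
Proof.
move=> he A /(regimeP HG)[m hm]; exists m => // k /= mk.
by apply: hm; apply: (regime_anti HG mk).
Qed.

Lemma regime_dilate (a : R) : 0 < a -> a * e @[e --> G] --> G.
Proof.
move=> a0 A /(regimeP HG)[m hm].
pose c := Num.max 1 (Num.max a a^-1).
have c1 : 1 <= c by rewrite le_max lexx.
have c0 : 0 < c by rewrite (lt_le_trans ltr01).
have [k hk] := regime_scale HG m c1.
apply/(regimeP HG); exists k => e he; apply: hm; apply: hk => //.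
apply/andP; split; last by rewrite !le_max lexx !orbT.
by rewrite -[leRHS]invrK lef_pV2 ?posrE ?invr_gt0 // !le_max lexx !orbT.
Qed.

Hypothesis HL : slowly_varying G L.

(** Failure at every [m] would give [e l] and [r l * e l], both tending to [G], along which
    pointwise slow variation holds; [steinhaus] excludes this. *)
Lemma slowly_varying_local : exists m, forall e r, I m e -> 2^-1 <= r <= 2 ->
  [/\ 0 < L e, 0 < L (r * e) & L (r * e) <= 4 * L e].
Proof.
have FG := regime_filter.
have [D [mD mL L0 GD hL]] := HL.
have [m0 hm0] := (regimeP HG D).1 GD.
have [|m1 hm1] := regime_scale HG m0 (c := 8); first by rewrite ler1n.
have dom e a : I m1 e -> 4^-1 <= a <= 8 -> D (a * e).
  by move=> he /andP[h1 h2]; apply: hm0; apply: hm1 => //; lra.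
apply: contrapT => hno.
have H m : exists er : R * R, [/\ I m er.1, I m1 er.1, 2^-1 <= er.2 <= 2, I m (er.2 * er.1) &
   4 * L er.1 < L (er.2 * er.1)].
  have [|k hk] := regime_scale HG m (c := 2); first by rewrite ler1n.
  apply: contrapT => h; apply: hno; exists (m + k + m1)%N => e r he r2.
  have he1 : I m1 e by apply: (regime_anti HG) he; rewrite leq_addl.
  have hem : I m e by apply: (regime_anti HG) he; rewrite -addnA leq_addr.
  have hek : I k e by apply: (regime_anti HG) he; rewrite addnAC leq_addl.
  have /andP[r3 r4] := r2; split.
  - by apply: L0; rewrite -[e]mul1r; apply: dom => //; lra.
  - by apply: L0; apply: dom => //; lra.
  - rewrite leNgt; apply/negP => hlt; apply: h; exists (e, r); split=> //=.
    by apply: hk.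
have [er her] := choice H.
have s1 : (er l).1 @[l --> \oo] --> G by apply: regime_seq => l; have [] := her l.
have s2 : (er l).2 * (er l).1 @[l --> \oo] --> G by apply: regime_seq => l; have [] := her l.
have [|||||l] := @steinhaus R D L (fun l => (er l).1) (fun l => (er l).2) mD mL L0.
- by move=> l; have [h _ _ _ _] := her l; exact: (regime_gt0 HG h).
- by move=> l; have [] := her l.
- by move=> l a; apply: dom; have [] := her l.
- by move=> a a0; exact: (cvg_comp _ _ s1 (hL a a0)).
- by move=> a a0; exact: (cvg_comp _ _ s2 (hL a a0)).
by rewrite leNgt; have [_ _ _ _ ->] := her l.
Qed.

Lemma potter_dyadic m : (forall e r, I m e -> 2^-1 <= r <= 2 ->
    [/\ 0 < L e, 0 < L (r * e) & L (r * e) <= 4 * L e]) ->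
  forall k e e', I m e -> I m e' -> e <= e' <= 2 ^+ k * e ->
    L e' <= 4 ^+ k * L e /\ L e <= 4 ^+ k * L e'.
Proof.
move=> h; elim=> [|k IH] e e' he he' /andP[e1 e2].
  have -> : e' = e by apply/eqP; rewrite eq_le e1 andbT; move: e2; rewrite expr0 mul1r.
  by rewrite expr0 mul1r.
have e0 := regime_gt0 HG he; have e'0 := regime_gt0 HG he'.
(* The maximum keeps [f] between [e] and [e'], hence in [I m] by convexity, and within a factor 2 of
   [e']. *)
pose f := Num.max e (e' / 2).
have ef : e <= f by rewrite le_max lexx.
have fe' : f <= e' by rewrite ge_max e1 ler_pdivrMr // ler_peMr ?ler1n // ltW.
have f0 : 0 < f by exact: lt_le_trans ef.
have hf : I m f by apply: (regime_convex HG he he'); rewrite ef fe'.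
have e'f : e' <= 2 * f by rewrite mulrC -ler_pdivrMr // le_max lexx orbT.
have [|h1 h2] := IH e f he hf.
  rewrite ef ge_max ler_peMl ?exprn_ege1 ?ler1n ?(ltW e0) //=.
  by rewrite ler_pdivrMr // mulrAC -exprSr.
have [|_ _] := h f (e' / f) hf.
  rewrite ler_pdivlMr // ler_pdivrMr // e'f andbT.
  by rewrite (le_trans _ fe') // ler_piMl ?(ltW f0) // invf_le1 // ler1n.
rewrite divfK ?gt_eqF // => h3.
have [|_ _] := h e' (f / e') he'.
  rewrite ler_pdivlMr // ler_pdivrMr //; apply/andP; split.
    by rewrite mulrC ler_pdivrMr // mulrC.
  by rewrite (le_trans fe') // ler_peMl ?(ltW e'0) // ler1n.
rewrite divfK ?gt_eqF // => h4.
have k0 : 0 <= 4 ^+ k :> R by rewrite exprn_ge0.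
split; rewrite exprS -mulrA.
  by rewrite (le_trans h3) // ler_wpM2l.
by rewrite (le_trans h2) // mulrCA ler_wpM2l.
Qed.

Lemma pow2_between (r : R) : 1 <= r -> exists k, r <= 2 ^+ k <= 2 * r.
Proof.
move=> r1; have ex : exists k, r <= 2 ^+ k.
  exists (Num.truncn r).+1; rewrite (le_trans (ltW (truncnS_gt r))) //.
  by rewrite -natrX ler_nat ltnW // ltn_expl.
case: (ex_minnP ex) => -[|k] hk hmin; first by exists 0%N; rewrite hk expr0; lra.
exists k.+1; rewrite hk exprS ler_pM2l //= ltW // ltNge; apply/negP => h.
by have := hmin _ h; rewrite ltnn.
Qed.

(** Chaining [k] dyadic steps costs [4^k = (2^k)^2], and the least [k] with [r <= 2^k] has
    [2^k <= 2 r]: hence the factor 4 and the exponent 2. A fixed exponent suffices for polynomial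
    bounds. *)
Lemma potter : exists m, (forall e, I m e -> 0 < L e) /\
  forall e r, I m e -> 0 < r -> I m (r * e) -> L (r * e) <= 4 * Num.max r r^-1 ^+ 2 * L e.
Proof.
have [m hm] := slowly_varying_local; exists m.
have L0 e : I m e -> 0 < L e by move=> he; have [|] := hm e 1 he; [lra|].
split=> // e r he r0 hre; have e0 := regime_gt0 HG he.
have P4 k (q : R) : 1 <= q -> 2 ^+ k <= 2 * q -> 4 ^+ k <= 4 * q ^+ 2.
  move=> q1 kq; have -> : 4 = 2 ^+ 2 :> R by rewrite expr2; ring.
  by rewrite -exprM mulnC exprM -exprMn lerXn2r ?nnegrE ?exprn_ge0 ?mulr_ge0 // (le_trans ler01).
have [r1|r1] := leP 1 r.
  have [k /andP[k1 k2]] := pow2_between r1.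
  have [|h _] := potter_dyadic hm (k := k) he hre.
    by rewrite ler_peMl ?(ltW e0) //= ler_wpM2r ?(ltW e0).
  apply: (le_trans h); rewrite ler_wpM2r ?(ltW (L0 _ he)) //.
  rewrite (le_trans (P4 k r r1 k2)) // ler_wpM2l // lerXn2r ?nnegrE ?le_max ?lexx ?(ltW r0) //.
have r1' : 1 <= r^-1 by rewrite invf_ge1 // ltW.
have [k /andP[k1 k2]] := pow2_between r1'.
have [|_ h] := potter_dyadic hm (k := k) hre he.
  rewrite ler_piMl ?(ltW e0) ?(ltW r1) //= mulrA ler_peMl ?(ltW e0) //.
  by rewrite -ler_pdivrMr // mul1r.
apply: (le_trans h); rewrite ler_wpM2r ?(ltW (L0 _ he)) //.
rewrite (le_trans (P4 k _ r1' k2)) // ler_wpM2l // lerXn2r ?nnegrE ?le_max ?lexx ?invr_ge0 ?(ltW r0) ?orbT //.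
Qed.

End Potter.

(** * Tempered distributions and polar coordinates on the half-space *)

Section Tempered.
Variables (R : realType) (n : nat) (E : completeNormedModType R[i]).
Implicit Types (psi chi : schwartz R n) (f g h : tempered n E) (x : 'rV[R]_n) (a y c : R).

Lemma seminorm_le_sbound N c psi k s : sbound N c psi -> (k <= N)%N -> (size s <= N)%N ->
  seminorm k s psi <= c.
Proof. by move=> h kN sN; apply: seminorm_leP => x; exact: (sbound_weight x h). Qed.

Lemma tempered_bounded f : exists M, exists2 C : R, 0 <= C &
  forall c psi, sbound M c psi -> rnorm (f psi) <= C * c.
Proof.
have /cvg_rnormP/(_ 1 ltr01) := @tempered_continuous R n E f 0.
rewrite linear0 => -[N [e [e0 hN]]].
exists N, (2 / e); first by rewrite divr_ge0 // ltW.
move=> c psi hc; have c0 := sbound_ge0 hc; apply/ler_addgt0Pr => d d0.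
(* [c] may be 0, so [psi] is normalised by a larger [b]; the excess contributes exactly [d] to the
   bound. *)
pose b := c + e * d / 2; have b0 : 0 < b by rewrite ltr_wpDl // divr_gt0 // mulr_gt0.
have hb : sbound N b psi by apply: sboundW hc => //; rewrite lerDl ltW // divr_gt0 // mulr_gt0.
pose t := e / 2 / b; have t0 : 0 < t by rewrite !divr_gt0.
have tb : t * b = e / 2 by rewrite /t -mulrA mulVf ?mulr1 // lt0r_neq0.
have /hN : sball N e 0 (t%:C *: psi).
  move=> k s kN sN; rewrite subr0; have := sboundZ t%:C hb.
  rewrite rnorm_real (gtr0_norm t0) tb => h.
  apply: (le_lt_trans (seminorm_le_sbound h kN sN)).
  by rewrite ltr_pdivrMr // ltr_pMr // ltr1n.
rewrite /= sub0r rnormN linearZ /= rnormZ rnorm_real (gtr0_norm t0) -ltr_pdivlMl //.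
move=> /ltW/le_trans; apply; rewrite mulr1 /t invf_div /b.
by rewrite (_ : _ / (e / 2) = 2 / e * c + d) //; have := lt0r_neq0 e0 => ?; field.
Qed.

Lemma bounded_continuous (g : {linear schwartz R n -> E}) N (C : R) : 0 <= C ->
  (forall c psi, sbound N c psi -> rnorm (g psi) <= C * c) -> continuous g.
Proof.
move=> C0 hC psi; have FF := snbhs_filter psi.
apply/(@cvg_rnormP R E _ (nbhs psi) _ g (g psi)) => e e0.
have C1 : 0 < C + 1 by rewrite ltr_wpDl.
exists N, (e / (C + 1)); split; first by rewrite divr_gt0.
move=> chi hchi; rewrite /= rnorm_distC -linearB.
have hs : sbound N (e / (C + 1)) (chi - psi).
  move=> s x sN; apply: le_trans (seminorm_ub N s _ x) _; apply: ltW.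
  exact: hchi.
rewrite (le_lt_trans (hC _ _ hs)) // mulrA ltr_pdivrMr // mulrC ltr_pM2l //.
by rewrite ltrDl.
Qed.

(** The reverse inequality is the same one, applied to [a^-1] and [a *: psi]. *)
Lemma cseminormZ_of_le (tau : schwartz R n -> R) : (forall psi, 0 <= tau psi) ->
  (forall (a : R[i]) psi, tau (a *: psi) <= rnorm a * tau psi) ->
  forall (a : R[i]) psi, tau (a *: psi) = rnorm a * tau psi.
Proof.
move=> t0 tZ a psi; apply/eqP; rewrite eq_le tZ /=.
have [->|a0] := eqVneq a 0; first by rewrite (rnorm0 R[i]^o) mul0r.
have e : rnorm a * rnorm a^-1 = 1 by rewrite -rnormM mulfV // rnorm1.
have := ler_wpM2l (rnorm_ge0 a) (tZ a^-1 (a *: psi)).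
by rewrite scalerA mulVf // scale1r mulrA e mul1r.
Qed.

Lemma cseminorm_rnorm (T : schwartz R n -> E) :
  (forall (a : R[i]) psi chi, T (a *: psi + chi) = a *: T psi + T chi) ->
  (exists N, exists2 C : R, 0 <= C & forall c psi, sbound N c psi -> rnorm (T psi) <= C * c) ->
  cseminorm (fun psi => rnorm (T psi)).
Proof.
move=> TP [N [C C0 hC]]; split.
- move=> psi chi; rewrite -[psi]scale1r TP !scale1r; exact: ler_rnormD.
- move=> a psi; have T0 : T 0 = 0.
    have := TP 1 0 0; rewrite !scale1r addr0 => /eqP.
    by rewrite -subr_eq0 opprD addrA subrr sub0r oppr_eq0 => /eqP.
  by rewrite -[a *: psi]addr0 TP T0 addr0 rnormZ.
- by exists N, C; split=> // c psi; exact: hC.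
Qed.

(** [r] is the Euclidean norm of [(x, y)]; the last clause compares it with [y] and with the
    sup-norm weight, in which [tbound] is expressed. *)
Lemma half_sphere_polar x y : 0 < y -> exists (r : R) x' y',
  [/\ 0 < r, half_sphere (x', y'), x = r *: x' & y = r * y'] /\
  (y <= 1 -> y <= r /\ r <= n.+1%:R * (1 + `|x|)).
Proof.
move=> y0; pose q := \sum_i x ord0 i ^+ 2 + y ^+ 2.
have s0 : 0 <= \sum_i x ord0 i ^+ 2 by apply: sumr_ge0 => i _; exact: sqr_ge0.
have q0 : 0 < q by rewrite ltr_wpDl // exprn_gt0.
pose r := Num.sqrt q; have r0 : 0 < r by rewrite sqrtr_gt0.
have rn : r != 0 by rewrite gt_eqF.
have r2 : r ^+ 2 = q by rewrite sqr_sqrtr // ltW.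
exists r, (r^-1 *: x), (r^-1 * y); split.
  split=> //.
  - split=> /=; last by rewrite mulr_gt0 // invr_gt0.
    under eq_bigr do rewrite mxE exprMn.
    by rewrite -mulr_sumr exprMn -mulrDr -/q -r2 exprVn mulVf // expf_neq0.
  - by rewrite scalerA mulfV // scale1r.
  - by rewrite mulrA mulfV // mul1r.
move=> y1; split.
  by rewrite -(ler_pXn2r (n := 2)) ?nnegrE ?(ltW y0) ?(ltW r0) // r2 /q lerDr.
have x1 := weight_ge1 x; have w0 := ltW (weight_gt0 x).
rewrite -(ler_pXn2r (n := 2)) ?nnegrE ?mulr_ge0 ?(ltW r0) //.
rewrite r2 exprMn; apply: (@le_trans _ _ (n.+1%:R * (1 + `|x|) ^+ 2)).
  rewrite -natr1 mulrDl mul1r; apply: lerD.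
    rewrite mulr_natl -[X in _ *+ X]card_ord -sumr_const ler_sum // => i _.
    rewrite -[x ord0 i ^+ 2]real_normK ?num_real // lerXn2r ?nnegrE //.
    by rewrite (le_trans (coord_le_norm x i)) // lerDr.
  by rewrite lerXn2r ?nnegrE ?(ltW y0) // (le_trans y1).
by rewrite ler_wpM2r ?exprn_ge0 // expr2 ler_peMl // ler1n.
Qed.

End Tempered.

(** * Normalised dilations of f, and necessity of the conditions *)

Section Quasiasymptotics.
Variables (R : realType) (n : nat) (E : completeNormedModType R[i]).
Variables (phi : schwartz R n) (L : R -> R) (f : tempered n E) (alpha : R) (x0 : 'rV[R]_n).
Variables (G : set_system R) (I : nat -> set R).
Hypotheses (HG : regime G I) (HL : slowly_varying G L).
Implicit Types (psi chi : schwartz R n) (x : 'rV[R]_n) (e r a y c : R).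

#[local] Instance GF : ProperFilter G := regime_filter HG.

Definition gauge e := e `^ alpha * L e.

Definition dilated e psi : E := (gauge e)^-1%:C *: f (rescale x0 e psi).

Lemma dilatedP e (b : R[i]) psi chi : 0 < e ->
  dilated e (b *: psi + chi) = b *: dilated e psi + dilated e chi.
Proof.
move=> e0; rewrite /dilated rescaleP ?gt_eqF // linearP scalerDr !scalerA.
by rewrite [b * _]mulrC.
Qed.

Lemma dilated_bounded e : 0 < e -> exists N, exists2 C : R, 0 <= C &
  forall c psi, sbound N c psi -> rnorm (dilated e psi) <= C * c.
Proof.
move=> e0; have [M [C C0 hC]] := tempered_bounded f.
pose K := ((1 + `|x0|) ^+ M * (1 + e) ^+ M * (1 + e^-1) ^+ (n + M)).
have K0 : 0 <= K.
  have ei0 : 0 <= e^-1 by rewrite invr_ge0 ltW.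
  by rewrite /K; do ![apply: mulr_ge0|apply: exprn_ge0|apply: addr_ge0] => //; exact: ltW.
exists M, (`|(gauge e)^-1| * (C * K)); first by rewrite mulr_ge0 // mulr_ge0.
move=> c psi hc; rewrite /dilated rnormZ rnorm_real -!mulrA ler_wpM2l //.
apply: (le_trans (hC _ _ (sbound_rescale x0 e0 hc))).
by rewrite [c * _]mulrC -!mulrA.
Qed.

Lemma dilated_cseminorm e : 0 < e -> cseminorm (fun psi => rnorm (dilated e psi)).
Proof.
move=> e0; apply: cseminorm_rnorm; last exact: dilated_bounded.
by move=> b psi chi; exact: dilatedP.
Qed.

Lemma gauge_gt0 : \forall e \near G, 0 < gauge e.
Proof.
have [D [_ _ L0 GD _]] := HL; near=> e.
have e0 : 0 < e by apply: (@regime_gt0 _ _ _ HG 0%N); near: e; exact: regime_in.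
by rewrite mulr_gt0 ?powR_gt0 // L0 //; near: e.
Unshelve. all: by end_near. Qed.

(** Dilating the test function by [a] amounts to working at scale [a * e]. With [gauge_ratio], this
    makes limits homogeneous and carries information from the half-sphere to the half-space. *)
Lemma dilated_rescale e a psi : 0 < e -> 0 < a -> gauge (a * e) != 0 ->
  dilated e (rescale 0 a psi) = (gauge (a * e) / gauge e)%:C *: dilated (a * e) psi.
Proof.
move=> e0 a0 ga; rewrite /dilated rescaleA ?gt_eqF // scaler0 addr0 scalerA -rmorphM.
by rewrite mulrAC mulfV // mul1r [a * e]mulrC.
Qed.

Lemma gauge_ratio a : 0 < a -> gauge (a * e) / gauge e @[e --> G] --> a `^ alpha.
Proof.
move=> a0; have [D [_ _ L0 GD hL]] := HL.
rewrite -[X in _ --> X]mulr1.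
have h : a `^ alpha * (L (a * e) / L e) @[e --> G] --> a `^ alpha * 1.
  by apply: cvgMl_tmp; exact: hL.
apply: cvg_trans h; apply: near_eq_cvg; near=> e.
have e0 : 0 < e by apply: (@regime_gt0 _ _ _ HG 0%N); near: e; exact: regime_in.
have Le : L e != 0 by rewrite gt_eqF // L0 //; near: e.
have pe : e `^ alpha != 0 by rewrite gt_eqF // powR_gt0.
by rewrite /gauge powRM ?(ltW a0) ?(ltW e0) //; field; rewrite Le pe.
Unshelve. all: by end_near. Qed.

Lemma dilated_rescale_cvg a psi (l : E) : 0 < a ->
  dilated e psi @[e --> G] --> l ->
  dilated e (rescale 0 a psi) @[e --> G] --> (a `^ alpha)%:C *: l.
Proof.
move=> a0 hl.
have h1 : dilated (a * e) psi @[e --> G] --> l.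
  exact: (cvg_comp _ _ (regime_dilate HG a0) hl).
have h2 : ((gauge (a * e) / gauge e)%:C : R[i]^o) @[e --> G] --> ((a `^ alpha)%:C : R[i]^o).
  by apply/cvg_complexP; split=> /=; [exact: gauge_ratio|exact: cvg_cst].
have h : (gauge (a * e) / gauge e)%:C *: dilated (a * e) psi @[e --> G] -->
   (a `^ alpha)%:C *: l by exact: cvgZ h2 h1.
apply: cvg_trans h; apply: near_eq_cvg; near=> e.
rewrite dilated_rescale //.
- by apply: (@regime_gt0 _ _ _ HG 0%N); near: e; exact: regime_in.
- rewrite gt_eqF //; near: e.
  exact: (regime_dilate HG a0 gauge_gt0).
Unshelve. all: by end_near. Qed.

Lemma dilated_transform e x y : 0 < e -> 0 < y ->
  dilated e (rescale x y phi) =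
  ((e `^ alpha * L e)^-1)%:C *: phi_transform phi f (x0 + e *: x) (e * y).
Proof. by move=> e0 y0; rewrite /dilated /phi_transform rescaleA ?gt_eqF. Qed.

Lemma transform_limitE (F : 'rV[R]_n -> R -> E) : transform_limit G x0 phi alpha L f F <->
  forall x y, half_sphere (x, y) -> dilated e (rescale x y phi) @[e --> G] --> F x y.
Proof.
have eqn x y : half_sphere (x, y) -> {near G, (fun e => dilated e (rescale x y phi)) =1
    (fun e => ((e `^ alpha * L e)^-1)%:C *: phi_transform phi f (x0 + e *: x) (e * y))}.
  move=> [_ /= y0]; near=> e; apply: dilated_transform => //.
  by apply: (@regime_gt0 _ _ _ HG 0%N); near: e; exact: regime_in.
split=> H x y xy; have h := H x y xy; apply: cvg_trans h; apply: near_eq_cvg.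
  by apply: filterS (eqn x y xy) => e ->.
by apply: filterS (eqn x y xy) => e ->.
Unshelve. all: by end_near. Qed.

(** On the half-sphere [|x|] and [y] are at most 1, so only the power of [1 + y^-1 <= 2 y^-1] is
    unbounded; its exponent becomes the [k] of the growth condition. *)
Lemma sbound_half_sphere N c x y : half_sphere (x, y) -> sbound N c phi ->
  sbound N (c * (4 ^+ N * 2 ^+ (n + N)) * y^-1 ^+ (n + N)) (rescale x y phi).
Proof.
move=> [/= hs y0] hc; have c0 := sbound_ge0 hc.
apply: sboundW (leqnn _) _ (sbound_rescale x y0 hc).
have s0 : 0 <= \sum_i x ord0 i ^+ 2 by apply: sumr_ge0 => i _; exact: sqr_ge0.
have y1 : y <= 1.
  by rewrite -(ler_pXn2r (n := 2)) ?nnegrE ?(ltW y0) // expr1n -hs lerDr.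
have x1 : `|x| <= 1.
  apply: row_norm_le => // i; rewrite -(ler_pXn2r (n := 2)) ?nnegrE // expr1n -hs.
  rewrite real_normK ?num_real // (bigD1 i) //= -addrA lerDl addr_ge0 ?sqr_ge0 //.
  by apply: sumr_ge0 => j _; exact: sqr_ge0.
have yi1 : 1 <= y^-1 by rewrite invf_ge1.
rewrite -!mulrA ler_wpM2l // mulrA -!exprMn; apply: ler_pM.
- by rewrite exprn_ge0 // mulr_ge0 ?addr_ge0 // ltW.
- by rewrite exprn_ge0 // addr_ge0 // (le_trans ler01).
- rewrite lerXn2r ?nnegrE ?mulr_ge0 ?addr_ge0 ?(ltW y0) //.
  have -> : 4 = 2 * 2 :> R by ring.
  by apply: ler_pM; rewrite ?addr_ge0 ?(ltW y0) // -[2]/(1 + 1) lerD2l.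
- by rewrite lerXn2r ?nnegrE ?addr_ge0 ?mulr_ge0 ?(le_trans ler01 yi1) // mulr_natl mulr2n lerD2r.
Qed.

Lemma growth_value k e x y : 0 < e -> 0 < gauge e -> half_sphere (x, y) ->
  y ^+ k / (e `^ alpha * L e) * rnorm (phi_transform phi f (x0 + e *: x) (e * y)) =
  y ^+ k * rnorm (dilated e (rescale x y phi)).
Proof.
move=> e0 ge [_ /= y0]; rewrite dilated_transform // rnormZ rnorm_real.
by rewrite -/(gauge e) ger0_norm ?invr_ge0 ?(ltW ge) // mulrA.
Qed.

Lemma transform_growthE : (exists k, transform_growth G x0 phi alpha L f k) <->
  exists k m (M : R), forall e x y, I m e -> half_sphere (x, y) ->
    y ^+ k * rnorm (dilated e (rescale x y phi)) <= M.
Proof.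
have [m0 hm0] := (regimeP HG _).1 gauge_gt0.
split=> [[k]|[k [m [M hM]]]].
  rewrite /transform_growth limf_esupE => /ereal_inf_lt[s [V GV <-]].
  set S := ereal_sup _ => Soo; have [m hm] := (regimeP HG V).1 GV.
  exists k, (maxn m m0), (fine S) => e x y he xy.
  have e0 := regime_gt0 HG he.
  have he0 : I m0 e by apply: (regime_anti HG) he; rewrite leq_maxr.
  have Ve : V e by apply: hm; apply: (regime_anti HG) he; rewrite leq_maxl.
  have hS : ((y ^+ k * rnorm (dilated e (rescale x y phi)))%:E <= S)%E.
    rewrite -(growth_value k e0 (hm0 e he0) xy).
    apply: le_trans (ereal_sup_ubound (imageP _ Ve)).
    by apply: ereal_sup_ubound; exists (x, y).
  rewrite -lee_fin fineK // fin_numElt Soo andbT.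
  by rewrite (lt_le_trans _ hS) // ltNyr.
exists k; rewrite /transform_growth limf_esupE.
apply: (@le_lt_trans _ _ M%:E); last exact: ltry.
pose q := maxn m m0.
apply: (@le_trans _ _ (ereal_sup [set ereal_sup [set (p.2 ^+ k / (e `^ alpha * L e) *
   rnorm (phi_transform phi f (x0 + e *: p.1) (e * p.2)))%:E | p in half_sphere (R := R) (n := n)] | e in I q])).
  by apply: ereal_inf_lbound; exists (I q); [exact: (regime_in HG q)|by []].
apply: ge_ereal_sup => _ [e he <-]; apply: ge_ereal_sup => _ [[x y] xy <-] /=.
have he0 : I m0 e by apply: (regime_anti HG) he; rewrite leq_maxr.
rewrite (growth_value k (regime_gt0 HG he) (hm0 e he0) xy) lee_fin.
by apply: hM => //; apply: (regime_anti HG) he; rewrite leq_maxl.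
Qed.

Lemma seq_bounded (a : nat -> R) (c : R) : (\forall m \near \oo, a m <= c) ->
  exists c', forall m, a m <= c'.
Proof.
move=> [k _ hk]; exists (`|c| + \sum_(j < k) `|a j|) => m.
have [km|mk] := leqP k m.
  rewrite (le_trans (hk m km)) // (le_trans (ler_norm c)) // lerDl sumr_ge0 //.
rewrite (bigD1 (Ordinal mk)) //= addrCA (le_trans (ler_norm (a m))) // lerDl addr_ge0 //.
by rewrite sumr_ge0.
Qed.

(** Convergence bounds each test function only on an interval that depends on it. Along a sequence
    with [e_m] in [I m], each test function is bounded for all [m], and the uniform boundedness
    principle applies. *)
Lemma quasiasymptotic_equibounded (g : schwartz R n -> E) :
  (forall psi, dilated e psi @[e --> G] --> g psi) ->
  exists m N (C : R), 0 <= C /\ forall e psi c, I m e -> sbound N c psi ->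
    rnorm (dilated e psi) <= C * c.
Proof.
move=> hg; apply: contrapT => hno.
have H m : exists epc : R * schwartz R n * R,
    [/\ I m epc.1.1, sbound m epc.2 epc.1.2 & m%:R * epc.2 < rnorm (dilated epc.1.1 epc.1.2)].
  apply: contrapT => h; apply: hno; exists m, m, m%:R; split=> // e psi c he hc.
  by rewrite leNgt; apply/negP => hlt; apply: h; exists (e, psi, c).
have [t ht] := choice H; pose ee m := (t m).1.1.
have he m : I m (ee m) by have [] := ht m.
have ce := regime_seq HG he.
have [|psi|N [C C0 hC]] := @uniform_boundedness R n nat (fun m psi => rnorm (dilated (ee m) psi)).
- by move=> m; apply: dilated_cseminorm; exact: (regime_gt0 HG (he m)).
- have /cvg_rnormP/(_ 1 ltr01) := cvg_comp _ _ ce (hg psi).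
  move=> h; apply: (@seq_bounded _ (rnorm (g psi) + 1)); apply: filterS h => m /= hm.
  have -> : dilated (ee m) psi = g psi - (g psi - dilated (ee m) psi).
    by rewrite opprB addrC subrK.
  by rewrite (le_trans (ler_rnormB _ _)) // lerD2l ltW.
(* The [m]-th choice violates order [m] with constant [m]; this [m] exceeds both the order [N] and
   the constant [C]. *)
pose m := (N + (Num.truncn C).+1)%N.
have [_ hb hlt] := ht m.
have hb' : sbound N (t m).2 (t m).1.2 by apply: sboundW hb => //; rewrite leq_addr.
have := hC m _ _ hb'; rewrite leNgt => /negP; apply; apply: le_lt_trans hlt.
rewrite ler_wpM2r ?(sbound_ge0 hb) // (le_trans (ltW (truncnS_gt C))) //.
by rewrite ler_nat leq_addl.
Qed.

Lemma necessity (g : tempered n E) : quasiasymptotic G x0 alpha L f g ->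
  (exists F, transform_limit G x0 phi alpha L f F) /\
  (exists k, transform_growth G x0 phi alpha L f k).
Proof.
move=> hg; split.
  by exists (phi_transform phi g); apply/transform_limitE => x y _; exact: hg.
apply/transform_growthE; have [m [N [C [C0 hC]]]] := quasiasymptotic_equibounded hg.
have [c hc] := sbound_ex N phi.
exists (n + N)%N, m, (C * (c * (4 ^+ N * 2 ^+ (n + N)))) => e x y he xy.
have /= y0 := xy.2; have yX : 0 < y ^+ (n + N) by rewrite exprn_gt0.
have := hC _ _ _ he (sbound_half_sphere xy hc).
by rewrite mulrA exprVn ler_pdivlMr // mulrC.
Qed.

End Quasiasymptotics.

(** * Polynomial growth on the half-space *)

Section PolynomialBounds.
Variables (R : realType) (T : Type) (S : set T) (w : T -> R).
Hypothesis w1 : forall t, S t -> 1 <= w t.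
Implicit Types (u v : T -> R).

(** A class closed under products and powers, which frees the composite bounds below from tracking
    exponents. *)
Definition polybound v := exists B K, 0 <= B /\ forall t, S t -> 0 <= v t <= B * w t ^+ K.

Lemma polybound_le u v : polybound v -> (forall t, S t -> 0 <= u t <= v t) -> polybound u.
Proof.
move=> [B [K [B0 h]]] uv; exists B, K; split=> // t St.
by have /andP[-> h1] := uv t St; have /andP[_ h2] := h t St; exact: le_trans h1 h2.
Qed.

Lemma polybound_cst (c : R) : 0 <= c -> polybound (fun=> c).
Proof. by move=> c0; exists c, 0%N; split=> // t _; rewrite expr0 mulr1 c0 /=. Qed.

Lemma polybound_w : polybound w.
Proof.
exists 1, 1%N; split=> // t St; rewrite mul1r expr1 lexx andbT.
by rewrite (le_trans ler01) // w1.
Qed.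

Lemma polyboundM u v : polybound u -> polybound v -> polybound (fun t => u t * v t).
Proof.
move=> [B [K [B0 h]]] [C [k [C0 h']]]; exists (B * C), (K + k)%N; split; first exact: mulr_ge0.
move=> t St; have /andP[h1 h2] := h t St; have /andP[h3 h4] := h' t St.
by rewrite mulr_ge0 //= exprD mulrACA ler_pM.
Qed.

Lemma polyboundX u k : polybound u -> polybound (fun t => u t ^+ k).
Proof.
move=> hu; elim: k => [|k IH].
  by apply: (polybound_le (polybound_cst ler01)) => t _; rewrite expr0 lexx ler01.
apply: (polybound_le (polyboundM hu IH)) => t St; rewrite -exprS lexx andbT exprn_ge0 //.
by have [B [K [_ h]]] := hu; have /andP[] := h t St.
Qed.

End PolynomialBounds.

Lemma powR_le_max (R : realType) (alpha : R) :
  exists a, forall r : R, 0 < r -> r `^ alpha <= Num.max r r^-1 ^+ a.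
Proof.
pose a := (Num.truncn `|alpha|).+1; exists a.
have ha (q b : R) : 1 <= q -> `|b| <= `|alpha| -> q `^ b <= q ^+ a.
  move=> q1 hb; rewrite -powR_mulrn ?(le_trans ler01) // ler_powR //.
  rewrite (le_trans (ler_norm b)) // (le_trans hb) // ltW //; exact: truncnS_gt.
move=> r r0; have [r1|r1] := leP 1 r.
  apply: (le_trans (ha r alpha r1 (lexx _))).
  by rewrite lerXn2r ?nnegrE ?le_max ?lexx ?(ltW r0).
have ri1 : 1 <= r^-1 by rewrite invf_ge1 // ltW.
have -> : r `^ alpha = r^-1 `^ (- alpha).
  by rewrite -(powR_inv1 (ltW r0)) -powRrM mulN1r opprK.
apply: (le_trans (ha _ (- alpha) ri1 _)); first by rewrite normrN.
by rewrite lerXn2r ?nnegrE ?le_max ?lexx ?orbT ?invr_ge0 ?(ltW r0).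
Qed.

Section PolarBounds.
Variables (R : realType) (n : nat) (E : completeNormedModType R[i]).
Variables (phi : schwartz R n) (L : R -> R) (f : tempered n E) (alpha : R) (x0 : 'rV[R]_n).
Variables (G : set_system R) (I : nat -> set R).
Hypothesis HG : regime G I.
Implicit Types (psi chi : schwartz R n) (x : 'rV[R]_n) (e r a y c : R).

Local Notation gam := (gauge L alpha).
Local Notation dil := (dilated L f alpha x0).

#[local] Instance GF' : ProperFilter G := regime_filter HG.

(* Points of the half-space in polar form: t = (e, (r, (x', y'))). *)
Definition polar m : set (R * (R * ('rV[R]_n * R))) := fun t =>
  [/\ I m t.1, 0 < t.2.1, half_sphere t.2.2, t.2.1 * t.2.2.2 <= 1 /\ t.2.1 * t.2.2.2 <= t.2.1 &
   t.2.1 <= n.+1%:R * (1 + `|t.2.1 *: t.2.2.1|)].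

(** At the point [(x, y) = (r x', r y')] this is [(1 + |x|) / y], whose [K]-th power is the weight
    in [tbound]. *)
Definition pweight (t : R * (R * ('rV[R]_n * R))) : R :=
  (1 + `|t.2.1 *: t.2.2.1|) / (t.2.1 * t.2.2.2).

Lemma polar_y m t : polar m t -> 0 < t.2.1 * t.2.2.2.
Proof. by move=> [_ r0 [_ y0] _ _]; rewrite mulr_gt0. Qed.

Lemma pweight_x m t : polar m t -> 1 + `|t.2.1 *: t.2.2.1| <= pweight t.
Proof.
move=> h; have y0 := polar_y h; have [_ _ _ [y1 _] _] := h.
by rewrite /pweight ler_peMr ?invf_ge1 // ltW // weight_gt0.
Qed.

Lemma pweight_ge1 m t : polar m t -> 1 <= pweight t.
Proof. by move=> h; apply: le_trans (pweight_x h); exact: weight_ge1. Qed.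

Lemma pweight_y m t : polar m t -> (t.2.1 * t.2.2.2)^-1 <= pweight t.
Proof.
move=> h; have y0 := polar_y h.
by rewrite /pweight ler_peMl ?weight_ge1 // invr_ge0 ltW.
Qed.

Lemma max_inv_ge0 r : 0 < r -> 0 <= Num.max r r^-1.
Proof. by move=> r0; rewrite le_max ltW. Qed.

Lemma polybound_radius m : polybound (polar m) pweight (fun t => Num.max t.2.1 t.2.1^-1).
Proof.
apply: (polybound_le (polyboundM (polybound_cst _ _ (ler0n R n.+1)) (polybound_w (@pweight_ge1 m)))).
move=> t h; have [_ r0 _ [y1 yr] hr] := h; have y0 := polar_y h.
rewrite max_inv_ge0 //= ge_max; apply/andP; split.
  by rewrite (le_trans hr) // ler_wpM2l // (pweight_x h).
apply: (@le_trans _ _ (pweight t)).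
  by apply: le_trans (pweight_y h); rewrite lef_pV2 ?posrE.
by rewrite ler_peMl ?ler1n // (le_trans ler01) // (pweight_ge1 h).
Qed.

(** The value at scale [e] and point [r (x', y')] is read at scale [r e] on the half-sphere: Potter
    bounds the ratio of gauges, the growth condition bounds the value, and [y'^-1 = r / (r y')] is
    absorbed by the weight. *)
Lemma polybound_in m k (M : R) :
  (forall e r, I m e -> 0 < r -> I m (r * e) -> 0 < L e /\ 0 < L (r * e) /\
     L (r * e) <= 4 * Num.max r r^-1 ^+ 2 * L e) ->
  (forall e x y, I m e -> half_sphere (x, y) ->
    y ^+ k * rnorm (dil e (rescale x y phi)) <= M) ->
  polybound (polar m `&` [set t | I m (t.2.1 * t.1)]) pweight
    (fun t => rnorm (dil t.1 (rescale 0 t.2.1 (rescale t.2.2.1 t.2.2.2 phi)))).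
Proof.
move=> hL hM; have [a ha] := powR_le_max alpha.
have sub v : polybound (polar m) pweight v ->
    polybound (polar m `&` [set t | I m (t.2.1 * t.1)]) pweight v.
  by move=> [B [K [B0 h]]]; exists B, K; split=> // t [ht _]; exact: h.
have pr := polybound_radius m.
have w1 := @pweight_ge1 m.
have w0 := polybound_w w1.
have hB := sub _ (polyboundM (polyboundM (polyboundX a pr)
   (polyboundM (polybound_cst _ _ (ler0n R 4)) (polyboundX 2 pr)))
   (polyboundM (polybound_cst _ _ (normr_ge0 M)) (polyboundX k (polyboundM pr w0)))).
apply: (polybound_le hB) => -[e [r [x y]]] [/= hp hre].
have [/= he r0 hs _ _] := hp; have y0 : 0 < y := hs.2.
have e0 := regime_gt0 HG he; have [Le [Lre hLL]] := hL e r he r0 hre.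
have mu0 := max_inv_ge0 r0; rewrite rnorm_ge0 /=.
have pe : 0 < e `^ alpha by rewrite powR_gt0.
have pre : 0 < (r * e) `^ alpha by rewrite powR_gt0 // mulr_gt0.
rewrite dilated_rescale //; last by rewrite gt_eqF // mulr_gt0.
rewrite rnormZ rnorm_real; apply: ler_pM; rewrite ?rnorm_ge0 //.
  rewrite ger0_norm; last by rewrite divr_ge0 // ltW // mulr_gt0.
  have -> : gam (r * e) / gam e = r `^ alpha * (L (r * e) / L e).
    rewrite /gauge powRM ?(ltW r0) ?(ltW e0) //; field.
    by rewrite !gt_eqF.
  apply: ler_pM; rewrite ?powR_ge0 ?divr_ge0 ?(ltW Le) ?(ltW Lre) ?ha //.
  by rewrite ler_pdivrMr.
have yk : 0 < y ^+ k by rewrite exprn_gt0.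
apply: (@le_trans _ _ (`|M| * y^-1 ^+ k)).
  rewrite exprVn ler_pdivlMr // mulrC (le_trans (hM _ _ _ hre hs)) //; exact: ler_norm.
rewrite ler_wpM2l // lerXn2r ?nnegrE ?invr_ge0 ?(ltW y0) //.
  by rewrite mulr_ge0 // (le_trans ler01) // (w1 _ hp).
have -> : y^-1 = r * (r * y)^-1 by field; rewrite !gt_eqF.
apply: ler_pM; rewrite ?(ltW r0) ?invr_ge0 ?mulr_ge0 ?(ltW y0) ?(ltW r0) ?le_max ?lexx //.
exact: (pweight_y hp).
Qed.

(* When r e leaves I m, max e e^-1 is bounded by a multiple of max r r^-1, so
   that the continuity of f gives a polynomial bound without any growth condition. *)
Lemma polybound_out m :
  (forall e, I m e -> 0 < L e) ->
  (forall e r, I m e -> 0 < r -> I m (r * e) -> L (r * e) <= 4 * Num.max r r^-1 ^+ 2 * L e) ->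
  polybound (polar m `&` [set t | ~ I m (t.2.1 * t.1)]) pweight
    (fun t => rnorm (dil t.1 (rescale 0 t.2.1 (rescale t.2.2.1 t.2.2.2 phi)))).
Proof.
move=> L0 hL; have [a ha] := powR_le_max (- alpha).
set S := _ `&` _.
have w1 t : S t -> 1 <= pweight t by move=> [h _]; exact: (pweight_ge1 h).
have w0 := polybound_w w1.
have [C C0 hC] := regime_exit HG m.
have pnu : polybound S pweight (fun t => Num.max t.1 t.1^-1).
  have [B [K [B0 h]]] := polybound_radius m.
  have pr : polybound S pweight (fun t => Num.max t.2.1 t.2.1^-1).
    by exists B, K; split=> // t [ht _]; exact: h.
  apply: (polybound_le (polyboundM (polybound_cst S pweight (ltW C0)) pr)) => t [ht hn].
  have [he r0 _ _ _] := ht; have e0 := regime_gt0 HG he.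
  by rewrite max_inv_ge0 //= hC.
(* A fixed reference scale: the Potter bound from [e] to [e1] keeps [L e] above a negative power of
   [Num.max e e^-1]. *)
have [e1 he1] := regime_ex HG m; have e10 := regime_gt0 HG he1.
have [N [Cf Cf0 hf]] := tempered_bounded f.
have [c hc] := sbound_ex N phi; have c0 := sbound_ge0 hc.
pose nu1 := Num.max e1 e1^-1; have nu10 : 0 <= nu1 := max_inv_ge0 e10.
have k2 : 0 <= (2 : R) by [].
have pN := polyboundM (polybound_cst S pweight nu10) pnu.
have cS (b : R) : 0 <= b -> polybound S pweight (fun=> b) by exact: polybound_cst.
have L1 := L0 _ he1.
have hB := polyboundM (polyboundM (polyboundX a pnu)
   (polyboundM (cS (4 / L e1) (divr_ge0 (ler0n R 4) (ltW L1))) (polyboundX 2 pN)))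
  (polyboundM (cS (Cf * c) (mulr_ge0 Cf0 c0))
   (polyboundM (polyboundM (polyboundX N (polyboundM (cS (1 + `|x0|) (ltW (weight_gt0 x0))) (polyboundM pnu w0)))
      (polyboundX N (polyboundM (cS 2 k2) pnu)))
      (polyboundX (n + N) (polyboundM (cS 2 k2) (polyboundM pnu w0))))).
apply: (polybound_le hB) => -[e [r [x y]]] [/= hp hre].
have [/= he r0 hs [ry1 yr] hr] := hp; have y0 : 0 < y := hs.2.
have e0 := regime_gt0 HG he; have Le := L0 e he.
have ry0 : 0 < r * y by rewrite mulr_gt0.
have nu1' := max_inv_ge1 e0; have nu0 := max_inv_ge0 e0.
set nu := Num.max e e^-1 in nu1' nu0 *; set W := pweight _.
have W1 : 1 <= W := pweight_ge1 hp; have W0 : 0 <= W by rewrite (le_trans ler01).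
have e_nu : e <= nu by rewrite le_max lexx.
have ei_nu : e^-1 <= nu by rewrite le_max lexx orbT.
rewrite rnorm_ge0 /= rescaleA ?gt_eqF // add0r /dilated rescaleA ?gt_eqF //.
rewrite rnormZ rnorm_real; apply: ler_pM; rewrite ?rnorm_ge0 //.
  rewrite ger0_norm; last by rewrite invr_ge0 mulr_ge0 ?powR_ge0 // ltW.
  rewrite /gauge invfM -powRN; apply: ler_pM; rewrite ?powR_ge0 ?invr_ge0 ?(ltW Le) ?ha //.
  have q1 : Num.max (e1 / e) (e1 / e)^-1 <= nu1 * nu.
    rewrite ge_max invf_div; apply/andP; split.
      by apply: ler_pM; rewrite ?invr_ge0 ?(ltW e0) ?(ltW e10) // le_max lexx.
    by rewrite mulrC; apply: ler_pM; rewrite ?invr_ge0 ?(ltW e0) ?(ltW e10) // le_max lexx orbT.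
  have q2 : L e1 <= 4 * (nu1 * nu) ^+ 2 * L e.
    have := hL e (e1 / e) he (divr_gt0 e10 e0); rewrite divfK ?gt_eqF // => /(_ he1) h1.
    apply: (le_trans h1); rewrite ler_wpM2r ?(ltW Le) // ler_wpM2l //.
    by rewrite lerXn2r ?nnegrE ?mulr_ge0 // max_inv_ge0 // divr_gt0.
  rewrite -[leLHS]mul1r ler_pdivrMr //.
  rewrite [leRHS](_ : _ = (4 * (nu1 * nu) ^+ 2 * L e) / L e1); last by ring.
  by rewrite ler_pdivlMr // mul1r.
have ery0 : 0 < e * (r * y) by rewrite mulr_gt0.
apply: (le_trans (hf _ _ (sbound_rescale _ ery0 hc))).
rewrite mulrA ler_wpM2l ?(mulr_ge0 Cf0 c0) //.
have nuW : 1 <= nu * W by rewrite mulr_ege1.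
have u1 : 1 + `|x0 + e *: (r *: x)| <= (1 + `|x0|) * (nu * W).
  apply: (le_trans (weightD _ _)); rewrite ler_wpM2l ?(ltW (weight_gt0 _)) //.
  apply: (@le_trans _ _ (nu * (1 + `|r *: x|))).
    by rewrite mulrDr mulr1 lerD // normrZ gtr0_norm // ler_wpM2r.
  by rewrite ler_wpM2l // (pweight_x hp).
have u2 : 1 + e * (r * y) <= 2 * nu.
  rewrite mulr_natl mulr2n lerD // -[leRHS]mulr1.
  by apply: ler_pM; rewrite ?(ltW e0) ?(ltW ry0).
have u3 : 1 + (e * (r * y))^-1 <= 2 * (nu * W).
  rewrite mulr_natl mulr2n lerD // invfM.
  by apply: ler_pM; rewrite ?invr_ge0 ?(ltW e0) ?(ltW ry0) // (pweight_y hp).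
have g1 : 0 <= 1 + e * (r * y) by rewrite addr_ge0 // ltW.
have g2 : 0 <= 1 + (e * (r * y))^-1 by rewrite addr_ge0 // invr_ge0 ltW.
have g3 := le_trans (ltW (weight_gt0 (x0 + e *: (r *: x)))) u1.
have g4 := le_trans g1 u2; have g5 := le_trans g2 u3.
apply: ler_pM; [| |apply: ler_pM|]; rewrite ?mulr_ge0 ?exprn_ge0 // ?(ltW (weight_gt0 _)) //.
- by rewrite lerXn2r ?nnegrE // ltW // weight_gt0.
- by rewrite lerXn2r ?nnegrE.
- by rewrite lerXn2r ?nnegrE.
Qed.

End PolarBounds.

(** * Sufficiency of the conditions *)

Section Tauberian.
Variables (R : realType) (n : nat) (E : completeNormedModType R[i]).
Variables (phi : schwartz R n) (L : R -> R) (f : tempered n E) (alpha : R) (x0 : 'rV[R]_n).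
Hypothesis phi1 : schwartz_integral phi = 1.
Variables (G : set_system R) (I : nat -> set R).
Hypotheses (HG : regime G I) (HL : slowly_varying G L).
Implicit Types (psi chi : schwartz R n) (x : 'rV[R]_n) (e r a y c d : R).

Local Notation dil := (dilated L f alpha x0).

#[local] Instance GF'' : ProperFilter G := regime_filter HG.

Lemma rescale_polar r x y psi : 0 < r -> 0 < y ->
  rescale (r *: x) (r * y) psi = rescale 0 r (rescale x y psi).
Proof. by move=> r0 y0; rewrite rescaleA ?gt_eqF // add0r. Qed.

Lemma dilatedZ e (b : R[i]) psi : 0 < e -> dil e (b *: psi) = b *: dil e psi.
Proof.
move=> e0; have D0 : dil e 0 = 0.
  have : dil e (1 *: 0 + 0) = 1 *: dil e 0 + dil e 0 by exact: dilatedP.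
  by rewrite !scale1r addr0 => /eqP; rewrite -subr_eq0 opprD addrA subrr sub0r oppr_eq0 => /eqP.
by rewrite -[b *: psi]addr0 dilatedP // D0 addr0.
Qed.

(** In polar form, either [r * e] stays in [I m], where the growth condition is available, or it
    leaves [I m]. As the weight is at least 1, adding the exponents covers both cases. *)
Lemma dilated_tbound : (exists k, transform_growth G x0 phi alpha L f k) ->
  exists K m B, 0 <= B /\ forall e, I m e -> tbound phi K (fun psi => rnorm (dil e psi)) B.
Proof.
move/(transform_growthE phi f alpha x0 HG HL) => [k [m2 [M hM]]].
have [m1 [L0 hP]] := potter HG HL.
pose m := maxn m1 m2.
have sub1 e : I m e -> I m1 e by apply: (regime_anti HG); rewrite leq_maxl.
have sub2 e : I m e -> I m2 e by apply: (regime_anti HG); rewrite leq_maxr.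
have [|e x y he|B1 [K1 [B10 h1]]] := @polybound_in R n E phi L f alpha x0 G I HG m k M.
- by move=> e r he r0 hre; split; [exact: L0 (sub1 _ he)|split; [exact: L0 (sub1 _ hre)|apply: hP; auto]].
- by apply: hM; exact: sub2.
have [|e r he r0 hre|B2 [K2 [B20 h2]]] := @polybound_out R n E phi L f alpha x0 G I HG m.
- by move=> e he; exact: L0 (sub1 _ he).
- by apply: hP => //; exact: sub1.
exists (K1 + K2)%N, m, (B1 + B2); split; first exact: addr_ge0.
move=> e he x y /andP[y0 y1].
have [r [x' [y' [[r0 hs -> ey] hr]]]] := half_sphere_polar x y0.
move: y0 y1 hr; rewrite ey => ry0 ry1 /(_ ry1)[yr hr].
have y'0 : 0 < y' := hs.2.
pose t : R * (R * ('rV[R]_n * R)) := (e, (r, (x', y'))).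
have ht : polar I m t by split.
have w1 : 1 <= pweight t := pweight_ge1 ht.
have w0 : 0 <= pweight t by rewrite (le_trans ler01).
rewrite rescale_polar // -exprMn -[_ * _^-1]/(pweight t) exprD mulrDl.
have p1 : pweight t ^+ K1 <= pweight t ^+ K1 * pweight t ^+ K2.
  by rewrite ler_peMr ?exprn_ge0 // exprn_ege1.
have p2 : pweight t ^+ K2 <= pweight t ^+ K1 * pweight t ^+ K2.
  by rewrite ler_peMl ?exprn_ge0 // exprn_ege1.
have q0 : 0 <= pweight t ^+ K1 * pweight t ^+ K2 by rewrite mulr_ge0 ?exprn_ge0.
have [hin|hout] := pselect (I m (r * e)).
  have /andP[_ h] := h1 t (conj ht hin).
  rewrite (le_trans h) // -[leLHS]addr0.
  by apply: lerD; [exact: ler_wpM2l | exact: mulr_ge0].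
have /andP[_ h] := h2 t (conj ht hout).
rewrite (le_trans h) // -[leLHS]add0r.
by apply: lerD; [exact: mulr_ge0 | exact: ler_wpM2l].
Qed.

Lemma dilated_equibounded : (exists k, transform_growth G x0 phi alpha L f k) ->
  exists m N C, 0 <= C /\ forall e psi c, I m e -> sbound N c psi ->
    rnorm (dil e psi) <= C * c.
Proof.
move/dilated_tbound => [K [m [B [B0 hB]]]].
have [N [D D0 hD]] := cseminorm_bounded phi1 K.
exists m, N, (D * B); split; first exact: mulr_ge0.
move=> e psi c he; apply: (hD (fun psi => rnorm (dil e psi)) B psi c _ B0 (hB e he)).
exact: dilated_cseminorm (regime_gt0 HG he).
Qed.

(* osc psi is the upper limit of |dil e psi - dil e' psi|: a continuous seminorm
   which vanishes on the rescalings of phi, hence everywhere. *)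
Definition oscillates psi d := 0 <= d /\
  exists m, forall e e', I m e -> I m e' -> rnorm (dil e psi - dil e' psi) <= d.

Definition osc psi := inf (oscillates psi).

Section Oscillation.
Variables (m0 N : nat) (C : R).
Hypotheses (C0 : 0 <= C)
  (hC : forall e psi c, I m0 e -> sbound N c psi -> rnorm (dil e psi) <= C * c).

Lemma oscillates_sbound psi c : sbound N c psi -> oscillates psi (2 * C * c).
Proof.
move=> hc; have c0 := sbound_ge0 hc; split; first by rewrite !mulr_ge0.
exists m0 => e e' he he'; rewrite (le_trans (ler_rnormB _ _)) //.
rewrite (_ : 2 * C * c = C * c + C * c); last by ring.
by rewrite lerD // hC.
Qed.

Lemma osc_le psi d : oscillates psi d -> osc psi <= d.
Proof. by move=> h; apply: ge_inf => //; exists 0 => d' [d0 _]. Qed.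

(** Equicontinuity makes the set nonempty; on an empty set [inf] would only be a default value. *)
Lemma osc_has_inf psi : has_inf (oscillates psi).
Proof.
split; last by exists 0 => d [d0 _].
by have [c hc] := sbound_ex N psi; exists (2 * C * c); exact: oscillates_sbound.
Qed.

Lemma osc_ge0 psi : 0 <= osc psi.
Proof. by apply: lb_le_inf; [exact: (osc_has_inf psi).1|move=> d [d0 _]]. Qed.

Lemma osc_adherent psi d : 0 < d -> exists2 d', oscillates psi d' & d' < osc psi + d.
Proof. by move=> d0; exact: inf_adherent d0 (osc_has_inf psi). Qed.

Lemma osc_cseminorm : cseminorm osc.
Proof.
have oscZ (b : R[i]) psi : osc (b *: psi) <= rnorm b * osc psi.
  have b0 : 0 <= rnorm b := rnorm_ge0 b.
  apply/ler_addgt0Pr => e e0.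
  have b1 : 0 < rnorm b + 1 by rewrite ltr_wpDl.
  have [d [d0 [m hd]] hlt] := osc_adherent psi (divr_gt0 e0 b1).
  apply: (@le_trans _ _ (rnorm b * d)).
    apply: osc_le; split; first by rewrite mulr_ge0.
    exists m => e1 e2 he1 he2; have e10 := regime_gt0 HG he1; have e20 := regime_gt0 HG he2.
    by rewrite !dilatedZ // -scalerBr rnormZ ler_wpM2l // hd.
  apply: (le_trans (ler_wpM2l b0 (ltW hlt))); rewrite mulrDr lerD2l mulrA ler_pdivrMr //.
  by rewrite mulrC ler_wpM2l ?lerDl // ltW.
split.
- move=> psi chi; apply/ler_addgt0Pr => e e0.
  have e2 : 0 < e / 2 by rewrite divr_gt0.
  have [d1 [d10 [m1 h1]] l1] := osc_adherent psi e2.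
  have [d2 [d20 [m2 h2]] l2] := osc_adherent chi e2.
  apply: (@le_trans _ _ (d1 + d2)); last by move: l1 l2; lra.
  apply: osc_le; split; first exact: addr_ge0.
  exists (maxn m1 m2) => e1 e2' he1 he2.
  have e10 := regime_gt0 HG he1; have e20 := regime_gt0 HG he2.
  have D e' : 0 < e' -> dil e' (psi + chi) = dil e' psi + dil e' chi.
    by move=> e'0; rewrite -[psi in LHS]scale1r dilatedP // scale1r.
  rewrite !D // opprD addrACA (le_trans (ler_rnormD _ _)) // lerD //.
    by apply: h1; apply: (regime_anti HG (leq_maxl m1 m2)).
  by apply: h2; apply: (regime_anti HG (leq_maxr m1 m2)).
- exact: cseminormZ_of_le osc_ge0 oscZ.
- exists N, (2 * C); split; first exact: mulr_ge0.
  by move=> c psi hc; apply: osc_le; exact: oscillates_sbound.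
Qed.

Lemma osc_cvg psi (l : E) : dil e psi @[e --> G] --> l -> osc psi <= 0.
Proof.
move=> hl; apply/ler_addgt0Pr => d d0; rewrite add0r.
have d2 : 0 < d / 2 by rewrite divr_gt0.
have /cvg_rnormP/(_ _ d2)/(regimeP HG)[m hm] := hl.
apply: osc_le; split; first exact: ltW.
exists m => e e' he he'.
have -> : dil e psi - dil e' psi = (l - dil e' psi) - (l - dil e psi).
  by rewrite opprB [RHS]addrC addrA subrK.
by rewrite (le_trans (ler_rnormB _ _)) // [d]splitr lerD // ltW // hm.
Qed.

(** Vanishing oscillation is the Cauchy property, and [E] is complete. *)
Lemma cvg_osc psi : osc psi <= 0 -> exists l : E, dil e psi @[e --> G] --> l.
Proof.
move=> h0; exists (lim (dil e psi @[e --> G]) : E); apply: cauchy_cvg; apply: cauchy_exP => -[d b].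
rewrite ltcE /= => /andP[/eqP -> d0].
have [d' [_ [m hm]] hlt] := osc_adherent psi d0.
have [e0 he0] := regime_ex HG m; exists (dil e0 psi).
apply/(regimeP HG); exists m => e he; rewrite /= -ball_normE /= rnormE ltcR.
by rewrite (le_lt_trans (hm _ _ he0 he)) // (lt_le_trans hlt) // gerDr.
Qed.

End Oscillation.

(** Convergence spreads from the half-sphere along rays, since a dilation only multiplies the limit
    by [r ^ alpha]. *)
Lemma dilated_transform_cvg F x y : transform_limit G x0 phi alpha L f F -> 0 < y ->
  exists l : E, dil e (rescale x y phi) @[e --> G] --> l.
Proof.
move/(transform_limitE phi L f alpha x0 HG) => hF y0.
have [r [x' [y' [[r0 hs -> ->] _]]]] := half_sphere_polar x y0.
rewrite rescale_polar //; last exact: hs.2.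
exists ((r `^ alpha)%:C *: F x' y').
by apply: (dilated_rescale_cvg HG HL r0); exact: hF.
Qed.

Lemma sufficiency F : transform_limit G x0 phi alpha L f F ->
  (exists k, transform_growth G x0 phi alpha L f k) ->
  exists g : tempered n E, homogeneous alpha g /\ quasiasymptotic G x0 alpha L f g.
Proof.
move=> hF /dilated_equibounded[m [N [C [C0 hC]]]].
have cv psi : exists l : E, dil e psi @[e --> G] --> l.
  apply: (cvg_osc C0 hC).
  (* [osc] vanishes on all rescalings of [phi], so [tbound] holds with [K = 0] and [B = 0], and the
     resulting bound is 0. *)
  have [N' [D D0 hD]] := cseminorm_bounded phi1 0.
  have [c hc] := sbound_ex N' psi.
  rewrite (le_trans (hD osc 0 psi c (osc_cseminorm C0 hC) (lexx _) _ hc)) ?mulr0 ?mul0r //.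
  move=> x y /andP[y0 _]; rewrite mul0r.
  by have [l hl] := dilated_transform_cvg x hF y0; exact: osc_cvg hl.
have [g hg] := choice cv.
have gP : linear g.
  move=> b psi chi; apply: (@norm_cvg_unique _ E (dil e (b *: psi + chi) @[e --> G])); first exact: hg.
  have h : b *: dil e psi + dil e chi @[e --> G] --> b *: g psi + g chi.
    by apply: cvgD; [apply: cvgZ; [exact: cvg_cst|exact: hg]|exact: hg].
  apply: cvg_trans h; apply: near_eq_cvg; near=> e.
  rewrite dilatedP //; apply: (@regime_gt0 _ _ _ HG 0%N); near: e; exact: regime_in.
pose gl := HB.pack_for {linear schwartz R n -> E} g (GRing.isLinear.Build R[i] _ E _ g gP).
have gc : continuous gl.
  apply: (bounded_continuous C0) => c psi hc.
  apply: (cvg_rnorm_le (hg psi)); near=> e; apply: hC hc.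
  by near: e; exact: regime_in.
exists (Tempered gc); split; last exact: hg.
(* Homogeneity: the limit on the dilated test function is computed in two ways. *)
move=> a psi a0; apply: (@norm_cvg_unique _ E (dil e (rescale 0 a psi) @[e --> G])).
- exact: hg.
- by apply: (dilated_rescale_cvg HG HL a0); exact: hg.
Unshelve. all: by end_near. Qed.

Lemma quasiasymptotic_transform F (g : tempered n E) :
  transform_limit G x0 phi alpha L f F -> quasiasymptotic G x0 alpha L f g ->
  forall x y, half_sphere (x, y) -> phi_transform phi g x y = F x y.
Proof.
move/(transform_limitE phi L f alpha x0 HG) => hF hg x y xy.
apply: (@norm_cvg_unique _ E (dil e (rescale x y phi) @[e --> G])).
- exact: hg.
- exact: hF.
Qed.

End Tauberian.

(** * Uniqueness, and the two cases of the theorem *)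

Lemma homogeneous_transform_inj (R : realType) (n : nat) (E : completeNormedModType R[i])
    (phi : schwartz R n) (alpha : R) (g h : tempered n E) :
  schwartz_integral phi = 1 -> homogeneous alpha g -> homogeneous alpha h ->
  (forall x y, half_sphere (x, y) -> phi_transform phi h x y = phi_transform phi g x y) ->
  forall psi, h psi = g psi.
Proof.
move=> phi1 hg hh e psi; apply/eqP; rewrite -subr_eq0; apply/eqP/rnorm_eq0.
have ct : cseminorm (fun psi => rnorm (h psi - g psi)).
  apply: cseminorm_rnorm => [b p q|].
    rewrite (linearP h) (linearP g) scalerBr.
    by rewrite opprD addrACA.
  have [M [C C0 hC]] := tempered_bounded h; have [M' [C' C'0 hC']] := tempered_bounded g.
  exists (maxn M M'), (C + C'); first exact: addr_ge0.
  move=> c p hc; rewrite (le_trans (ler_rnormB _ _)) // mulrDl lerD //.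
    by apply: hC; apply: sboundW hc => //; rewrite leq_maxl.
  by apply: hC'; apply: sboundW hc => //; rewrite leq_maxr.
have [N [D D0 hD]] := cseminorm_bounded phi1 0.
have [c hc] := sbound_ex N psi.
apply/eqP; rewrite eq_le rnorm_ge0 andbT.
(* By homogeneity the two transforms agree on the whole half-space, so the bound on the rescalings
   is 0. *)
rewrite (le_trans (hD _ 0 psi c ct (lexx _) _ hc)) ?mulr0 ?mul0r //.
move=> x y /andP[y0 _]; rewrite mul0r.
have [r [x' [y' [[r0 hs -> ->] _]]]] := half_sphere_polar x y0.
rewrite rescale_polar ?(hs.2) // hg // hh //.
by have := e _ _ hs; rewrite /phi_transform => ->; rewrite subrr rnorm0.
Qed.

Lemma slowly_varying_originP (R : realType) (L : R -> R) :
  slowly_varying_origin L -> slowly_varying 0^'+ L.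
Proof.
move=> [A A0 [mL L0 hL]]; have hA : \forall e \near 0^'+, `]0, A]%classic e.
  near=> e; rewrite /= in_itv /=; apply/andP; split; near: e.
    exact: nbhs_right_gt.
  exact: nbhs_right_le.
exists `]0, A]%classic; split=> // x; rewrite /= in_itv; exact: L0.
Unshelve. all: by end_near. Qed.

Lemma slowly_varying_infinityP (R : realType) (L : R -> R) :
  slowly_varying_infinity L -> slowly_varying +oo L.
Proof.
move=> [A A0 [mL L0 hL]]; have hA : \forall e \near +oo, `[A, +oo[%classic e.
  by near=> e; rewrite /= in_itv /= andbT; near: e; apply: nbhs_pinfty_ge; rewrite num_real.
exists `[A, +oo[%classic; split=> // x; rewrite /= in_itv /= andbT; exact: L0.
Unshelve. all: by end_near. Qed.

Theorem theorem6p4 (R : realType) (n : nat) (n_gt0 : (0 < n)%N)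
    (E : completeNormedModType R[i]) (phi : schwartz R n)
    (phi1 : schwartz_integral phi = 1) (L : R -> R) (f : tempered n E)
    (alpha : R) (x0 : 'rV[R]_n) :
  (slowly_varying_origin L ->
    (((exists F, transform_limit 0^'+ x0 phi alpha L f F) /\
      (exists k, transform_growth 0^'+ x0 phi alpha L f k))
     <->
     (exists g : tempered n E,
        homogeneous alpha g /\ quasiasymptotic 0^'+ x0 alpha L f g)) /\
    (forall F (g : tempered n E),
       transform_limit 0^'+ x0 phi alpha L f F ->
       homogeneous alpha g -> quasiasymptotic 0^'+ x0 alpha L f g ->
       (forall x y, half_sphere (x, y) -> phi_transform phi g x y = F x y) /\
       (forall h : tempered n E, homogeneous alpha h ->
          (forall x y, half_sphere (x, y) -> phi_transform phi h x y = F x y) ->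
          forall psi, h psi = g psi)))
  /\
  (slowly_varying_infinity L ->
    (((exists F, transform_limit +oo 0 phi alpha L f F) /\
      (exists k, transform_growth +oo 0 phi alpha L f k))
     <->
     (exists g : tempered n E,
        homogeneous alpha g /\ quasiasymptotic +oo 0 alpha L f g)) /\
    (forall F (g : tempered n E),
       transform_limit +oo 0 phi alpha L f F ->
       homogeneous alpha g -> quasiasymptotic +oo 0 alpha L f g ->
       (forall x y, half_sphere (x, y) -> phi_transform phi g x y = F x y) /\
       (forall h : tempered n E, homogeneous alpha h ->
          (forall x y, half_sphere (x, y) -> phi_transform phi h x y = F x y) ->
          forall psi, h psi = g psi))).
Proof.
have main (G : set_system R) (I : nat -> set R) (z : 'rV[R]_n) : regime G I ->
    slowly_varying G L ->
    (((exists F, transform_limit G z phi alpha L f F) /\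
      (exists k, transform_growth G z phi alpha L f k))
     <->
     (exists g : tempered n E,
        homogeneous alpha g /\ quasiasymptotic G z alpha L f g)) /\
    (forall F (g : tempered n E),
       transform_limit G z phi alpha L f F ->
       homogeneous alpha g -> quasiasymptotic G z alpha L f g ->
       (forall x y, half_sphere (x, y) -> phi_transform phi g x y = F x y) /\
       (forall h : tempered n E, homogeneous alpha h ->
          (forall x y, half_sphere (x, y) -> phi_transform phi h x y = F x y) ->
          forall psi, h psi = g psi)).
  move=> HG HL; split; first split.
  - by move=> [[F hF] hk]; exact: (sufficiency phi1 HG HL hF hk).
  - by move=> [g [_ hg]]; exact: (necessity phi HG HL hg).
  move=> F g hF hg hq; have gF := quasiasymptotic_transform HG hF hq.
  split=> // h hh hF'; apply: (homogeneous_transform_inj phi1 hg hh) => x y xy.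
  by rewrite gF // hF'.
split=> [/slowly_varying_originP|/slowly_varying_infinityP]; apply: main.
- exact: regime_origin.
- exact: regime_infinity.
Qed.
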